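(* Let $\Omega\subseteq\mathbb{R}^n$ be open. The map $\mathcal{B}(\Omega)\to\mathcal{E}^s(\Omega)$, $R\mapsto R^s$, has the following properties: (i) $(\iota u)^s=\iota^su$ for $u\in\mathcal{D}'(\Omega)$. (ii) $(\sigma f)^s=\sigma^sf$ for $f\in C^\infty(\Omega)$. (iii) $R^s\in\mathcal{E}^s_M(\Omega)$ for $R\in\mathcal{M}(\Omega)$. (iv) $R^s\in\mathcal{N}^s(\Omega)$ for $R\in\mathcal{N}(\Omega)$.
   Context: Notation: $\mathbb{N}=\{1,2,\dots\}$, $\mathbb{N}_0=\{0,1,2,\dots\}$, $\mathbb{R}^+=[0,\infty)$. $K\Subset L$ means that $K$ is compact and contained in the interior of $L$. $\mathcal{U}_x(\Omega)$ is the set of open neighborhoods of $x$ in $\Omega$. $B_r(x)$ is the open Euclidean ball. $C^\infty(U)$ is the space of complex-valued smooth functions on $U$, $\mathcal{D}(\Omega)$ the space of test functions with its usual topology, $\mathcal{D}'(\Omega)$ the space of distributions, $\mathcal{S}(\mathbb{R}^n)$ the Schwartz space, $\mathcal{D}_L(U)$ the space of test functions on $U$ with support in $L$. Smoothness of maps between locally convex spaces is understood in the sense of convenient calculus (Kriegl--Michor), and $\mathrm{d}^k R$ denotes the $k$-th differential. Basic space: $\mathcal{B}(\Omega)$ is the set of sheaf homomorphisms from $C^\infty(-,\mathcal{D}(\Omega))$ to $C^\infty(-)$, both regarded as sheaves on $\Omega$ with values in the category of locally convex spaces with smooth maps. That is, $R\in\mathcal{B}(\Omega)$ is a family $(R_U)_U$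 of smooth maps $R_U: C^\infty(U,\mathcal{D}(\Omega))\to C^\infty(U)$ ($U\subseteq\Omega$ open) with $R_U(\vec\varphi)|_V=R_V(\vec\varphi|_V)$ for all open $V\subseteq U$. One writes $R$ for $R_U$. Embeddings: $(\iota u)(\vec\varphi)(x)=\langle u,\vec\varphi(x)\rangle$ for $u\in\mathcal{D}'(\Omega)$ and $(\sigma f)(\vec\varphi)(x)=f(x)$ for $f\in C^\infty(\Omega)$, where $\vec\varphi\in C^\infty(U,\mathcal{D}(\Omega))$, $x\in U$. Seminorms: for $U\subseteq\Omega$ open, $K,L\Subset U$, $m,c,l\in\mathbb{N}_0$, $B$ a bounded set of smooth functions on $\Omega$, and $\vec\varphi\in C^\infty(U,\mathcal{D}_L(U))$: $\|f\|_{K,m}=\sup_{x\in K,|\alpha|\le m}|\partial^\alpha f(x)|$; $\|\vec\varphi\|_{K,c;L,l}=\sup_{x\in K,|\alpha|\le c,\,y\in L,|\beta|\le l}|\partial_x^\alpha\partial_y^\beta\vec\varphi(x)(y)|$; $\|\vec\varphi\|_{K,c;B}=\sup_{x\in K,|\alpha|\le c,\,f\in B}|\int f(y)\,\partial_x^\alpha\vec\varphi(x)(y)\,dy|$; $\|\vec\varphi-\vec\delta\|_{K,c;B}=\sup_{x\in K,|\alpha|\le c,\,f\in B}|\int f(y)\,\partial_x^\alpha\vec\varphi(x)(y)\,dy-\partial^\alpha f(x)|$ (here $\vec\delta(x)=\delta_x$). Polynomials: $\mathcal{P}_k=\mathbb{R}^+[y_0,\dots,y_k]$ (polynomials with coefficients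 in $\mathbb{R}^+$); $\mathcal{I}_k=\{\lambda\in\mathbb{R}^+[y_0,\dots,y_k,z_0,\dots,z_k] : \lambda(y_0,\dots,y_k,0,\dots,0)=0\}$. $R\in\mathcal{B}(\Omega)$ is moderate ($R\in\mathcal{M}(\Omega)$) if: $(\forall x\in\Omega)(\exists U\in\mathcal{U}_x(\Omega))(\forall K,L\Subset U)(\forall m,k\in\mathbb{N}_0)(\exists c,l\in\mathbb{N}_0)(\exists\lambda\in\mathcal{P}_k)(\forall\vec\varphi_0,\dots,\vec\varphi_k\in C^\infty(U,\mathcal{D}_L(U)))$: $\|\mathrm{d}^kR(\vec\varphi_0)(\vec\varphi_1,\dots,\vec\varphi_k)\|_{K,m}\le\lambda(\|\vec\varphi_0\|_{K,c;L,l},\dots,\|\vec\varphi_k\|_{K,c;L,l})$. $R\in\mathcal{B}(\Omega)$ is negligible ($R\in\mathcal{N}(\Omega)$) if: $(\forall x\in\Omega)(\exists U\in\mathcal{U}_x(\Omega))(\forall K,L\Subset U)(\forall m,k\in\mathbb{N}_0)(\exists c,l\in\mathbb{N}_0)(\exists\lambda\in\mathcal{I}_k)(\exists B\subseteq C^\infty(\Omega)\text{ bounded})(\forall\vec\varphi_0,\dots,\vec\varphi_k\in C^\infty(U,\mathcal{D}_L(U)))$: $\|\mathrm{d}^kR(\vec\varphi_0)(\vec\varphi_1,\dots,\vec\varphi_k)\|_{K,m}\le\lambda(\|\vec\varphi_0\|_{K,c;L,l},\dots,\|\vec\varphi_k\|_{K,c;L,l},\|\vec\varphi_0-\vec\delta\|_{K,c;B},\|\vec\varphi_1\|_{K,c;B},\dots,\|\vec\varphi_k\|_{K,c;B})$.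 Special algebra: fix $\rho\in\mathcal{S}(\mathbb{R}^n)$ with $\int\rho(x)\,dx=1$ and $\int x^\alpha\rho(x)\,dx=0$ for all $\alpha\in\mathbb{N}_0^n\setminus\{0\}$, and $\chi\in\mathcal{D}(\mathbb{R}^n)$ with $0\le\chi\le1$, $\chi\equiv1$ on $B_1(0)$, $\operatorname{supp}\chi\subseteq B_2(0)$. For $\varepsilon>0$ set $\rho_\varepsilon(y)=\varepsilon^{-n}\rho(y/\varepsilon)$, $\theta_\varepsilon(y)=\rho_\varepsilon(y)\,\chi(y|\ln\varepsilon|)$, $K_\varepsilon=\{x\in\Omega : d(x,\mathbb{R}^n\setminus\Omega)\ge\varepsilon\}\cap B_{1/\varepsilon}(0)$ (a relatively compact subset of $\Omega$), choose $\kappa_\varepsilon\in\mathcal{D}(\Omega)$ with $0\le\kappa_\varepsilon\le1$ and $\kappa_\varepsilon\equiv1$ on $K_\varepsilon$, and put $\vec\psi_\varepsilon(x)(y)=\theta_\varepsilon(x-y)\kappa_\varepsilon(y)$, so $\vec\psi_\varepsilon\in C^\infty(\Omega,\mathcal{D}(\Omega))$. With $I=(0,1]$ and $O$-estimates for $\varepsilon\to0$: $\mathcal{E}^s(\Omega)=C^\infty(\Omega)^I$; $\mathcal{E}^s_M(\Omega)=\{(u_\varepsilon)_\varepsilon\in\mathcal{E}^s(\Omega) : \forall K\Subset\Omega\ \forall m\in\mathbb{N}_0\ \exists N\in\mathbb{N}: \|u_\varepsilon\|_{K,m}=O(\varepsilon^{-N})\}$; $\mathcal{N}^s(\Omega)=\{(u_\varepsilon)_\varepsilon\in\mathcal{E}^s(\Omega)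 : \forall K\Subset\Omega\ \forall m\in\mathbb{N}_0\ \forall N\in\mathbb{N}: \|u_\varepsilon\|_{K,m}=O(\varepsilon^{N})\}$; $(\iota^su)_\varepsilon(x)=\langle u,\vec\psi_\varepsilon(x)\rangle$ for $u\in\mathcal{D}'(\Omega)$; $(\sigma^sf)_\varepsilon=f$ for $f\in C^\infty(\Omega)$. The map: for $R\in\mathcal{B}(\Omega)$, $R^s=(R^s_\varepsilon)_\varepsilon\in\mathcal{E}^s(\Omega)$ is defined by $R^s_\varepsilon(x)=R(\vec\psi_\varepsilon)(x)$. *)

(* Defs.v *)
From HB Require Import structures.
From mathcomp Require Import all_boot all_order all_algebra.
From mathcomp Require Import all_classical all_reals all_analysis.
From mathcomp Require Import complex.
From mathcomp Require mpoly.

Set Implicit Arguments.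
Unset Strict Implicit.
Unset Printing Implicit Defensive.

Import Order.TTheory GRing.Theory Num.Theory.
Import numFieldNormedType.Exports.

Local Open Scope classical_set_scope.
Local Open Scope ring_scope.

(* Complex values live in [Rcomplex R], i.e. R[i] with its structure of normed
   real vector space: [`|z|] is the modulus, an element of R.

   A function on an open set U is represented by its extension by 0 to R^n, so
   that Leibniz equality of representatives is equality of functions on U. *)

Section Euclidean.
Variables (R : realType) (n : nat).
Implicit Types (x y : 'rV[R]_n) (U K L : set 'rV[R]_n).

Definition enorm x : R := Num.sqrt (\sum_i x ord0 i ^+ 2).

Definition csub K L : Prop := compact K /\ K `<=` L°.

Definition restr (V : nmodType) U (f : 'rV[R]_n -> V) : 'rV[R]_n -> V :=
  patch (fun=> 0) U f.

Definition mi_deg (a : {ffun 'I_n -> nat}) : nat := (\sum_i a i)%N.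

Definition monomial (a : {ffun 'I_n -> nat}) x : R := \prod_i x ord0 i ^+ a i.

End Euclidean.

(* The Lebesgue integral over R^n as an iterated integral.  By Fubini this is
   the usual integral for the integrands met below, which are continuous and
   either compactly supported or rapidly decreasing. *)
Fixpoint rint (R : realType) (n : nat) : ('rV[R]_n -> R) -> R :=
  match n return ('rV[R]_n -> R) -> R with
  | 0 => fun f => f 0
  | m.+1 => fun f => \int[@lebesgue_measure R]_t
              rint (fun y : 'rV[R]_m => f (row_mx (const_mx t : 'rV[R]_1) y))
  end.

Section Calculus.
Variables (R : realType) (n : nat).
Local Notation C := (Rcomplex R).
Local Notation E := 'rV[R]_n.
Implicit Types (f g : E -> C) (U K L : set E) (x y : E).

Definition cint f : C := Complex (rint (fun y => complex.Re (f y)))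
                                 (rint (fun y => complex.Im (f y))).

Definition partial (i : 'I_n) f : E -> C := fun x =>
  Complex ('D_(delta_mx 0 i) (fun y => complex.Re (f y)) x)
          ('D_(delta_mx 0 i) (fun y => complex.Im (f y)) x).

Definition pderiv (a : {ffun 'I_n -> nat}) f : E -> C :=
  foldr (fun i g => iter (a i) (partial i) g) f (enum 'I_n).

Fixpoint Ck (k : nat) U f : Prop :=
  (forall x, U x -> {for x, continuous (fun y => complex.Re (f y))} /\
                    {for x, continuous (fun y => complex.Im (f y))}) /\
  match k with
  | 0 => True
  | k'.+1 => forall i : 'I_n,
      (forall x, U x -> derivable (fun y => complex.Re (f y)) x (delta_mx 0 i) /\
                        derivable (fun y => complex.Im (f y)) x (delta_mx 0 i)) /\
      Ck k' U (partial i f)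
  end.

Definition smooth_on U f : Prop := forall k, Ck k U f.

Definition supp f : set E := closure [set y | f y <> 0].

(* All the suprema below are taken over bounded sets of nonnegative reals, with
   the convention [sup set0 = 0]. *)
Definition snorm K (m : nat) f : R :=
  sup [set r | exists x a, [/\ K x, (mi_deg a <= m)%N & r = `|pderiv a f x| ]].

Definition schwartz f : Prop := smooth_on setT f /\
  forall a b : {ffun 'I_n -> nat}, exists M : R,
    forall x, `|monomial a x *: pderiv b f x| <= M.

End Calculus.

(* A locally convex space: a linear subspace of V together with a opfamily of
   seminorms, meaningful on that subspace, generating its topology. *)
Record lcs (R : realType) (V : lmodType R) := Lcs {
  lcs_pts : set V;
  lcs_seminorms : set (V -> R)
}.

Section ConvenientCalculus.
Variable R : realType.

Definition is_curve_deriv (V : lmodType R) (F : lcs V) (c : R -> V) (t : R)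
    (v : V) : Prop :=
  forall p, lcs_seminorms F p ->
    (fun h : R => p (h^-1 *: (c (t + h) - c t) - v)) @ (0 : R)^' --> (0 : R).

Definition smooth_curve (V : lmodType R) (F : lcs V) (c : R -> V) : Prop :=
  exists d : nat -> R -> V, d 0%N = c /\
    forall k t, lcs_pts F (d k t) /\ is_curve_deriv F (d k) t (d k.+1 t).

Definition conv_smooth (V W : lmodType R) (F : lcs V) (U : set V) (G : lcs W)
    (f : V -> W) : Prop :=
  forall c, smooth_curve F c -> (forall t, U (c t)) -> smooth_curve G (f \o c).

Definition curve_deriv (V : lmodType R) (F : lcs V) (c : R -> V) (t : R) : V :=
  xget 0 [set v | lcs_pts F v /\ is_curve_deriv F c t v].

(* [differential G f x [:: v1; ...; vk]] is d^k f(x)(v1, ..., vk). *)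
Fixpoint differential (V W : lmodType R) (G : lcs W) (f : V -> W) (x : V)
    (vs : seq V) : W :=
  match vs with
  | [::] => f x
  | v :: vs' => curve_deriv G (fun t => differential G f (x + t *: v) vs') 0
  end.

End ConvenientCalculus.

Section Spaces.
Variables (R : realType) (n : nat).
Local Notation C := (Rcomplex R).
Local Notation E := 'rV[R]_n.
Implicit Types (f g : E -> C) (U K L Omega : set E) (phi : E -> E -> C).

Definition rV_lcs : lcs E := Lcs setT [set (fun x : E => `|x|)].

Definition Cinf U : lcs (E -> C) :=
  Lcs [set f | smooth_on U f /\ forall x, ~ U x -> f x = 0]
      [set p | exists K m, [/\ compact K, K `<=` U & p = snorm K m]].

Definition Dsupp L : lcs (E -> C) :=
  Lcs [set f | smooth_on setT f /\ supp f `<=` L]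
      [set p | exists m, p = snorm L m].

(* The inductive limit topology of the D_K(Omega): a seminorm is continuous iff
   its restriction to each D_K(Omega) is. *)
Definition Dtest Omega : lcs (E -> C) :=
  let test := [set f | [/\ smooth_on setT f, compact (supp f)
                         & supp f `<=` Omega]] in
  Lcs test
      [set p | [/\ forall f g, test f -> test g -> p (f + g) <= p f + p g,
                   forall (a : C) f, test f -> p (fun y => a * f y) = `|a| * p f
                 & forall K, compact K -> K `<=` Omega ->
                     exists (m : nat) (M : R), forall f, test f ->
                       supp f `<=` K -> p f <= M * snorm K m f]].

(* The x-derivatives of a map with values in a space of functions of y are
   computed pointwise in y, evaluation at y being linear and continuous on the
   spaces of test functions. *)
Definition xderiv (a : {ffun 'I_n -> nat}) phi (x y : E) : C :=
  pderiv a (fun z => phi z y) x.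

Definition CinfV U (F : lcs (E -> C)) : lcs (E -> E -> C) :=
  Lcs [set phi | conv_smooth rV_lcs U F phi /\ forall x, ~ U x -> phi x = 0]
      [set q | exists K (c : nat) p,
        [/\ compact K, K `<=` U, lcs_seminorms F p
          & q = fun phi => sup [set r | exists x a,
                  [/\ K x, (mi_deg a <= c)%N & r = p (xderiv a phi x)]]]].

Definition is_distribution Omega (u : (E -> C) -> C) : Prop :=
  [/\ forall f g, lcs_pts (Dtest Omega) f -> lcs_pts (Dtest Omega) g ->
        u (f + g) = u f + u g,
      forall (a : C) f, lcs_pts (Dtest Omega) f -> u (fun y => a * f y) = a * u f
    & exists2 p, lcs_seminorms (Dtest Omega) p &
        forall f, lcs_pts (Dtest Omega) f -> `|u f| <= p f].

Definition bounded_Cinf U (B : set (E -> C)) : Prop :=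
  B `<=` lcs_pts (Cinf U) /\
  forall p, lcs_seminorms (Cinf U) p ->
    exists M : R, forall f, B f -> p f <= M.

Definition norm_cl K (c : nat) L (l : nat) phi : R :=
  sup [set r | exists x y a b,
    [/\ K x, L y, (mi_deg a <= c)%N, (mi_deg b <= l)%N
      & r = `|pderiv a (fun z => pderiv b (phi z) y) x| ]].

Definition norm_B K (c : nat) (B : set (E -> C)) phi : R :=
  sup [set r | exists x a f,
    [/\ K x, (mi_deg a <= c)%N, B f
      & r = `|cint (fun y => f y * xderiv a phi x y)| ]].

Definition norm_delta_B K (c : nat) (B : set (E -> C)) phi : R :=
  sup [set r | exists x a f,
    [/\ K x, (mi_deg a <= c)%N, B f
      & r = `|cint (fun y => f y * xderiv a phi x y) - pderiv a f x| ]].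

(* Families (T_U)_U; only open U contained in Omega matter. *)
Definition opfamily : Type := set E -> (E -> E -> C) -> E -> C.

Definition is_basic Omega (T : opfamily) : Prop :=
  forall U, open U -> U `<=` Omega ->
  [/\ forall phi, lcs_pts (CinfV U (Dtest Omega)) phi ->
        lcs_pts (Cinf U) (T U phi),
      conv_smooth (CinfV U (Dtest Omega)) (lcs_pts (CinfV U (Dtest Omega)))
        (Cinf U) (T U)
    & forall V phi, open V -> V `<=` U -> lcs_pts (CinfV U (Dtest Omega)) phi ->
        restr V (T U phi) = T V (restr V phi)].

Definition emb_dist (u : (E -> C) -> C) : opfamily :=
  fun U phi => restr U (fun x => u (phi x)).

Definition emb_smooth f : opfamily := fun U _ => restr U f.

Definition open_nbhd Omega (x : E) U : Prop := [/\ open U, U x & U `<=` Omega].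

(* d^k T(phi_0)(phi_1, ..., phi_k) *)
Definition dT (T : opfamily) U (k : nat) (phi : 'I_k.+1 -> E -> E -> C) : E -> C :=
  differential (Cinf U) (T U) (phi ord0) [seq phi (lift ord0 i) | i <- enum 'I_k].

Definition nneg_coeffs (r : nat) (lam : mpoly.mpoly r R) : Prop :=
  forall a, 0 <= mpoly.mcoeff a lam.

(* The point (y_0, ..., y_k, z_0, ..., z_k). *)
Definition yz_point (k : nat) (y z : 'I_k.+1 -> R) (i : 'I_(k.+1 + k.+1)) : R :=
  match fintype.split i with inl j => y j | inr j => z j end.

Definition in_I (k : nat) (lam : mpoly.mpoly (k.+1 + k.+1) R) : Prop :=
  nneg_coeffs lam /\
  forall y : 'I_k.+1 -> R, mpoly.meval (yz_point y (fun=> 0)) lam = 0.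

Definition is_moderate Omega (T : opfamily) : Prop := is_basic Omega T /\
  forall x, Omega x -> exists2 U, open_nbhd Omega x U &
  forall K L, csub K U -> csub L U -> forall m k : nat,
  exists (c l : nat) (lam : mpoly.mpoly k.+1 R), nneg_coeffs lam /\
  forall phi : 'I_k.+1 -> E -> E -> C,
    (forall i, lcs_pts (CinfV U (Dsupp L)) (phi i)) ->
    snorm K m (dT T U phi) <=
      mpoly.meval (fun i => norm_cl K c L l (phi i)) lam.

Definition is_negligible Omega (T : opfamily) : Prop := is_basic Omega T /\
  forall x, Omega x -> exists2 U, open_nbhd Omega x U &
  forall K L, csub K U -> csub L U -> forall m k : nat,
  exists (c l : nat) (lam : mpoly.mpoly (k.+1 + k.+1) R) (B : set (E -> C)),
  [/\ in_I lam, bounded_Cinf Omega B &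
  forall phi : 'I_k.+1 -> E -> E -> C,
    (forall i, lcs_pts (CinfV U (Dsupp L)) (phi i)) ->
    snorm K m (dT T U phi) <=
      mpoly.meval (yz_point (fun i => norm_cl K c L l (phi i))
                        (fun i => if i == ord0 then norm_delta_B K c B (phi i)
                                  else norm_B K c B (phi i))) lam].

(* Elements of C^infty(Omega)^I are functions of a real parameter eps, whose
   values for eps outside I = ]0, 1] are irrelevant. *)
Definition Es Omega (u : R -> E -> C) : Prop :=
  forall e : R, 0 < e <= 1 -> lcs_pts (Cinf Omega) (u e).

Definition EsM Omega (u : R -> E -> C) : Prop := Es Omega u /\
  forall K (m : nat), csub K Omega -> exists2 N : nat, (0 < N)%N &
    (fun e : R => snorm K m (u e)) =O_ (0^'+) (fun e : R => e ^- N).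

Definition Ns Omega (u : R -> E -> C) : Prop := Es Omega u /\
  forall K (m : nat), csub K Omega -> forall N : nat, (0 < N)%N ->
    (fun e : R => snorm K m (u e)) =O_ (0^'+) (fun e : R => e ^+ N).

(* The distance to the complement is +oo when Omega = R^n. *)
Definition Keps Omega (e : R) : set E :=
  [set x | [/\ Omega x,
     (e%:E <= ereal_inf [set (enorm (x - z))%:E | z in ~` Omega])%E
     & enorm x < e^-1]].

Definition theta (rho chi : E -> C) (e : R) (y : E) : C :=
  (e ^- n *: rho (e^-1 *: y)) * chi (`|ln e| *: y).

Definition psi Omega (rho chi : E -> C) (kappa : R -> E -> C) (e : R)
    : E -> E -> C :=
  restr Omega (fun x y => theta rho chi e (x - y) * kappa e y).

Definition emb_dist_s Omega (rho chi : E -> C) (kappa : R -> E -> C)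
    (u : (E -> C) -> C) : R -> E -> C :=
  fun e => restr Omega (fun x => u (psi Omega rho chi kappa e x)).

Definition emb_smooth_s f : R -> E -> C := fun=> f.

Definition to_special Omega (rho chi : E -> C) (kappa : R -> E -> C) (T : opfamily)
    : R -> E -> C :=
  fun e => T Omega (psi Omega rho chi kappa e).

End Spaces.

(* Main.v *)
(* Near a point x0 of Omega, for x in a small ball V, the kernel psi_e(x) agrees
   with phi_e(x)(y) = beta(x) theta_e(x - y) kappa_e(y), where the cut-off beta
   forces phi_e(x) to be supported in one compact set L for all x and all small e.
   So phi_e is an admissible test object in the definitions of moderateness and
   negligibility (used with k = 0), and R(psi_e) = R(phi_e) on V by the sheaf
   property.  On V the seminorms of phi_e are those of theta_e.  Scaling bounds
   them by e^-N.  For f in a bounded set, the integral of f(y) d_x^a theta_e(x - y)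
   is that of rho(z) chi(e |ln e| z) (d^a f)(x - e z); Taylor's formula, the
   vanishing moments of rho and |chi(e |ln e| z) - 1| <= (4 e |z|^2)^m show that it
   is d^a f(x) + O(e^N).  Every monomial of a polynomial in I_k contains some z_i,
   so the polynomial bounds turn these estimates into powers of e, and compactness
   of K makes them uniform. *)

Require Import Defs.
From mathcomp Require Import all_boot all_order all_algebra.
From mathcomp Require Import all_classical all_reals all_analysis.
From mathcomp Require Import complex ring lra measurable_realfun.
Import Order.TTheory GRing.Theory Num.Theory.
Import numFieldNormedType.Exports.
Local Open Scope classical_set_scope.
Local Open Scope ring_scope.

Set Implicit Arguments.
Unset Strict Implicit.
Unset Printing Implicit Defensive.

(** Two obstacles shape the development. Membership of psi_e and phi_e in the test spaces is a
    statement of convenient calculus: composition with every smooth curve must give a smooth curve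
    for all seminorms of the target, in D(Omega) even for those of an inductive limit. A single
    kernel u(x(t), y) does not keep its form under differentiation in t, but finite sums of a(t)
    u(x(t), y) do, and their difference quotients converge uniformly together with the y-derivatives
    of any bounded order. Secondly, integrals over R^n are iterated integrals, so bounds, dominated
    convergence and substitution are obtained by induction on the dimension, for continuous
    functions dominated by a multiple of the product of the 1/(1 + y_i^2). The factor 4 e |z|^2
    comes from |ln e| sqrt e <= 2. Constants are absorbed by spending one additional power of e in
    each bound. *)

Lemma dist_halves (R : realFieldType) (a1 a2 a3 c : R) :
  `|a1 - a3| <= c / 2 -> `|a2 - a3| <= c / 2 -> `|a2 - a1| <= c.
Proof. by rewrite !ler_norml => /andP[? ?] /andP[? ?]; apply/andP; split; lra. Qed.

(** * Iterated partial derivatives of real functions *)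

Section RealPartials.
Context {R : realType} {n : nat}.
Local Notation E := 'rV[R]_n.
Implicit Types (u : E -> R) (U : set E) (x v : E) (w : seq 'I_n).

Definition basis_vec (i : 'I_n) : E := delta_mx 0 i.

Definition pd (i : 'I_n) u : E -> R := fun x => 'D_(basis_vec i) u x.

(** Derivatives are indexed by words, the last letter acting first: concatenation is then
    composition ([pdw_cat]), and the product and chain rules go by induction on the word, where
    multi-indices would call for the symmetry of mixed partials throughout. *)
Definition pdw w u : E -> R := foldr pd u w.

Definition smooth U u : Prop := forall w x, U x ->
  {for x, continuous (pdw w u)} /\
  forall i, derivable (pdw w u) x (basis_vec i).

Lemma is_derive_line u x v t : derivable u (x + t *: v) v ->
  is_derive t (1 : R) (fun s => u (x + s *: v)) ('D_v u (x + t *: v)).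
Proof.
have H : (fun h : R => h^-1 *: (((fun s => u (x + s *: v)) \o shift t) (h *: 1)
            - u (x + t *: v)))
   = (fun h : R => h^-1 *: ((u \o shift (x + t *: v)) (h *: v) - u (x + t *: v))).
  apply/funext => h /=; congr (_ *: (u _ - _)).
  have -> : h *: (1 : R) = h by exact: mulr1.
  by rewrite scalerDl addrCA addrC.
by move=> du; split; rewrite /derivable /derive H.
Qed.

Lemma MVT_line u x v (h : R) :
  (forall s, `|s| <= `|h| -> derivable u (x + s *: v) v) ->
  exists2 s, `|s| <= `|h| & u (x + h *: v) - u x = h * 'D_v u (x + s *: v).
Proof.
move=> du; set f := fun s : R => u (x + s *: v).
have fd s : `|s| <= `|h| -> is_derive s (1 : R) f ('D_v u (x + s *: v)).
  by move=> sh; exact/is_derive_line/du.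
have fc (a b : R) : (forall s, s \in `[a, b] -> `|s| <= `|h|) ->
    {within `[a, b], continuous f}.
  move=> H; apply: derivable_within_continuous => s sab.
  by have /H/fd[] := sab.
have f0 : f 0 = u x by rewrite /f scale0r addr0.
have [h0|h0] := leP 0 h.
- have H s : s \in `[0, h] -> `|s| <= `|h|.
    by rewrite in_itv /= => /andP[s0 sh]; rewrite !ger0_norm.
  have [|s sh E1] := @MVT_segment _ f (fun s => 'D_v u (x + s *: v)) 0 h h0 _ (fc _ _ H).
    by move=> s sh; apply: fd; apply: H; apply: subset_itv_oo_cc.
  by exists s; [exact: H|rewrite -f0 -/(f h) E1 subr0 mulrC].
- have H s : s \in `[h, 0] -> `|s| <= `|h|.
    by rewrite in_itv /= => /andP[s0 sh]; rewrite !ler0_norm ?lerN2 // ltW.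
  have [|s sh E1] := @MVT_segment _ f (fun s => 'D_v u (x + s *: v)) h 0 (ltW h0) _ (fc _ _ H).
    by move=> s sh; apply: fd; apply: H; apply: subset_itv_oo_cc.
  by exists s; [exact: H|rewrite -f0 -/(f h) -opprB E1 sub0r mulrN opprK mulrC].
Qed.

Definition norm1 v : R := \sum_i `|v 0 i|.

(** The segment from x to x + v is replaced by a path changing one coordinate at a time. It stays in
    the box, so partial derivatives and the one-variable mean value theorem suffice, without total
    differentiability. *)
Lemma lipschitz_box u x v (M : R) :
  (forall z : E, (forall i, `|z 0 i - x 0 i| <= `|v 0 i|) ->
     forall i, derivable u z (basis_vec i) /\ `|pd i u z| <= M) ->
  `|u (x + v) - u x| <= M * norm1 v.
Proof.
move=> H.
pose t (s : seq 'I_n) : E := \row_j (if j \in s then v 0 j else 0).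
have step s : uniq s -> `|u (x + t s) - u x| <= M * \sum_(i <- s) `|v 0 i|.
  elim: s => [_|i s IH /= /andP[iNs us]].
    by rewrite (_ : t _ = 0) ?big_nil ?mulr0 ?addr0 ?subrr ?normr0//;
       apply/rowP => j; rewrite !mxE.
  have tE : t (i :: s) = t s + v 0 i *: basis_vec i.
    apply/rowP => j; rewrite !mxE inE eqxx /= eq_sym.
    case: (eqVneq i j) => [<-|ij] /=.
      by rewrite (negbTE iNs) mulr1 add0r.
    by rewrite mulr0 addr0.
  have K r : `|r| <= `|v 0 i| -> forall j,
      `|(x + t s + r *: basis_vec i) 0 j - x 0 j| <= `|v 0 j|.
    move=> rv j; rewrite !mxE eqxx /= [j == i]eq_sym.
    case: (eqVneq i j) => [<-|ij] /=.
      by rewrite (negbTE iNs) mulr1 addr0 addrAC subrr add0r.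
    rewrite mulr0 addr0 addrAC subrr add0r.
    by case: ifP => // _; rewrite normr0.
  rewrite tE addrA big_cons mulrDr.
  have [|r rv E1] := @MVT_line u (x + t s) (basis_vec i) (v 0 i).
    by move=> r rv; have [] := H _ (K r rv) i.
  rewrite -[u _ - u x](subrKA (u (x + t s))) (le_trans (ler_normD _ _)) //.
  apply: lerD; last exact: IH.
  rewrite E1 normrM mulrC ler_wpM2r //.
  by have [] := H _ (K r rv) i.
have := step (enum 'I_n) (enum_uniq _).
rewrite (_ : t _ = v) ?big_enum //.
by apply/rowP => j; rewrite !mxE mem_enum.
Qed.

Definition bnd (k : nat) (M : R) u : Prop :=
  forall w, (size w <= k)%N -> forall x, `|pdw w u x| <= M.

Lemma bnd_le k k' M M' u : (k' <= k)%N -> M <= M' -> bnd k M u -> bnd k' M' u.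
Proof.
by move=> kk MM H w wk x; apply: le_trans MM; apply: H; exact: leq_trans kk.
Qed.

Lemma bnd_ge0 k M u : bnd k M u -> 0 <= M.
Proof. by move=> /(_ [::] isT 0); exact: le_trans. Qed.

Lemma pdw_cat w1 w2 u : pdw (w1 ++ w2) u = pdw w1 (pdw w2 u).
Proof. by rewrite /pdw foldr_cat. Qed.

Lemma bnd_pdw k M u w : bnd (k + size w) M u -> bnd k M (pdw w u).
Proof.
by move=> H w' w'k x; rewrite -pdw_cat; apply: H; rewrite size_cat leq_add2r.
Qed.

Lemma smooth_pdw U u w : smooth U u -> smooth U (pdw w u).
Proof. by move=> H w' x Ux; rewrite -pdw_cat; exact: H. Qed.

Lemma smooth_pd U u i : smooth U u -> smooth U (pd i u).
Proof. exact: (@smooth_pdw _ _ [:: i]). Qed.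

Lemma norm1_ge0 v : 0 <= norm1 v. Proof. by apply: sumr_ge0. Qed.

Lemma norm1Z (a : R) v : norm1 (a *: v) = `|a| * norm1 v.
Proof. by rewrite mulr_sumr; apply: eq_bigr => i _; rewrite mxE normrM. Qed.

Lemma norm1_norm v : norm1 v <= n%:R * `|v|.
Proof.
rewrite /norm1 -[X in X%:R * _]card_ord -sum1_card natr_sum mulr_suml.
apply: ler_sum => i _; rewrite mul1r.
rewrite [`|v|]mx_normrE.
exact: (le_bigmax _ (fun ij : 'I_1 * 'I_n => `|v ij.1 ij.2|) (0, i)).
Qed.

Lemma lipschitz u x v M : smooth setT u -> bnd 1 M u ->
  `|u (x + v) - u x| <= M * norm1 v.
Proof.
move=> su bu; apply: lipschitz_box => z _ i; split.
  by have [_] := su [::] z I; apply.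
exact: (bu [:: i]).
Qed.

Lemma pd_lin (a : 'I_n -> R) i x :
  is_derive x (basis_vec i) (fun z : E => \sum_j z 0 j * a j) (a i).
Proof.
have D j : is_derive x (basis_vec i) (fun z : E => z 0 j) ((i == j)%:R).
  have E0 : (fun h : R => h^-1 *: (((fun z : E => z 0 j) \o shift x) (h *: basis_vec i) - x 0 j))
      = (fun h : R => h^-1 * (h * (i == j)%:R)).
    by apply/funext => h /=; rewrite !mxE eqxx /= eq_sym addrK.
  have C0 : (fun h : R => h^-1 * (h * (i == j)%:R)) @ 0^' --> ((i == j)%:R : R).
    apply: (@cvg_near_cst _ _ _ _ _ (dnbhs_filter _)).
    near=> h; rewrite /= mulrA mulVf ?mul1r //.
    by near: h; exact: nbhs_dnbhs_neq.
  by split; rewrite /derivable /derive E0; [apply/cvg_ex; eexists; exact: C0|exact/cvg_lim].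
have -> : a i = \sum_j ((i == j)%:R * a j).
  by rewrite (bigD1 i) //= eqxx mul1r big1 ?addr0 // => j ji; rewrite eq_sym (negbTE ji) mul0r.
have -> : (fun z : E => \sum_j z 0 j * a j) = \sum_j (fun z : E => z 0 j * a j).
  by apply/funext => z; rewrite fct_sumE.
apply: is_derive_sum => j.
rewrite mulrC (_ : (fun z : E => z 0 j * a j) = a j \*: (fun z : E => z 0 j)); last first.
  by apply/funext => z; rewrite mulrC.
exact: is_deriveZ.
Unshelve. all: by end_near. Qed.

(** Let l be linear with the partials of u at x as coefficients. The partials of u - l at z are
    differences of those of u, at most M [norm1 v] on the box by [lipschitz]; then [lipschitz_box]
    applies to u - l. *)
Lemma taylor1 u x v M : smooth setT u -> bnd 2 M u ->
  `|u (x + v) - u x - \sum_i v 0 i * pd i u x| <= M * norm1 v ^+ 2.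
Proof.
move=> su bu.
have M0 := bnd_ge0 bu.
pose l := fun z : E => \sum_j z 0 j * pd j u x.
have lD : l (x + v) = l x + \sum_i v 0 i * pd i u x.
  by rewrite /l -big_split; apply: eq_bigr => i _; rewrite mxE mulrDl.
have -> : u (x + v) - u x - \sum_i v 0 i * pd i u x = (u - l) (x + v) - (u - l) x.
  by rewrite /= !fctE lD; ring.
rewrite expr2 mulrA; apply: lipschitz_box => z zx i.
have du : derivable u z (basis_vec i) by have [_] := su [::] z I; apply.
have dl := pd_lin (fun j => pd j u x) i z.
split; first by apply: derivableB => //; exact: ex_derive.
rewrite /pd deriveB //= -/(pd i u z).
rewrite (@derive_val _ _ _ _ _ _ _ dl).
have -> : z = x + (z - x) by rewrite addrC subrK.
have b1 : bnd 1 M (pd i u) by exact: (@bnd_pdw 1 M u [:: i]).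
apply: le_trans (lipschitz _ _ (smooth_pd i su) b1) _.
by apply: ler_wpM2l => //; apply: ler_sum => j _; rewrite !mxE.
Qed.

Lemma pd_near i u1 u2 x : (\near x, u1 x = u2 x) -> pd i u1 x = pd i u2 x.
Proof.
move=> H; have [n0|n0] := eqVneq (basis_vec i) 0; last exact: near_eq_derive.
by rewrite /pd n0 !derive0.
Qed.

Lemma pdw_near w u1 u2 x : (\near x, u1 x = u2 x) ->
  \near x, pdw w u1 x = pdw w u2 x.
Proof.
elim: w => //= i w IH /IH /nbhs_interior H.
by near=> y; apply: pd_near; near: y.
Unshelve. all: by end_near. Qed.

Lemma pdw_open U w u1 u2 : open U -> (forall x, U x -> u1 x = u2 x) ->
  forall x, U x -> pdw w u1 x = pdw w u2 x.
Proof.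
move=> oU H x Ux; suff /nbhs_singleton : \near x, pdw w u1 x = pdw w u2 x by [].
by apply: pdw_near; near=> y; apply: H; near: y; apply: open_nbhs_nbhs.
Unshelve. all: by end_near. Qed.

Lemma smooth_open U u1 u2 : open U -> (forall x, U x -> u1 x = u2 x) ->
  smooth U u1 -> smooth U u2.
Proof.
move=> oU H su w x Ux; have [c d] := su w x Ux.
have E1 : \near x, pdw w u1 x = pdw w u2 x.
  by near=> y; apply: (@pdw_open U) => //; near: y; apply: open_nbhs_nbhs.
split.
  have E2 : pdw w u1 x = pdw w u2 x by exact: nbhs_singleton E1.
  change (pdw w u2 @ x --> pdw w u2 x); rewrite -E2.
  have E3 := near_eq_cvg (FF := nbhs_filter x) E1.
  by move=> A /c; exact: E3.
move=> i; have [n0|n0] := eqVneq (basis_vec i) 0; first by rewrite n0; exact: derivable0.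
by apply: near_eq_derivable (d i).
Unshelve. all: by end_near. Qed.

Lemma smooth_sub U V u : V `<=` U -> smooth U u -> smooth V u.
Proof. by move=> VU su w x /VU; exact: su. Qed.

Opaque pd.

(* The second difference quotient of u in the directions i, j takes the values
   of both mixed partial derivatives at points tending to x. *)
Lemma pdC U u i j x : open U -> smooth U u -> U x ->
  pd i (pd j u) x = pd j (pd i u) x.
Proof.
move=> oU su Ux.
(* The second difference of u over a square of side r: the mean value theorem is applied in
   direction a to the increment f in direction b, then in direction b to [pd a u]. *)
have key (a b : 'I_n) (r : R) : 0 < r ->
    (forall s t : R, `|s| <= r -> `|t| <= r ->
      U (x + s *: basis_vec a + t *: basis_vec b)) ->
    exists s t : R, [/\ `|s| <= r, `|t| <= r &
      u (x + r *: basis_vec a + r *: basis_vec b) - u (x + r *: basis_vec a)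
      - (u (x + r *: basis_vec b) - u x) =
      r * (r * pd b (pd a u) (x + s *: basis_vec a + t *: basis_vec b))].
  move=> r0 HU; pose f z := u (z + r *: basis_vec b) - u z.
  have rr : `|r| = r by rewrite gtr0_norm.
  have U0 s : `|s| <= r -> U (x + s *: basis_vec a).
    by move=> sr; rewrite -[x + _]addr0 -(scale0r (basis_vec b)); apply: HU;
       rewrite ?normr0 // ltW.
  have dshift s : `|s| <= r -> is_derive (x + s *: basis_vec a) (basis_vec a)
      (fun z => u (z + r *: basis_vec b))
      (pd a u (x + s *: basis_vec a + r *: basis_vec b)).
    move=> sr; have D := (su [::] _ (HU s r sr _)).2 a.
    have E0 : (fun h : R => h^-1 *: (((fun z => u (z + r *: basis_vec b))
         \o shift (x + s *: basis_vec a)) (h *: basis_vec a)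
         - u (x + s *: basis_vec a + r *: basis_vec b)))
       = (fun h : R => h^-1 *: ((u \o shift (x + s *: basis_vec a + r *: basis_vec b))
            (h *: basis_vec a) - u (x + s *: basis_vec a + r *: basis_vec b))).
      by apply/funext => h /=; rewrite /shift /= !addrA.
    by split; [rewrite /derivable E0; apply: D; rewrite rr|rewrite /derive E0].
  have df s : `|s| <= r -> is_derive (x + s *: basis_vec a) (basis_vec a) f
      (pd a u (x + s *: basis_vec a + r *: basis_vec b) - pd a u (x + s *: basis_vec a)).
    move=> sr; apply: is_deriveB; first exact: dshift.
    by apply/derivableP; exact: (su [::] _ (U0 s sr)).2.
  have [|s sr E1] := @MVT_line f x (basis_vec a) r.
    by move=> s; rewrite rr => sr; have [] := df s sr.
  rewrite rr in sr.
  rewrite (@derive_val _ _ _ _ _ _ _ (df s sr)) in E1.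
  have [|t tr E2] := @MVT_line (pd a u) (x + s *: basis_vec a) (basis_vec b) r.
    by move=> t; rewrite rr => tr; exact: (su [:: a] _ (HU s t sr tr)).2.
  rewrite rr in tr.
  by exists s, t; split => //; rewrite -E2 -E1.
have cont a b : {for x, continuous (pd b (pd a u))} by exact: (su [:: b; a] x Ux).1.
apply/eqP; rewrite -subr_eq0 -normr_le0; apply/ler_addgt0Pr => e e0; rewrite add0r.
have e2 : 0 < e / 2 by rewrite divr_gt0.
have P : \forall y \near x, [/\ U y, `|pd i (pd j u) x - pd i (pd j u) y| <= e / 2
     & `|pd j (pd i u) x - pd j (pd i u) y| <= e / 2].
  have H1 : \forall y \near x, U y by exact: open_nbhs_nbhs.
  have cle (f : E -> R) : {for x, continuous f} -> \forall y \near x, `|f x - f y| <= e / 2.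
    by move/cvgrPdist_le; apply.
  have H2 := cle _ (cont j i); have H3 := cle _ (cont i j).
  by apply: filterS3 H1 H2 H3 => y *; split.
have [d /= d0 dP] := (nbhs_ballP _ _).1 P.
(* With |s| and |t| at most d / B the displacement has norm less than d; the summand 1 makes B
   positive and the inequality strict. *)
pose B := 1 + `|basis_vec i| + `|basis_vec j|.
have B0 : 0 < B by rewrite /B -addrA ltr_pwDl // addr_ge0.
have r0 : 0 < d / B by rewrite divr_gt0.
have inb a b (s t : R) : (a, b) = (i, j) \/ (a, b) = (j, i) ->
    `|s| <= d / B -> `|t| <= d / B ->
    ball x d (x + s *: basis_vec a + t *: basis_vec b).
  move=> ab sr tr; rewrite -ball_normE /= -addrA opprD addNKr normrN.
  apply: le_lt_trans (ler_normD _ _) _; rewrite !normrZ.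
  have BE : `|basis_vec a| + `|basis_vec b| = `|basis_vec i| + `|basis_vec j|.
    by case: ab => -[-> ->] //; rewrite addrC.
  apply: (@le_lt_trans _ _ (d / B * (`|basis_vec a| + `|basis_vec b|))).
    by rewrite mulrDr lerD // ler_wpM2r.
  rewrite BE -[ltRHS](divfK (lt0r_neq0 B0)) ltr_pM2l //.
  by rewrite /B -addrA ltr_pwDl.
have [|s [t [sr tr E1]]] := key i j _ r0.
  by move=> s t sr tr; have [] := dP _ (inb i j s t (or_introl erefl) sr tr).
have [|s' [t' [sr' tr' E2]]] := key j i _ r0.
  by move=> s' t' sr' tr'; have [] := dP _ (inb j i s' t' (or_intror erefl) sr' tr').
have E3 : pd j (pd i u) (x + s *: basis_vec i + t *: basis_vec j) =
          pd i (pd j u) (x + s' *: basis_vec j + t' *: basis_vec i).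
  apply: (mulfI (lt0r_neq0 r0)); apply: (mulfI (lt0r_neq0 r0)).
  apply: etrans (esym E1) _; apply: etrans _ E2.
  rewrite (addrAC x _ ((d / B) *: basis_vec i)); set c1 := u _; set c2 := u _.
  by set c3 := u _; ring.
have [_ _ h1] := dP _ (inb i j s t (or_introl erefl) sr tr).
have [_ h2 _] := dP _ (inb j i s' t' (or_intror erefl) sr' tr').
rewrite E3 in h1.
exact: dist_halves h1 h2.
Unshelve. all: by end_near. Qed.

Lemma pdw_perm U u w w' : open U -> smooth U u -> perm_eq w w' ->
  forall x, U x -> pdw w u x = pdw w' u x.
Proof.
move=> oU su; elim: w w' => [|i w IH] w' pw x Ux.
  by have := perm_size pw; case: w' pw.
have iw' : i \in w' by rewrite -(perm_mem pw) inE eqxx.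
have [w1 [w2 w'E]] : exists w1 w2, w' = w1 ++ i :: w2.
  by case/splitPr: iw' => w1 w2; exists w1, w2.
(* Adjacent transpositions, each an instance of [pdC], bring the letter i to the front. *)
have front w0 y : U y -> pdw (w0 ++ i :: w2) u y = pdw (i :: w0 ++ w2) u y.
  elim: w0 y => //= k w0 IH0 y Uy.
  transitivity (pd k (pdw (i :: w0 ++ w2) u) y).
    exact: (@pdw_open U [:: k]).
  by apply: (@pdC U) => //; exact: smooth_pdw.
rewrite w'E front //=; apply: (@pdw_open U [:: i]) => // y Uy.
apply: IH => //; move: pw; rewrite w'E -(cat1s i w2) perm_sym perm_catCA /=.
by rewrite perm_cons perm_sym.
Qed.

End RealPartials.

(** * Product rule and functions with bounded derivatives *)

Section Leibniz.
Context {R : realType} {n : nat}.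
Local Notation E := 'rV[R]_n.
Implicit Types (u f g : E -> R) (U A : set E) (x v : E) (w : seq 'I_n).

Definition bndon A (k : nat) (M : R) u : Prop :=
  forall w, (size w <= k)%N -> forall x, A x -> `|pdw w u x| <= M.

Lemma bnd_bndon k M u : bndon setT k M u <-> bnd k M u.
Proof. by split=> H w wk x *; apply: H. Qed.

(** Only finitely many words have length at most k. The recursion is on the last letter, which acts
    first: the derivatives of u of order at most k.+1 are u and those of the [pd i u] of order at
    most k, and their bounds are added up. *)
Lemma bndon_ex A u : (forall w, exists M, forall x, A x -> `|pdw w u x| <= M) ->
  forall k, exists2 M, 0 <= M & bndon A k M u.
Proof.
move=> H k; elim: k u H => [|k IH] u H.
  have [M HM] := H [::]; exists `|M| => // -[|//] _ x Ax.
  by apply: le_trans (HM x Ax) (ler_norm _).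
have [M0 HM0] := H [::].
have /choice[M HM] : forall i : 'I_n, exists M : R, 0 <= M /\ bndon A k M (pd i u).
  move=> i; have [|M M0' HM] := IH (pd i u); last by exists M.
  by move=> w; have [M HM] := H (rcons w i); exists M => x Ax;
     rewrite -[pd i u]/(pdw [:: i] u) -pdw_cat cats1; exact: HM.
exists (`|M0| + \sum_i M i).
  by rewrite addr_ge0 // sumr_ge0 // => i _; have [] := HM i.
move=> w; case/lastP: w => [_ x Ax|w i].
  apply: le_trans (HM0 x Ax) _; apply: le_trans (ler_norm _) _.
  by rewrite lerDl sumr_ge0 // => i _; have [] := HM i.
rewrite size_rcons ltnS => wk x Ax; rewrite -cats1 pdw_cat /=.
have [_ Hi] := HM i; apply: le_trans (Hi w wk x Ax) _.
rewrite (bigD1 i) //= addrCA lerDl addr_ge0 // sumr_ge0 // => j _.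
by have [] := HM j.
Qed.

Lemma derivable_pdP u x i d : is_derive x (basis_vec i) u d -> pd i u x = d.
Proof. by move=> D; rewrite -(@derive_val _ _ _ _ _ _ _ D). Qed.

Lemma smooth_is_derive U u w x i : smooth U u -> U x ->
  is_derive x (basis_vec i) (pdw w u) (pdw (i :: w) u x).
Proof. by move=> su Ux; apply/derivableP; exact: (su w x Ux).2. Qed.

(** A guessed family F, closed under differentiation by prefixing a letter, yields smoothness and
    the formula for all derivatives at once. The rules for products, sums and affine substitutions
    are instances. *)
Lemma smoothI U u (F : seq 'I_n -> E -> R) : open U ->
  (forall x, U x -> u x = F [::] x) ->
  (forall w x, U x -> {for x, continuous (F w)}) ->
  (forall w i x, U x -> is_derive x (basis_vec i) (F w) (F (i :: w) x)) ->
  smooth U u /\ forall w x, U x -> pdw w u x = F w x.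
Proof.
move=> oU F0 Fc Fd.
have E1 w x : U x -> pdw w u x = F w x.
  elim: w x => [|i w IH] x Ux; first exact: F0.
  rewrite -(derivable_pdP (Fd w i x Ux)).
  exact: (@pdw_open _ _ U [:: i]).
split => // w x Ux.
have N : \forall y \near x, pdw w u y = F w y.
  have N : \forall y \near x, U y by exact: open_nbhs_nbhs.
  by apply: filterS N => y; exact: E1.
have N' : \forall y \near x, F w y = pdw w u y by apply: filterS N => y ->.
split.
  change (pdw w u @ x --> pdw w u x); rewrite (E1 w x Ux).
  have E3 := near_eq_cvg (FF := nbhs_filter x) N'.
  have c : F w @ x --> F w x by exact: Fc.
  by move=> A /c; exact: E3.
move=> i; have [n0|n0] := eqVneq (basis_vec i : E) 0.
  by rewrite n0; exact: derivable0.
by apply: near_eq_derivable N' _ => //; have [] := Fd w i x Ux.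
Qed.

Lemma is_derive_big (I : Type) (r : seq I) (F : I -> E -> R) (dF : I -> R) x v :
  (forall j, is_derive x v (F j) (dF j)) ->
  is_derive x v (fun z => \sum_(j <- r) F j z) (\sum_(j <- r) dF j).
Proof.
move=> D; elim: r => [|j r IH].
  rewrite big_nil (_ : (fun z => _) = cst 0); first exact: is_derive_cst.
  by apply/funext => z; rewrite big_nil.
rewrite big_cons (_ : (fun z => _) = F j + (fun z => \sum_(j <- r) F j z)).
  exact: is_deriveD.
by apply/funext => z; rewrite big_cons.
Qed.

Lemma continuous_big (I : Type) (r : seq I) (F : I -> E -> R) x :
  (forall j, {for x, continuous (F j)}) ->
  {for x, continuous (fun z => \sum_(j <- r) F j z)}.
Proof.
move=> C; elim: r => [|j r IH].
  rewrite (_ : (fun z => _) = cst 0); first exact: cst_continuous.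
  by apply/funext => z; rewrite big_nil.
rewrite (_ : (fun z => _) = F j + (fun z => \sum_(j <- r) F j z)).
  exact: continuousD.
by apply/funext => z; rewrite big_cons.
Qed.

(** Each letter of w goes to one of two factors. The distributions are listed with repetition, so
    Leibniz's formula has no binomial coefficients. *)
Fixpoint splits w : seq (seq 'I_n * seq 'I_n) :=
  if w is i :: w' then
    [seq (i :: p.1, p.2) | p <- splits w'] ++ [seq (p.1, i :: p.2) | p <- splits w']
  else [:: ([::], [::])].

Lemma size_splits w : size (splits w) = (2 ^ size w)%N.
Proof. by elim: w => //= i w IH; rewrite size_cat !size_map IH addnn -mul2n -expnS. Qed.

Lemma mem_splits w p : p \in splits w -> (size p.1 <= size w)%N /\ (size p.2 <= size w)%N.
Proof.
elim: w p => [|i w IH] p /=; first by rewrite inE => /eqP ->.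
rewrite mem_cat => /orP[] /mapP[q /IH[h1 h2] ->] /=; split => //; exact: leqW.
Qed.

Lemma leibniz U f g : open U -> smooth U f -> smooth U g ->
  smooth U (f * g) /\ forall w x, U x -> pdw w (f * g) x =
    \sum_(p <- splits w) pdw p.1 f x * pdw p.2 g x.
Proof.
move=> oU sf sg; apply: smoothI => //.
- by move=> x _; rewrite /= big_seq1.
- move=> w x Ux; apply: continuous_big => p.
  by apply: continuousM; [exact: (sf _ _ Ux).1|exact: (sg _ _ Ux).1].
- move=> w i x Ux; rewrite /= big_cat !big_map /= -big_split /=.
  apply: is_derive_big => p.
  have D := @is_deriveM _ _ _ _ _ _ _ _ (smooth_is_derive p.1 i sf Ux) (smooth_is_derive p.2 i sg Ux).
  apply: is_derive_eq D _; rewrite addrC; congr (_ + _).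
  by rewrite mulrC.
Qed.

Lemma smoothM U f g : open U -> smooth U f -> smooth U g -> smooth U (f * g).
Proof. by move=> oU sf sg; have [] := leibniz oU sf sg. Qed.

Lemma bndonM U A k M N f g : open U -> A `<=` U -> smooth U f -> smooth U g ->
  bndon A k M f -> bndon A k N g -> bndon A k (2 ^+ k * (M * N)) (f * g).
Proof.
move=> oU AU sf sg bf bg w wk x Ax.
have [_ ->] := leibniz oU sf sg; last exact: AU.
have M0 : 0 <= M by exact: le_trans (bf [::] isT x Ax).
have N0 : 0 <= N by exact: le_trans (bg [::] isT x Ax).
apply: le_trans (ler_norm_sum _ _ _) _.
apply: (@le_trans _ _ (\sum_(p <- splits w) M * N)).
  rewrite big_seq [leRHS]big_seq; apply: ler_sum => p /mem_splits[h1 h2].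
  by rewrite normrM ler_pM // ?bf ?bg //; exact: leq_trans wk.
rewrite big_const_seq count_predT size_splits iter_addr_0 -[leLHS]mulr_natl natrX.
by rewrite ler_wpM2r ?mulr_ge0 // ler_weXn2l // ler1n.
Qed.

Lemma smoothD U f g : open U -> smooth U f -> smooth U g ->
  smooth U (f + g) /\ forall w x, U x -> pdw w (f + g) x = pdw w f x + pdw w g x.
Proof.
move=> oU sf sg; apply: (smoothI (F := fun w x => pdw w f x + pdw w g x)) => //.
- by move=> w x Ux; apply: continuousD; [exact: (sf _ _ Ux).1|exact: (sg _ _ Ux).1].
- move=> w i x Ux.
  exact: (is_deriveD (smooth_is_derive w i sf Ux) (smooth_is_derive w i sg Ux)).
Qed.

Lemma smoothZ U f (c : R) : open U -> smooth U f ->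
  smooth U (fun x => c * f x) /\ forall w x, U x -> pdw w (fun x => c * f x) x = c * pdw w f x.
Proof.
move=> oU sf; apply: (smoothI (F := fun w x => c * pdw w f x)) => //.
- by move=> w x Ux; apply: continuousM; [exact: cst_continuous|exact: (sf _ _ Ux).1].
- move=> w i x Ux.
  exact: (is_deriveZ c (smooth_is_derive w i sf Ux)).
Qed.

Lemma smoothB U f g : open U -> smooth U f -> smooth U g ->
  smooth U (f - g) /\ forall w x, U x -> pdw w (f - g) x = pdw w f x - pdw w g x.
Proof.
move=> oU sf sg; have [sN N] := smoothZ (-1) oU sg.
have E0 : - g = (fun x => -1 * g x) by apply/funext => x; rewrite mulN1r.
rewrite E0; have [sD D] := smoothD oU sf sN; split => // w x Ux.
by rewrite D // N // mulN1r.
Qed.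

Lemma smooth_cst U (c : R) : open U ->
  smooth U (cst c) /\ forall w x, U x -> pdw w (cst c) x = if w is [::] then c else 0.
Proof.
move=> oU; apply: (smoothI (F := fun w _ => if w is [::] then c else 0)) => //.
- by move=> [|? ?] x Ux; exact: cst_continuous.
Qed.

Lemma smoothU U V f : smooth U f -> smooth V f -> smooth (U `|` V) f.
Proof. by move=> sU sV w x [/sU|/sV]; apply. Qed.

(** A class that contains the real and imaginary parts of test functions and of Schwartz functions
    and is stable under products and affine substitutions. Its global bounds make the remainder
    estimates uniform. *)
Definition tame u : Prop := smooth setT u /\ forall k, exists M, bnd k M u.

Lemma pdw_supp (S : set E) u w x : closed S -> (forall y, ~ S y -> u y = 0) ->
  ~ S x -> pdw w u x = 0.
Proof.
move=> cS H nSx.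
have oC : open (~` S) by exact: closed_openC.
rewrite (@pdw_open _ _ (~` S) w u (cst 0)) //.
by have [_ ->] := smooth_cst 0 oC => //; case: w.
Qed.

Lemma tame_compact u (S : set E) : smooth setT u -> compact S ->
  (forall y, ~ S y -> u y = 0) -> tame u.
Proof.
move=> su cS S0; split => // k.
have [|M M0 HM] := @bndon_ex setT u _ k; last by exists M; apply/bnd_bndon.
move=> w.
have cc : closed S by apply: compact_closed => //; exact: norm_hausdorff.
have [M HM] : exists M, forall x, S x -> `|pdw w u x| <= M.
  have c : {within S, continuous (fun x => `|pdw w u x|)}.
    apply: continuous_subspaceT => x; apply: continuous_comp.
      exact: (su w x I).1.
    exact: norm_continuous.
  have [S00|S00] := pselect (S !=set0); last first.
    by exists 0 => x Sx; case: S00; exists x.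
  have [z Sz Hz] := compact_EVT_max S00 cS c.
  by exists `|pdw w u z| => x Sx; apply: Hz; rewrite inE.
exists `|M| => x _; have [Sx|Sx] := pselect (S x).
  by apply: le_trans (HM x Sx) (ler_norm _).
by rewrite (pdw_supp _ cc S0 Sx) normr0.
Qed.

Lemma tame_pdw w u : tame u -> tame (pdw w u).
Proof.
move=> [su bu]; split; first exact: smooth_pdw.
by move=> k; have [M HM] := bu (k + size w)%N; exists M; exact: bnd_pdw.
Qed.

Lemma tameM f g : tame f -> tame g -> tame (f * g).
Proof.
move=> [sf bf] [sg bg]; split; first exact: smoothM openT sf sg.
move=> k; have [M /bnd_bndon HM] := bf k; have [N /bnd_bndon HN] := bg k.
by exists (2 ^+ k * (M * N)); apply/bnd_bndon; exact: (bndonM openT).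
Qed.

Lemma tameD f g : tame f -> tame g -> tame (f + g).
Proof.
move=> [sf bf] [sg bg]; have [s E1] := smoothD openT sf sg; split => //.
move=> k; have [M HM] := bf k; have [N HN] := bg k; exists (M + N) => w wk x.
by rewrite E1 // (le_trans (ler_normD _ _)) // lerD // ?HM ?HN.
Qed.

Lemma tameZ f (c : R) : tame f -> tame (fun x => c * f x).
Proof.
move=> [sf bf]; have [s E1] := smoothZ c openT sf; split => //.
move=> k; have [M HM] := bf k; exists (`|c| * M) => w wk x.
by rewrite E1 // normrM ler_wpM2l // HM.
Qed.

Lemma tameB f g : tame f -> tame g -> tame (f - g).
Proof.
move=> tf tg; rewrite (_ : f - g = f + (fun x => -1 * g x)).
  by apply: tameD => //; exact: tameZ.
by apply/funext => x; rewrite /= !fctE mulN1r.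
Qed.

Lemma is_derive_bound f x v d (C : R) :
  (forall h : R, h != 0 -> `|h^-1 * (f (h *: v + x) - f x) - d| <= C * `|h|) ->
  is_derive x v f d.
Proof.
move=> H.
have C0 : (fun h : R => h^-1 *: ((f \o shift x) (h *: v) - f x)) @ 0^' --> d.
  apply/cvgrPdist_le => e e0; near=> h; rewrite distrC.
  have h0 : h != 0 by near: h; exact: nbhs_dnbhs_neq.
  apply: le_trans (H h h0) _.
  apply: (@le_trans _ _ ((`|C| + 1) * `|h|)).
    by rewrite ler_wpM2r // (le_trans (ler_norm _)) // lerDl.
  rewrite -ler_pdivlMl ?ltr_pwDr //.
  near: h; apply: dnbhs0_le.
  by rewrite mulr_gt0 // invr_gt0 ltr_pwDr.
by split; [apply/cvg_ex; exists d|apply/cvg_lim].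
Unshelve. all: by end_near. Qed.

End Leibniz.

Lemma coord_le_norm {R : realType} {n : nat} (v : 'rV[R]_n) i : `|v 0 i| <= `|v|.
Proof.
rewrite [`|v|]mx_normrE.
exact: (le_bigmax _ (fun ij : 'I_1 * 'I_n => `|v ij.1 ij.2|) (0, i)).
Qed.

Lemma lipschitz_continuous_at {R : realType} {V W : normedModType R} (f : V -> W)
    (x : V) (C : R) :
  (forall y, `|f y - f x| <= C * `|y - x|) -> {for x, continuous f}.
Proof.
move=> L A /nbhs_ballP[e /= e0 eA]; apply/nbhs_ballP.
exists (e / (`|C| + 1)); first by rewrite /= divr_gt0.
move=> y; rewrite -ball_normE /= => yx; apply: eA; rewrite -ball_normE /= distrC.
apply: le_lt_trans (L y) _; rewrite distrC in yx.
apply: (@le_lt_trans _ _ ((`|C| + 1) * `|y - x|)).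
  by rewrite ler_wpM2r // (le_trans (ler_norm _)) // lerDl.
by rewrite mulrC -ltr_pdivlMr.
Qed.

(** * Chain rule for affine substitutions *)

Section AffineChange.
Context {R : realType} {p q : nat}.
Variables (a : 'M[R]_(p, q)) (b : 'rV[R]_q).

(** Under x |-> x a + b, a derivative in direction i becomes a sum over j with coefficients [a i j],
    so a word expands into weighted words of the same length. *)
Fixpoint lifts (w : seq 'I_p) : seq (R * seq 'I_q) :=
  if w is i :: w' then
    [seq (a i j * c.1, j :: c.2) | j <- enum 'I_q, c <- lifts w']
  else [:: (1, [::])].

Lemma mem_lifts w c : c \in lifts w -> size c.2 = size w.
Proof.
elim: w c => [|i w IH] c /=; first by rewrite inE => /eqP ->.
by move=> /allpairsP[[j d] /= [_ /IH h ->]] /=; rewrite h.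
Qed.

Definition affine (x : 'rV[R]_p) : 'rV[R]_q := x *m a + b.

Lemma affine_line x (h : R) i : affine (h *: basis_vec i + x) = affine x + h *: row i a.
Proof.
rewrite /affine mulmxDl -scalemxAl /basis_vec -rowE addrAC addrC.
by rewrite -addrA [b + _]addrC.
Qed.

Lemma tame_affine_continuous (u : 'rV[R]_q -> R) (x : 'rV[R]_p) : tame u ->
  {for x, continuous (u \o affine)}.
Proof.
move=> [su bu]; have [M HM] := bu 1%N; have M0 := bnd_ge0 HM.
pose C := \sum_j \sum_i `|a i j|.
have L y : `|u (affine y) - u (affine x)| <= M * C * `|y - x|.
  have -> : affine y = affine x + (y - x) *m a.
    by rewrite /affine mulmxBl addrAC [x *m a + _]addrC subrK.
  apply: le_trans (lipschitz _ _ su HM) _; rewrite -mulrA ler_wpM2l //.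
  rewrite mulr_suml; apply: ler_sum => j _; rewrite mxE mulr_suml.
  apply: le_trans (ler_norm_sum _ _ _) _; apply: ler_sum => i _.
  by rewrite normrM mulrC ler_wpM2l // coord_le_norm.
exact: lipschitz_continuous_at L.
Qed.

Lemma is_derive_affine (u : 'rV[R]_q -> R) x i : tame u ->
  is_derive x (basis_vec i) (u \o affine) (\sum_j a i j * pd j u (affine x)).
Proof.
move=> [su bu]; have [M HM] := bu 2%N.
apply: (@is_derive_bound _ _ _ _ _ _ (M * norm1 (row i a) ^+ 2)) => h h0.
rewrite /= affine_line; have := @taylor1 _ _ u (affine x) (h *: row i a) _ su HM.
set D := u _ - u _; rewrite norm1Z exprMn.
have -> : \sum_j (h *: row i a) 0 j * pd j u (affine x) = h * \sum_j a i j * pd j u (affine x).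
  by rewrite mulr_sumr; apply: eq_bigr => j _; rewrite !mxE mulrA.
set S := \sum_j _; rewrite -[D in D - _](mulVKf h0) -mulrBr normrM.
rewrite expr2 mulrCA -!mulrA ler_pM2l ?normr_gt0 // => /le_trans; apply.
rewrite (_ : `|h| * _ = M * (norm1 (row i a) * (norm1 (row i a) * `|h|))) ?lexx //.
by rewrite expr2; ring.
Qed.

Lemma affine_smooth (u : 'rV[R]_q -> R) : tame u ->
  smooth setT (u \o affine) /\ forall w x,
  pdw w (u \o affine) x = \sum_(c <- lifts w) c.1 * pdw c.2 u (affine x).
Proof.
move=> tu; have [|||s E1] := @smoothI _ _ setT (u \o affine)
   (fun w x => \sum_(c <- lifts w) c.1 * pdw c.2 u (affine x)) openT.
- by move=> x _; rewrite /= big_seq1 mul1r.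
- move=> w x _; apply: continuous_big => c; apply: continuousM.
    exact: cst_continuous.
  by apply: tame_affine_continuous; exact: tame_pdw.
- move=> w i x _; rewrite /= big_allpairs_dep /= exchange_big /=.
  apply: is_derive_big => c.
  have D := is_deriveZ c.1 (is_derive_affine x i (tame_pdw c.2 tu)).
  apply: is_derive_eq D _; rewrite /GRing.scale /= mulr_sumr big_enum /=.
  by apply: eq_bigr => j _; rewrite mulrCA mulrA.
- by split => // w x; exact: E1.
Qed.

Lemma tame_affine (u : 'rV[R]_q -> R) : tame u -> tame (u \o affine).
Proof.
move=> tu; have [s E1] := affine_smooth tu; split => // k.
have [M HM] := tu.2 k; have M0 := bnd_ge0 HM.
pose S w := \sum_(c <- lifts w) `|c.1|.
have [|M' _ HM'] := @bndon_ex _ _ setT (u \o affine) _ k; last by exists M'; apply/bnd_bndon.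
move=> w; have [N HN] := tu.2 (size w); exists (S w * N) => x _; rewrite E1.
apply: le_trans (ler_norm_sum _ _ _) _; rewrite mulr_suml.
rewrite big_seq [leRHS]big_seq; apply: ler_sum => c /mem_lifts cw.
by rewrite normrM ler_wpM2l // HN // cw.
Qed.

End AffineChange.

(** * Complex-valued functions *)

Section ComplexParts.
Context {R : realType} {n : nat}.
Local Notation C := (Rcomplex R).
Local Notation E := 'rV[R]_n.
Implicit Types (f g : E -> C) (U K : set E) (x : E) (w : seq 'I_n)
  (a : {ffun 'I_n -> nat}).

Definition rpart f : E -> R := fun x => complex.Re (f x).
Definition ipart f : E -> R := fun x => complex.Im (f x).

Lemma Rcomplex_eq (z1 z2 : C) : complex.Re z1 = complex.Re z2 ->
  complex.Im z1 = complex.Im z2 -> z1 = z2.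
Proof. by case: z1 z2 => a b [c d] /= -> ->. Qed.

Lemma normC_Re (z : C) : `|complex.Re z| <= `|z|.
Proof.
rewrite (_ : `|z| = Num.sqrt (complex.Re z ^+ 2 + complex.Im z ^+ 2)); last by case: z.
by rewrite -sqrtr_sqr ler_sqrt ?lerDl ?sqr_ge0 // addr_ge0 ?sqr_ge0.
Qed.

Lemma normC_Im (z : C) : `|complex.Im z| <= `|z|.
Proof.
rewrite (_ : `|z| = Num.sqrt (complex.Re z ^+ 2 + complex.Im z ^+ 2)); last by case: z.
by rewrite -sqrtr_sqr ler_sqrt ?lerDr ?sqr_ge0 // addr_ge0 ?sqr_ge0.
Qed.

Lemma normC_le (z : C) : `|z| <= `|complex.Re z| + `|complex.Im z|.
Proof.
rewrite (_ : `|z| = Num.sqrt (complex.Re z ^+ 2 + complex.Im z ^+ 2)); last by case: z.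
rewrite -[leRHS]ger0_norm ?addr_ge0 // -sqrtr_sqr ler_sqrt ?sqr_ge0 //.
rewrite sqrrD !real_normK ?num_real // addrAC lerDl.
by rewrite mulrn_wge0 // mulr_ge0.
Qed.

Definition word a : seq 'I_n := flatten [seq nseq (a i) i | i <- enum 'I_n].

Lemma size_word a : size (word a) = mi_deg a.
Proof.
rewrite /word size_flatten /shape -map_comp sumnE big_map /mi_deg big_enum /=.
by apply: eq_bigr => i _; rewrite size_nseq.
Qed.

Definition mi_count w : {ffun 'I_n -> nat} := [ffun i => count_mem i w].

Lemma perm_word w : perm_eq w (word (mi_count w)).
Proof.
apply/allP => i _ /=; apply/eqP.
rewrite count_flatten -map_comp sumnE big_map /=.
rewrite big_enum /= (bigD1 i) //= count_nseq /= eqxx mul1n ffunE big1 ?addn0 // => j ji.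
by rewrite count_nseq /= (negbTE ji).
Qed.

Lemma mi_deg_count w : mi_deg (mi_count w) = size w.
Proof. by rewrite -size_word; apply/esym/perm_size; exact: perm_word. Qed.

Lemma partialE i f : rpart (partial i f) = pd i (rpart f) /\
  ipart (partial i f) = pd i (ipart f).
Proof. by []. Qed.

Lemma pderivE a f : rpart (pderiv a f) = pdw (word a) (rpart f) /\
  ipart (pderiv a f) = pdw (word a) (ipart f).
Proof.
have iterE i k g : rpart (iter k (partial i) g) = pdw (nseq k i) (rpart g) /\
    ipart (iter k (partial i) g) = pdw (nseq k i) (ipart g).
  elim: k => //= k [<- <-]; exact: partialE.
rewrite /pderiv /word; elim: (enum 'I_n) => //= i s [IHr IHi].
rewrite !pdw_cat; have [-> ->] := iterE i (a i) (foldr (fun i g => iter (a i) (partial i) g) f s).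
by rewrite IHr IHi.
Qed.

Lemma Re_pderiv a f x : complex.Re (pderiv a f x) = pdw (word a) (rpart f) x.
Proof. by rewrite -(pderivE a f).1. Qed.

Lemma Im_pderiv a f x : complex.Im (pderiv a f x) = pdw (word a) (ipart f) x.
Proof. by rewrite -(pderivE a f).2. Qed.

Lemma smooth_onP U f : smooth_on U f <-> smooth U (rpart f) /\ smooth U (ipart f).
Proof.
split=> [|[sr si] k].
  move=> sf; suff H w : (forall x, U x -> {for x, continuous (pdw w (rpart f))} /\
        {for x, continuous (pdw w (ipart f))}) /\
      (forall i x, U x -> derivable (pdw w (rpart f)) x (basis_vec i) /\
        derivable (pdw w (ipart f)) x (basis_vec i)).
    split=> w x Ux; have [c d] := H w.
      by split; [exact: (c x Ux).1|move=> i; exact: (d i x Ux).1].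
    by split; [exact: (c x Ux).2|move=> i; exact: (d i x Ux).2].
  (* [Ck] takes the innermost derivative first, which is the last letter of the word. *)
  elim/last_ind: w f sf => [|w i IH] f sf.
    split; first by have [] := sf 0%N.
    by move=> i x Ux; have [_ H] := sf 1%N; have [D _] := H i; exact: D.
  rewrite -cats1 !pdw_cat /= -!(partialE i f).1 -!(partialE i f).2.
  by apply: IH => k; have [_ /(_ i)[]] := sf k.+1.
elim: k f sr si => [|k IH] f sr si /=.
  by split => // x Ux; split; [exact: (sr [::] x Ux).1|exact: (si [::] x Ux).1].
split.
  by move=> x Ux; split; [exact: (sr [::] x Ux).1|exact: (si [::] x Ux).1].
move=> i; split.
  by move=> x Ux; split; [exact: (sr [::] x Ux).2|exact: (si [::] x Ux).2].
by apply: IH; exact: smooth_pd.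
Qed.

Lemma pderiv_open U a f g : open U -> (forall x, U x -> f x = g x) ->
  forall x, U x -> pderiv a f x = pderiv a g x.
Proof.
move=> oU H x Ux; apply: Rcomplex_eq; rewrite ?Re_pderiv ?Im_pderiv;
  by apply: (@pdw_open _ _ U) => // y Uy; rewrite /rpart /ipart H.
Qed.

Lemma pderiv_norm_le U (M : R) f x a : 
  `|pdw (word a) (rpart f) x| <= M -> `|pdw (word a) (ipart f) x| <= M ->
  `|pderiv a f x| <= 2 * M.
Proof.
move=> h1 h2; apply: le_trans (normC_le _) _.
by rewrite Re_pderiv Im_pderiv mulr_natl mulr2n lerD.
Qed.

(** Since [sup set0 = 0], the hypothesis 0 <= M covers the empty set. *)
Lemma sup_le_ge0 (S : set R) (M : R) : 0 <= M -> (forall r, S r -> r <= M) -> sup S <= M.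
Proof.
move=> M0 H; have [S0|S0] := pselect (S !=set0); first exact: ge_sup.
rewrite sup_out // => -[] //.
Qed.

Lemma sup_ge0 (S : set R) : (forall r, S r -> 0 <= r) -> 0 <= sup S.
Proof.
move=> H; have [hS|hS] := pselect (has_sup S); last by rewrite sup_out.
have [[r Sr] _] := hS; apply: le_trans (H r Sr) _; apply: ub_le_sup => //.
by case: hS.
Qed.

Lemma snorm_le K m f (M : R) : 0 <= M ->
  (forall x a, K x -> (mi_deg a <= m)%N -> `|pderiv a f x| <= M) -> snorm K m f <= M.
Proof. by move=> M0 H; apply: sup_le_ge0 => // r [x [a [Kx am ->]]]; exact: H. Qed.

Lemma snorm_ge0 K m f : 0 <= snorm K m f.
Proof. by apply: sup_ge0 => r [x [a [_ _ ->]]]. Qed.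

Lemma bndon_compact U K (u : E -> R) k : smooth U u -> K `<=` U -> compact K ->
  exists2 M, 0 <= M & bndon K k M u.
Proof.
move=> su KU cK; apply: bndon_ex => w.
have c : {within K, continuous (fun x => `|pdw w u x|)}.
  apply: continuous_in_subspaceT => x; rewrite inE => /KU Ux.
  apply: (@continuous_comp _ _ _ (pdw w u) (fun y => `|y|)).
    exact: (su w x Ux).1.
  exact: norm_continuous.
have [S00|S00] := pselect (K !=set0); last first.
  by exists 0 => x Sx; case: S00; exists x.
have [z Sz Hz] := compact_EVT_max S00 cK c.
by exists `|pdw w u z| => x Sx; apply: Hz; rewrite inE.
Qed.

(** The [sup] of an unbounded set is 0, so an upper bound has to be exhibited before the supremum
    dominates its elements; compactness of K supplies it. *)
Lemma le_snorm U K m f x a : smooth_on U f -> compact K -> K `<=` U -> K x ->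
  (mi_deg a <= m)%N -> `|pderiv a f x| <= snorm K m f.
Proof.
move=> /smooth_onP[sr si] cK KU Kx am; apply: ub_le_sup; last by exists x, a.
have [M1 _ H1] := bndon_compact m sr KU cK.
have [M2 _ H2] := bndon_compact m si KU cK.
exists (M1 + M2) => r [y [b [Ky bm ->]]].
apply: le_trans (normC_le _) _; rewrite Re_pderiv Im_pderiv.
by apply: lerD; [apply: H1|apply: H2] => //; rewrite size_word.
Qed.

(* Bounds on the derivatives in all orders of differentiation: by symmetry of
   the partial derivatives they follow from those on the [pderiv a f]. *)
Lemma pdw_le_pderiv U f w x : open U -> smooth_on U f -> U x ->
  `|pdw w (rpart f) x| <= `|pderiv (mi_count w) f x| /\
  `|pdw w (ipart f) x| <= `|pderiv (mi_count w) f x|.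
Proof.
move=> oU /smooth_onP[sr si] Ux.
rewrite (pdw_perm oU sr (perm_word w) Ux) (pdw_perm oU si (perm_word w) Ux).
by rewrite -Re_pderiv -Im_pderiv; split; [exact: normC_Re|exact: normC_Im].
Qed.

Definition ctame f : Prop := tame (rpart f) /\ tame (ipart f).

Lemma supp_out f x : ~ supp f x -> f x = 0.
Proof.
by move=> H; apply: contrapT => fx; apply: H; exact: subset_closure.
Qed.

Lemma supp_sub (S : set E) f : closed S -> (forall x, ~ S x -> f x = 0) -> supp f `<=` S.
Proof.
move=> cS H; rewrite ((closure_id S).1 cS); apply: closureS => x fx.
by apply: contrapT => /H.
Qed.

Lemma ctame_compact (S : set E) f : smooth_on setT f -> compact S ->
  (forall x, ~ S x -> f x = 0) -> ctame f.
Proof.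
move=> /smooth_onP[sr si] cS H; split; apply: (@tame_compact _ _ _ S) => // x /H;
  by rewrite /rpart /ipart => ->.
Qed.

Lemma ctame_test f : lcs_pts (Dtest setT) f -> ctame f.
Proof.
by move=> [sf cf _]; apply: (@ctame_compact (supp f)) => // x; exact: supp_out.
Qed.

Lemma ctame_schwartz f : schwartz f -> ctame f.
Proof.
move=> [sf bf]; have [sr si] := (smooth_onP setT f).1 sf.
have H w : exists M, forall x, `|pderiv (mi_count w) f x| <= M.
  have [M HM] := bf [ffun=> 0%N] (mi_count w); exists M => x; apply: le_trans (HM x).
  rewrite (_ : monomial _ _ = 1) ?scale1r //.
  by rewrite /monomial big1 // => i _; rewrite ffunE expr0.
split; split => // k.
  have [|M _ HM] := @bndon_ex _ _ setT (rpart f) _ k; last by exists M; apply/bnd_bndon.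
  move=> w; have [M HM] := H w; exists M => x _; apply: le_trans (HM x).
  by have [] := pdw_le_pderiv w openT sf (I : setT x).
have [|M _ HM] := @bndon_ex _ _ setT (ipart f) _ k; last by exists M; apply/bnd_bndon.
move=> w; have [M HM] := H w; exists M => x _; apply: le_trans (HM x).
by have [] := pdw_le_pderiv w openT sf (I : setT x).
Qed.

Lemma ctameM f g : ctame f -> ctame g -> ctame (fun x => f x * g x).
Proof.
move=> [fr fi] [gr gi]; split.
  rewrite (_ : rpart _ = rpart f * rpart g - ipart f * ipart g).
    by apply: tameB; apply: tameM.
  by apply/funext => x; rewrite /rpart /ipart /= !fctE; case: (f x) (g x) => ? ? [].
rewrite (_ : ipart _ = rpart f * ipart g + ipart f * rpart g).
  by apply: tameD; apply: tameM.
by apply/funext => x; rewrite /rpart /ipart /= !fctE; case: (f x) (g x) => ? ? [].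
Qed.

End ComplexParts.

Lemma ctame_affine (R : realType) p q (a : 'M[R]_(p, q)) b (f : 'rV[R]_q -> Rcomplex R) :
  ctame f -> ctame (f \o affine a b).
Proof. by move=> [fr fi]; split; [exact: (tame_affine a b fr)|exact: (tame_affine a b fi)]. Qed.

(** * Smooth curves of kernels *)

Section SmoothScalars.
Context {R : realType}.
Implicit Types a b : R -> R.

Fixpoint nderivable (k : nat) a : Prop :=
  if k is k'.+1 then (forall t, derivable a t 1) /\ nderivable k' (derive1 a) else True.

Definition smooth_scalar a : Prop := forall k, nderivable k a.

Lemma nderivableS k a : nderivable k.+1 a -> nderivable k a.
Proof. by elim: k a => //= k IH a [da [dda H]]; split => //; exact: IH. Qed.

Lemma nderivableD k a b : nderivable k a -> nderivable k b -> nderivable k (a + b).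
Proof.
elim: k a b => //= k IH a b [da Ha] [db Hb]; split; first by move=> t; exact: derivableD.
rewrite (_ : derive1 (a + b) = derive1 a + derive1 b); first exact: IH.
by apply/funext => t; rewrite !fctE !derive1E deriveD.
Qed.

Lemma nderivableM k a b : nderivable k a -> nderivable k b -> nderivable k (a * b).
Proof.
elim: k a b => //= k IH a b [da Ha] [db Hb]; split; first by move=> t; exact: derivableM.
rewrite (_ : derive1 (a * b) = a * derive1 b + b * derive1 a).
  by apply: nderivableD; apply: IH => //; apply: nderivableS; split.
by apply/funext => t; rewrite !fctE !derive1E deriveM.
Qed.

Lemma smooth_scalarM a b : smooth_scalar a -> smooth_scalar b -> smooth_scalar (a * b).
Proof. by move=> sa sb k; exact: nderivableM. Qed.

Lemma smooth_scalar_derive1 a : smooth_scalar a -> smooth_scalar (derive1 a).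
Proof. by move=> sa k; have [] := sa k.+1. Qed.

Lemma smooth_scalar_seq (d : nat -> R -> R) :
  (forall k t, is_derive t (1 : R) (d k) (d k.+1 t)) -> forall k, smooth_scalar (d k).
Proof.
move=> H k m; elim: m k => //= m IH k; split; first by move=> t; have [] := H k t.
rewrite (_ : derive1 (d k) = d k.+1) //.
by apply/funext => t; rewrite derive1E; have [] := H k t.
Qed.

Lemma smooth_scalar_cst (r : R) : smooth_scalar (cst r).
Proof.
apply: (@smooth_scalar_seq (fun k _ => if k is 0 then r else 0) _ 0%N).
Qed.

End SmoothScalars.

(** * Sections of functions of two variables *)

Section Sections.
Context {R : realType} {p n : nat}.
Implicit Types (u : 'rV[R]_(p + n) -> R) (x : 'rV[R]_p) (y : 'rV[R]_n).

Definition ysec u x : 'rV[R]_n -> R := fun y => u (row_mx x y).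

Lemma ysec_affine u x : ysec u x = u \o affine (row_mx 0 1%:M) (row_mx x 0).
Proof.
apply/funext => y; rewrite /ysec /= /affine mul_mx_row mulmx0 mulmx1.
by rewrite add_row_mx add0r addr0.
Qed.

Lemma tame_ysec u x : tame u -> tame (ysec u x).
Proof. by rewrite ysec_affine; exact: tame_affine. Qed.

Lemma row_mx_basisr x y (h : R) i :
  row_mx x (h *: basis_vec i + y) = h *: basis_vec (rshift p i) + row_mx x y.
Proof.
rewrite -[basis_vec (rshift p i)]hsubmxK scale_row_mx add_row_mx; congr row_mx.
  rewrite [lsubmx _](_ : _ = 0) ?scaler0 ?add0r //.
  by apply/rowP => j; rewrite !mxE /= eq_lrshift.
congr (_ *: _ + _); apply/rowP => j; rewrite !mxE /=.
by rewrite eq_rshift.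
Qed.

Lemma is_derive_ysec u x y i (d : R) :
  is_derive (row_mx x y) (basis_vec (rshift p i)) u d ->
  is_derive y (basis_vec i) (ysec u x) d.
Proof.
have E0 : (fun h : R => h^-1 *: ((ysec u x \o shift y) (h *: basis_vec i) - ysec u x y))
  = (fun h : R => h^-1 *: ((u \o shift (row_mx x y)) (h *: basis_vec (rshift p i))
      - u (row_mx x y))).
  by apply/funext => h; rewrite /ysec /= /shift row_mx_basisr.
by move=> [D <-]; split; [rewrite /derivable E0|rewrite /derive E0].
Qed.

Lemma pdw_ysec u x w y : tame u ->
  pdw w (ysec u x) y = pdw (map (@rshift p n) w) u (row_mx x y).
Proof.
move=> tu; have [|||_ E1] := @smoothI _ _ setT (ysec u x)
   (fun w y => pdw (map (@rshift p n) w) u (row_mx x y)) openT.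
- by [].
- move=> w' y' _; have := @tame_ysec (pdw (map (@rshift p n) w') u) x (tame_pdw _ tu).
  by move=> [s _]; exact: (s [::] y' I).1.
- move=> w' i y' _; apply: is_derive_ysec.
  exact: (smooth_is_derive _ _ tu.1).
- exact: E1.
Qed.

End Sections.

Lemma mulr_sqr_div (R : fieldType) (x y : R) : x != 0 -> x * y ^+ 2 = x^-1 * (x * y) ^+ 2.
Proof. by move=> x0; field. Qed.

Lemma ler_norm_sum4 (R : realDomainType) (M x1 x2 x3 x4 r1 r2 r3 r4 : R) :
  `|x1| <= M * r1 -> `|x2| <= M * r2 -> `|x3| <= M * r3 -> `|x4| <= M * r4 ->
  `|x1 + x2 + x3 + x4| <= M * (r1 + r2 + r3 + r4).
Proof.
move=> h1 h2 h3 h4; rewrite !mulrDr.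
by do 3!(apply: le_trans (ler_normD _ _) _; apply: lerD => //).
Qed.

(** * Differentiation of kernels along smooth curves *)

Section KernelCurves.
Context {R : realType} {n : nat}.
Local Notation E := 'rV[R]_n.
Local Notation E2 := 'rV[R]_(n + n).
Implicit Types (u : E2 -> R) (G : R -> E2 -> R) (w : seq 'I_n).
Variables (S : set E) (d : nat -> R -> E).
Hypothesis dP : forall k t, is_curve_deriv (rV_lcs R n) (d k) t (d k.+1 t).

Lemma curve_norm1 k t :
  (fun h : R => norm1 (h^-1 *: (d k (t + h) - d k t) - d k.+1 t)) @ (0 : R)^' --> (0 : R).
Proof.
have H := dP k t (p := fun x : E => `|x|) erefl.
apply: (@squeeze_cvgr _ _ _ _ (cst 0) (fun h : R =>
    n%:R * `|h^-1 *: (d k (t + h) - d k t) - d k.+1 t|)).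
- by near=> h; rewrite norm1_ge0 norm1_norm.
- exact: cvg_cst.
- by rewrite -[X in _ --> X](mulr0 (n%:R : R)); apply: cvgM => //; exact: cvg_cst.
Unshelve. all: by end_near. Qed.

Lemma coord_derive k t i : is_derive t (1 : R) (fun t => d k t 0 i) (d k.+1 t 0 i).
Proof.
have C : (fun h : R => h^-1 *: (((fun t => d k t 0 i) \o shift t) (h *: 1) - d k t 0 i))
     @ 0^' --> d k.+1 t 0 i.
  apply/cvgrPdist_le => e e0; near=> h; rewrite distrC /=.
  apply: (@le_trans _ _ (norm1 (h^-1 *: (d k (t + h) - d k t) - d k.+1 t))).
    rewrite /norm1 (bigD1 i) //= !mxE (_ : h *: (1 : R) = h); last exact: mulr1.
    by rewrite [h + t]addrC -[leLHS]addr0; apply: lerD; [exact: lexx|exact: sumr_ge0].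
  near: h; have /cvgrPdist_le := curve_norm1 k t.
  by move=> /(_ e e0); apply: filterS => h; rewrite sub0r normrN ger0_norm ?norm1_ge0.
by split; [apply/cvg_ex; eexists; exact: C|exact/cvg_lim].
Unshelve. all: by end_near. Qed.

Lemma coord_smooth k i : smooth_scalar (fun t => d k t 0 i).
Proof. exact: (smooth_scalar_seq (fun k t => coord_derive k t i) k). Qed.

Definition vanishes u : Prop := forall x y, ~ S y -> u (row_mx x y) = 0.

(* For a smooth curve x, the maps t |-> (y |-> G t (x(t), y)) with G in this class
   are closed under differentiation in t. *)
Inductive kernel_curve : (R -> E2 -> R) -> Prop :=
| KernelTerm a u : smooth_scalar a -> tame u -> vanishes u ->
    kernel_curve (fun t z => a t * u z)
| KernelAdd G1 G2 : kernel_curve G1 -> kernel_curve G2 ->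
    kernel_curve (fun t z => G1 t z + G2 t z).

Lemma kernel_curve_tame G t : kernel_curve G -> tame (G t) /\ vanishes (G t).
Proof.
elim=> [a u _ tu vu|G1 G2 _ [t1 v1] _ [t2 v2]].
  by split; [exact: tameZ|move=> x y Sy; rewrite vu // mulr0].
by split; [exact: tameD|move=> x y Sy; rewrite v1 // v2 // addr0].
Qed.

(** Convergence of the difference quotients of t |-> G t (x(t), .) in the seminorms of test
    functions, x being [d 0]: the error e depends on t and k, but neither on y nor on the word w of
    length at most k. *)
Definition kernel_derivative G G' : Prop := forall t k, exists2 e : R -> R,
  e @ (0 : R)^' --> (0 : R) & forall h, h != 0 -> forall w y, (size w <= k)%N ->
  `|h^-1 * (pdw w (ysec (G (t + h)) (d 0%N (t + h))) y - pdw w (ysec (G t) (d 0%N t)) y)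
     - pdw w (ysec (G' t) (d 0%N t)) y| <= e h.

Lemma vanishes_pd u i : closed S -> vanishes u -> vanishes (pd (lshift n i) u).
Proof.
move=> cS vu x y Sy.
pose T := [set z : E2 | S (rsubmx z)].
have cT : closed T.
  apply: (@preimage_closed _ _ (rsubmx : E2 -> E)) => //.
  by move=> z _; exact/differentiable_continuous/differentiable_rsubmx.
apply: (@pdw_supp _ _ T u [:: lshift n i]) => //.
  by move=> z Tz; rewrite -[z]hsubmxK; apply: vu.
by rewrite /T /= row_mxKr.
Qed.

Lemma kernel_add_derivative G1 G1' G2 G2' : 
  kernel_curve G1 -> kernel_curve G1' -> kernel_curve G2 -> kernel_curve G2' ->
  kernel_derivative G1 G1' -> kernel_derivative G2 G2' ->
  kernel_derivative (fun t z => G1 t z + G2 t z) (fun t z => G1' t z + G2' t z).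
Proof.
move=> k1 k1' k2 k2' D1 D2 t k.
have [e1 c1 H1] := D1 t k; have [e2 c2 H2] := D2 t k.
exists (fun h => e1 h + e2 h).
  by rewrite -[X in _ --> X](addr0 (0 : R)); exact: cvgD.
move=> h h0 w y wk.
have sumE (H H' : R -> E2 -> R) s : kernel_curve H -> kernel_curve H' ->
    pdw w (ysec (fun z => H s z + H' s z) (d 0%N s)) y =
    pdw w (ysec (H s) (d 0%N s)) y + pdw w (ysec (H' s) (d 0%N s)) y.
  move=> kH kH'; have [tH _] := kernel_curve_tame s kH; have [tH' _] := kernel_curve_tame s kH'.
  by have [_] := smoothD openT (tame_ysec (d 0%N s) tH).1 (tame_ysec (d 0%N s) tH').1; apply.
have sumE' s : pdw w (ysec (fun z => G1' s z + G2' s z) (d 0%N t)) y =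
    pdw w (ysec (G1' s) (d 0%N t)) y + pdw w (ysec (G2' s) (d 0%N t)) y.
  have [tH _] := kernel_curve_tame s k1'; have [tH' _] := kernel_curve_tame s k2'.
  by have [_] := smoothD openT (tame_ysec (d 0%N t) tH).1 (tame_ysec (d 0%N t) tH').1; apply.
rewrite !sumE // (_ : _ - _ =
   (h^-1 * (pdw w (ysec (G1 (t + h)) (d 0%N (t + h))) y - pdw w (ysec (G1 t) (d 0%N t)) y)
     - pdw w (ysec (G1' t) (d 0%N t)) y) +
   (h^-1 * (pdw w (ysec (G2 (t + h)) (d 0%N (t + h))) y - pdw w (ysec (G2 t) (d 0%N t)) y)
     - pdw w (ysec (G2' t) (d 0%N t)) y)); last by ring.
by apply: le_trans (ler_normD _ _) _; apply: lerD; [exact: H1|exact: H2].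
Qed.

(** The t-derivative of a(t) u(x(t), y) by the product and chain rules, with velocity [d 1]. The sum
    runs over a list so that [kernel_curve_term] can build it up by [KernelAdd]. *)
Definition term_derivative (a : R -> R) u (t : R) (z : E2) : R :=
  derive1 a t * u z + \sum_(i <- enum 'I_n) (a t * d 1%N t 0 i) * pd (lshift n i) u z.

Lemma smooth_sum (T : Type) (s : seq T) (c : T -> R) (v : T -> E2 -> R) :
  (forall i, smooth setT (v i)) ->
  smooth setT (fun z => \sum_(i <- s) c i * v i z) /\
  forall W z, pdw W (fun z => \sum_(i <- s) c i * v i z) z = \sum_(i <- s) c i * pdw W (v i) z.
Proof.
move=> sv; have [|||sm E1] := @smoothI _ _ setT (fun z => \sum_(i <- s) c i * v i z)
   (fun W z => \sum_(i <- s) c i * pdw W (v i) z) openT.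
- by [].
- move=> W z _; apply: continuous_big => i; apply: continuousM.
    exact: cst_continuous.
  exact: (sv i W z I).1.
- move=> W i z _; apply: is_derive_big => j.
  exact: (is_deriveZ (c j) (smooth_is_derive W i (sv j) _)).
- by split => // W z; exact: E1.
Qed.

Lemma kernel_curve_term a u : closed S -> smooth_scalar a -> tame u -> vanishes u ->
  kernel_curve (term_derivative a u).
Proof.
move=> cS sa tu vu; rewrite /term_derivative; elim: (enum _) => [|i s IH].
  rewrite (_ : (fun t z => _) = fun t z => derive1 a t * u z).
    by apply: KernelTerm => //; exact: smooth_scalar_derive1.
  by apply/funext => t; apply/funext => z; rewrite big_nil addr0.
rewrite (_ : (fun t z => _) = fun t z =>
    (derive1 a t * u z + \sum_(i <- s) (a t * d 1%N t 0 i) * pd (lshift n i) u z)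
    + (a * (fun t => d 1%N t 0 i)) t * pd (lshift n i) u z).
  apply: KernelAdd => //; apply: KernelTerm.
  - by apply: smooth_scalarM => //; exact: coord_smooth.
  - exact: (@tame_pdw _ _ [:: lshift n i]).
  - exact: vanishes_pd.
by apply/funext => t; apply/funext => z; rewrite big_cons addrCA addrC.
Qed.

Lemma kernel_term_derivative a u : closed S -> smooth_scalar a -> tame u -> vanishes u ->
  kernel_derivative (fun t z => a t * u z) (term_derivative a u).
Proof.
(* The y-derivatives take k orders, and the second-order remainder in x takes two more. *)
move=> cS sa tu vu t k; have [M bu] := tu.2 (k + 2)%N; have M0 := bnd_ge0 bu.
pose q (h : R) := norm1 (h^-1 *: (d 0%N (t + h) - d 0%N t) - d 1%N t).
pose r (h : R) := `|h^-1 * (a (t + h) - a t) - derive1 a t|.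
pose N := norm1 (d 1%N t).
(* The four summands bound, in this order, the four terms into which the error is split below: error
   of the difference quotient of a, increment of the kernel, its Taylor remainder, error of the
   velocity. *)
exists (fun h => M * (r h + `|derive1 a t| * (`|h| * (q h + N)) +
    `|a t| * (`|h| * (q h + N) ^+ 2) + `|a t| * q h)).
  have q0 : q @ (0 : R)^' --> (0 : R) by exact: curve_norm1.
  have h0 : (fun h : R => `|h|) @ (0 : R)^' --> (0 : R).
    rewrite -[X in _ --> X](normr0 R); apply: cvg_norm.
    by apply: cvg_within_filter; exact: cvg_id.
  have r0 : r @ (0 : R)^' --> (0 : R).
    have [Da _] := sa 1%N; have := Da t.
    move=> /cvg_ex[l Cl].
    have lE : l = derive1 a t by rewrite derive1E /derive; apply/esym/cvg_lim.
    rewrite lE in Cl.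
    rewrite /r -[X in _ --> X](normr0 R); apply: cvg_norm.
    rewrite -[X in _ --> X](subrr (derive1 a t)).
    apply: cvgB; last exact: cvg_cst.
    rewrite (_ : (fun h : R => _) = (fun h : R => h^-1 *: ((a \o shift t) (h *: (1 : R)) - a t))) //.
    apply/funext => h; rewrite /= /shift (_ : h *: (1 : R) = h); last exact: mulr1.
    by rewrite [h + t]addrC.
  have Z : M * (0 + `|derive1 a t| * (0 * (0 + N)) + `|a t| * (0 * (0 + N) ^+ 2) + `|a t| * 0) = 0.
    by ring.
  rewrite -[X in _ --> X]Z; have qN : (fun h => q h + N) @ (0 : R)^' --> 0 + N.
    by apply: cvgD => //; exact: cvg_cst.
  apply: cvgM; first exact: cvg_cst.
  apply: cvgD; last by apply: cvgM => //; exact: cvg_cst.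
  apply: cvgD; last first.
    apply: cvgM; first exact: cvg_cst.
    by apply: cvgM => //; under eq_fun do rewrite expr2; rewrite expr2; exact: cvgM.
  apply: cvgD => //; apply: cvgM; first exact: cvg_cst.
  exact: cvgM.
move=> h h0 w y wk.
pose v := pdw (map (@rshift n n) w) u.
have tv : tame v by exact: tame_pdw.
have bv : bnd 2 M v.
  apply: bnd_pdw; apply: bnd_le bu => //.
  by rewrite size_map addnC leq_add2r.
have tE s : pdw w (ysec (fun z => a s * u z) (d 0%N s)) y = a s * v (row_mx (d 0%N s) y).
  rewrite pdw_ysec; last exact: tameZ.
  by have [_ ->] := smoothZ (a s) openT tu.1.
have tE' : pdw w (ysec (term_derivative a u t) (d 0%N t)) y =
   derive1 a t * v (row_mx (d 0%N t) y) + a t * \sum_i d 1%N t 0 i * pd (lshift n i) v (row_mx (d 0%N t) y).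
  have sd i : smooth setT (pd (lshift n i) u) by exact: smooth_pd tu.1.
  have [ss sE] := smooth_sum (enum 'I_n) (fun i => a t * d 1%N t 0 i) sd.
  have [sZ sZE] := smoothZ (derive1 a t) openT tu.1.
  have [sT sTE] := smoothD openT sZ ss.
  have [_ E1] : smooth setT (term_derivative a u t) /\ forall z,
     pdw (map (@rshift n n) w) (term_derivative a u t) z = derive1 a t * v z +
       \sum_(i <- enum 'I_n) a t * d 1%N t 0 i * pdw (map (@rshift n n) w) (pd (lshift n i) u) z.
    by split; [exact: sT|move=> z; rewrite -sE -sZE // -sTE].
  rewrite pdw_ysec; last by have [] := kernel_curve_tame t (kernel_curve_term cS sa tu vu).
  rewrite E1 big_enum /= mulr_sumr; congr (_ + _); apply: eq_bigr => i _.
  rewrite -mulrA; congr (_ * (_ * _)).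
  rewrite /v -[pd (lshift n i) u]/(pdw [:: lshift n i] u) -pdw_cat.
  rewrite -[pd (lshift n i) (pdw _ _)]/(pdw (lshift n i :: map (@rshift n n) w) u).
  (* The x-derivative is moved past the y-derivatives of w. *)
  by apply: (pdw_perm openT tu.1) => //; rewrite cats1 perm_rcons.
rewrite !tE tE'; set z := row_mx (d 0%N t) y.
set D := d 0%N (t + h) - d 0%N t.
have zE : row_mx (d 0%N (t + h)) y = z + row_mx D 0.
  by rewrite /z /D add_row_mx addr0 [d 0%N t + _]addrC subrK.
have nE : norm1 (row_mx D 0 : E2) = norm1 D.
  rewrite /norm1 big_split_ord /= [X in _ + X]big1 ?addr0.
    by apply: eq_bigr => i _; rewrite row_mxEl.
  by move=> i _; rewrite row_mxEr mxE normr0.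
have T0 := lipschitz z (row_mx D 0) tv.1 (bnd_le (isT : (1 <= 2)%N) (lexx M) bv).
have T1 := taylor1 z (row_mx D 0) tv.1 bv.
have sumE : \sum_i row_mx D 0 0 i * pd i v z = \sum_i D 0 i * pd (lshift n i) v z.
  rewrite big_split_ord /= [X in _ + X]big1 ?addr0.
    by apply: eq_bigr => i _; rewrite row_mxEl.
  by move=> i _; rewrite row_mxEr mxE mul0r.
rewrite sumE in T1; rewrite nE in T0 T1; rewrite zE.
have Dq : norm1 D <= `|h| * (q h + N).
  rewrite -[D in norm1 D](scalerKV h0) norm1Z ler_wpM2l //.
  rewrite -[_ *: D](subrK (d 1%N t)) /q /N -/D /norm1 -big_split; apply: ler_sum => i _ /=.
  by rewrite mxE ler_normD.
have Dq2 : `|h^-1| * norm1 D ^+ 2 <= `|h| * (q h + N) ^+ 2.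
  have -> : `|h| * (q h + N) ^+ 2 = `|h^-1| * (`|h| * (q h + N)) ^+ 2.
    by rewrite normfV; apply: mulr_sqr_div; rewrite normr_eq0.
  by rewrite ler_wpM2l // ler_sqr // ?nnegrE ?norm1_ge0 // mulr_ge0 // addr_ge0 // norm1_ge0.
have T2 : `|\sum_i (h^-1 * D 0 i - d 1%N t 0 i) * pd (lshift n i) v z| <= M * q h.
  apply: le_trans (ler_norm_sum _ _ _) _; rewrite /q -/D mulr_sumr; apply: ler_sum => i _.
  rewrite normrM mulrC !mxE ler_wpM2r //.
  exact: (bv [:: lshift n i]).
have E1 : h^-1 * (a (t + h) * v (z + row_mx D 0) - a t * v z) - (derive1 a t * v z +
     a t * \sum_i d 1%N t 0 i * pd (lshift n i) v z) =
   (h^-1 * (a (t + h) - a t) - derive1 a t) * v (z + row_mx D 0)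
   + derive1 a t * (v (z + row_mx D 0) - v z)
   + a t * (h^-1 * (v (z + row_mx D 0) - v z - \sum_i D 0 i * pd (lshift n i) v z))
   + a t * (\sum_i (h^-1 * D 0 i - d 1%N t 0 i) * pd (lshift n i) v z).
  have -> : \sum_i (h^-1 * D 0 i - d 1%N t 0 i) * pd (lshift n i) v z =
     h^-1 * \sum_i D 0 i * pd (lshift n i) v z - \sum_i d 1%N t 0 i * pd (lshift n i) v z.
    by rewrite mulr_sumr -sumrB; apply: eq_bigr => i _; rewrite mulrBl mulrA.
  by move: (\sum_i D 0 i * _) (\sum_i d 1%N t 0 i * _) => s1 s2; ring.
rewrite E1.
apply: ler_norm_sum4.
- by rewrite normrM mulrC ler_wpM2r // (bv [::]).
- by rewrite normrM mulrCA ler_wpM2l //; apply: le_trans T0 _; rewrite ler_wpM2l.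
- rewrite normrM mulrCA ler_wpM2l // normrM.
  apply: le_trans (ler_wpM2l _ T1) _ => //.
  by rewrite mulrCA ler_wpM2l.
- by rewrite normrM mulrCA ler_wpM2l.
Qed.

Lemma kernel_curve_next G : closed S -> kernel_curve G ->
  exists G', kernel_curve G' /\ kernel_derivative G G'.
Proof.
move=> cS; elim=> [a u sa tu vu|G1 G2 k1 [G1' [k1' D1]] k2 [G2' [k2' D2]]].
  exists (term_derivative a u); split; first exact: kernel_curve_term.
  exact: kernel_term_derivative.
exists (fun t z => G1' t z + G2' t z); split; first exact: KernelAdd.
exact: kernel_add_derivative.
Qed.

End KernelCurves.

(** * Kernels as smooth maps into spaces of test functions *)

Section KernelSmooth.
Context {R : realType} {n : nat}.
Local Notation E := 'rV[R]_n.
Local Notation C := (Rcomplex R).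
Implicit Types (S U : set E) (F : lcs (E -> C)) (Phi : 'rV[R]_(n + n) -> C).

(** What the curve argument asks of a target space, so that it serves both D_L and D(Omega): smooth
    functions vanishing off S belong to it, and each seminorm is controlled by a bound on the
    derivatives up to some order. *)
Definition test_lcs S F : Prop :=
  (forall f, smooth_on setT f -> (forall y, ~ S y -> f y = 0) -> lcs_pts F f) /\
  forall p, lcs_seminorms F p -> exists (k : nat) (M : R), forall f (b : R),
    smooth_on setT f -> (forall y, ~ S y -> f y = 0) -> 0 <= b ->
    (forall w y, (size w <= k)%N ->
       `|pdw w (rpart f) y| <= b /\ `|pdw w (ipart f) y| <= b) ->
    `|p f| <= M * b.

Lemma pdw_quotient (r : R) (A B D : E -> R) : tame A -> tame B -> tame D ->
  smooth setT (fun y => r * (A y - B y) - D y) /\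
  forall w y, pdw w (fun y => r * (A y - B y) - D y) y =
    r * (pdw w A y - pdw w B y) - pdw w D y.
Proof.
move=> [sA _] [sB _] [sD _].
have [s1 e1] := smoothB openT sA sB.
have [s2 e2] := smoothZ r openT s1.
have [s3 e3] := smoothB openT s2 sD.
by split => // w y; rewrite -e1 // -e2 // -e3.
Qed.

Lemma kernel_smooth_curve S F Phi (c : R -> E) : closed S -> test_lcs S F -> ctame Phi ->
  (forall x y, ~ S y -> Phi (row_mx x y) = 0) ->
  smooth_curve (rV_lcs R n) c -> smooth_curve F (fun t y => Phi (row_mx (c t) y)).
Proof.
move=> cS [FS pS] [tr ti] vPhi [d [d0 dP']].
have dP k t : is_curve_deriv (rV_lcs R n) (d k) t (d k.+1 t) by have [] := dP' k t.
(* Choice makes the passage from a kernel to its derivative a function, whose iterates supply the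
   whole sequence required by [smooth_curve]. *)
have nx (G : {G | kernel_curve S G}) : exists G' : {G | kernel_curve S G},
    kernel_derivative d (sval G) (sval G').
  by have [G' [kG' D]] := kernel_curve_next dP cS (svalP G); exists (exist _ G' kG').
have [next nextP] := choice nx.
have ini (u : 'rV[R]_(n + n) -> R) : tame u -> (forall x y, ~ S y -> u (row_mx x y) = 0) ->
    exists G : nat -> {G | kernel_curve S G},
     (forall t z, sval (G 0%N) t z = u z) /\
     forall k, kernel_derivative d (sval (G k)) (sval (G k.+1)).
  move=> tu vu; have k0 : kernel_curve S (fun t z => (cst 1 : R -> R) t * u z).
    by apply: KernelTerm => //; exact: smooth_scalar_cst.
  exists (fun k => iter k next (exist _ _ k0)); split; first by move=> t z /=; rewrite mul1r.
  by move=> k; rewrite iterS; exact: nextP.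
have [Gr [Gr0 GrP]] : exists G : nat -> {G | kernel_curve S G},
     (forall t z, sval (G 0%N) t z = rpart Phi z) /\
     forall k, kernel_derivative d (sval (G k)) (sval (G k.+1)).
  by apply: ini => // x y Sy; rewrite /rpart vPhi.
have [Gi [Gi0 GiP]] : exists G : nat -> {G | kernel_curve S G},
     (forall t z, sval (G 0%N) t z = ipart Phi z) /\
     forall k, kernel_derivative d (sval (G k)) (sval (G k.+1)).
  by apply: ini => // x y Sy; rewrite /ipart vPhi.
pose D (k : nat) (t : R) : E -> C := fun y =>
  Complex (ysec (sval (Gr k) t) (d 0%N t) y) (ysec (sval (Gi k) t) (d 0%N t) y).
have tG (G : {G | kernel_curve S G}) t s : tame (ysec (sval G t) (d 0%N s)).
  by apply: tame_ysec; have [] := kernel_curve_tame t (svalP G).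
have vG (G : {G | kernel_curve S G}) t s y : ~ S y -> ysec (sval G t) (d 0%N s) y = 0.
  by move=> Sy; have [_] := kernel_curve_tame t (svalP G); apply.
exists D; split.
  apply/funext => t; apply/funext => y; rewrite /D /ysec Gr0 Gi0 -d0 /rpart /ipart.
  by case: (Phi _).
move=> k t; split.
  apply: FS.
    by apply/smooth_onP; split; [exact: (tG (Gr k) t t).1|exact: (tG (Gi k) t t).1].
  by move=> y Sy; rewrite /D !vG.
move=> p /pS[k' [M HM]].
have [er cr Hr] := GrP k t k'; have [ei ci Hi] := GiP k t k'.
pose f h : E -> C := h^-1 *: (D k (t + h) - D k t) - D k.+1 t.
have fr h : rpart (f h) = fun y => h^-1 * (ysec (sval (Gr k) (t + h)) (d 0%N (t + h)) y
    - ysec (sval (Gr k) t) (d 0%N t) y) - ysec (sval (Gr k.+1) t) (d 0%N t) y by [].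
have fi h : ipart (f h) = fun y => h^-1 * (ysec (sval (Gi k) (t + h)) (d 0%N (t + h)) y
    - ysec (sval (Gi k) t) (d 0%N t) y) - ysec (sval (Gi k.+1) t) (d 0%N t) y by [].
have B h : h != 0 -> `|p (f h)| <= `|M| * (`|er h| + `|ei h|).
  move=> h0.
  have [sr Er] := pdw_quotient h^-1 (tG (Gr k) (t + h) (t + h)) (tG (Gr k) t t) (tG (Gr k.+1) t t).
  have [si Ei] := pdw_quotient h^-1 (tG (Gi k) (t + h) (t + h)) (tG (Gi k) t t) (tG (Gi k.+1) t t).
  apply: (@le_trans _ _ (M * (`|er h| + `|ei h|))); last by rewrite ler_wpM2r ?ler_norm // addr_ge0.
  apply: HM.
  - by apply/smooth_onP; rewrite fr fi.
  - by move=> y Sy; apply: Rcomplex_eq; rewrite -/(rpart (f h) y) -/(ipart (f h) y) ?fr ?fi !vG //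
      !subr0 mulr0.
  - by rewrite addr_ge0.
  - move=> w y wk; rewrite fr fi Er Ei; split.
      by apply: le_trans (Hr h h0 w y wk) _; rewrite (le_trans (ler_norm _)) // lerDl.
    by apply: le_trans (Hi h h0 w y wk) _; rewrite (le_trans (ler_norm _)) // lerDr.
apply: norm_cvg0.
apply: (@squeeze_cvgr _ _ _ _ (cst 0) (fun h => `|M| * (`|er h| + `|ei h|))).
- near=> h; rewrite normr_ge0 /=; apply: B; near: h; exact: nbhs_dnbhs_neq.
- exact: cvg_cst.
- rewrite -[X in _ --> X](mulr0 `|M|); apply: cvgM; first exact: cvg_cst.
  rewrite -[X in _ --> X](addr0 (0 : R)); apply: cvgD.
    by rewrite -[X in _ --> X](normr0 R); exact: cvg_norm.
  by rewrite -[X in _ --> X](normr0 R); exact: cvg_norm.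
Unshelve. all: by end_near. Qed.

Lemma kernel_CinfV S F Phi U : closed S -> test_lcs S F -> ctame Phi ->
  (forall x y, ~ S y -> Phi (row_mx x y) = 0) ->
  lcs_pts (CinfV U F) (restr U (fun x y => Phi (row_mx x y))).
Proof.
move=> cS FS tPhi vPhi; split=> [c sc Uc|x Ux]; last by rewrite /restr patchN // notin_setE.
rewrite (_ : _ \o c = fun t y => Phi (row_mx (c t) y)); first exact: (kernel_smooth_curve cS).
by apply/funext => t /=; rewrite /restr patchT // inE.
Qed.

Lemma test_lcs_Dsupp (L : set E) : closed L -> test_lcs L (Dsupp L).
Proof.
move=> cL; split=> [f sf fL|p [m ->]]; first by split => //; exact: supp_sub.
exists m, 2 => f b sf fL b0 H; rewrite ger0_norm ?snorm_ge0 //.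
apply: snorm_le => [|x a _ am]; first by rewrite mulr_ge0.
have [|h1 h2] := H (word a) x; first by rewrite size_word.
exact: (@pderiv_norm_le _ _ setT).
Qed.

Lemma test_lcs_Dtest (Omega K : set E) : compact K -> K `<=` Omega ->
  test_lcs K (Dtest Omega).
Proof.
move=> cK KO.
have clK : closed K by apply: compact_closed => //; exact: norm_hausdorff.
have tst f : smooth_on setT f -> (forall y, ~ K y -> f y = 0) -> lcs_pts (Dtest Omega) f.
  move=> sf fK; have sK := supp_sub clK fK; split => //.
    by apply: subclosed_compact cK _ => //; exact: closed_closure.
  exact: subset_trans KO.
split=> // p [pD pZ pK].
have [m [M HM]] := pK K cK KO.
exists m, (`|M| * 2) => f b sf fK b0 H.
have tf := tst f sf fK.
have sb : snorm K m f <= 2 * b.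
  apply: snorm_le => [|x a _ am]; first by rewrite mulr_ge0.
  have [|h1 h2] := H (word a) x; first by rewrite size_word.
  exact: (@pderiv_norm_le _ _ setT).
(* Nonnegativity follows from the seminorm axioms: 0 = p (f - f) <= p f + p (- f) = 2 p f. *)
have p0 : 0 <= p f.
  have tN : lcs_pts (Dtest Omega) (- f).
    apply: tst; last by move=> y /fK fy; rewrite fctE fy oppr0.
    have [sr si] := (smooth_onP setT f).1 sf; apply/smooth_onP; split.
      have [+ _] := smoothZ (-1) openT sr; rewrite (_ : (fun x => _) = rpart (- f)) //.
      by apply/funext => y; rewrite mulN1r /rpart fctE; case: (f y).
    have [+ _] := smoothZ (-1) openT si; rewrite (_ : (fun x => _) = ipart (- f)) //.
    by apply/funext => y; rewrite mulN1r /ipart fctE; case: (f y).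
  have fE : (fun y => -1 * f y) = - f by apply/funext => y; rewrite mulN1r.
  have h1 := pD f (- f) tf tN.
  have n1 : `|1 : C| = 1.
    rewrite (_ : `|1 : C| = Num.sqrt (1 ^+ 2 + 0 ^+ 2)) //.
    by rewrite expr1n expr0n addr0 sqrtr1.
  have h2 := pZ (-1) f tf; rewrite fE normrN n1 mul1r in h2.
  have h3 := pZ 0 f tf; rewrite normr0 mul0r in h3.
  have fE0 : (fun y => 0 * f y) = f + - f by apply/funext => y; rewrite mul0r !fctE subrr.
  rewrite fE0 in h3; rewrite h3 h2 -mulr2n in h1.
  by rewrite -(pmulrn_lge0 _ (n := 2)).
rewrite ger0_norm //; apply: le_trans (HM f tf (supp_sub clK fK)) _.
apply: (@le_trans _ _ (`|M| * snorm K m f)).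
  by rewrite ler_wpM2r ?ler_norm // snorm_ge0.
by rewrite -mulrA ler_wpM2l.
Qed.

End KernelSmooth.

(** * Iterated integrals *)

Section LineIntegral.
Context {R : realType}.
Local Notation mu := (@lebesgue_measure R).
Implicit Types (f g : R -> R) (A c s t : R).

Definition decaying A f : Prop :=
  continuous f /\ forall t, `|f t| <= A * (1 + t ^+ 2)^-1.

Lemma oneDsqr_pos t : 0 < 1 + t ^+ 2.
Proof. by rewrite ltr_pwDl // sqr_ge0. Qed.

Lemma continuous_oneDsqrV' : continuous (fun t : R => (1 + t ^+ 2)^-1).
Proof. exact: continuous_oneDsqrV. Qed.

Lemma continuous_scaled A f : continuous f -> continuous (fun t => A * f t).
Proof. by move=> cf t; apply: cvgM; [exact: cvg_cst|exact: cf]. Qed.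

Lemma continuous_posneg f : continuous f ->
  continuous (fun t => Num.max (f t) 0) /\ continuous (fun t => Num.max (- f t) 0).
Proof.
move=> cf; split=> t.
  exact: (@continuous_max _ _ f (cst 0) t (cf t) (@cst_continuous _ _ 0 t)).
exact: (@continuous_max _ _ (- f) (cst 0) t (continuousN (cf t)) (@cst_continuous _ _ 0 t)).
Qed.

Lemma max0_ge0 (x : R) : 0 <= Num.max x 0.
Proof. by rewrite le_max lexx orbT. Qed.

Lemma continuous_measurable f : continuous f -> measurable_fun setT (EFin \o f).
Proof. by move=> cf; apply/measurable_EFinP; exact: continuous_measurable_fun. Qed.

Lemma integrable_oneDsqrV :
  mu.-integrable setT (EFin \o (fun t : R => (1 + t ^+ 2)^-1)).
Proof.
have c := continuous_oneDsqrV'.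
apply/integrableP; split; first exact: continuous_measurable.
under eq_integral => t _ do
  rewrite /= ger0_norm ?invr_ge0 ?(ltW (oneDsqr_pos t)) //.
rewrite ge0_symfun_integralT //.
- by rewrite -set_itvcy integral0y_oneDsqr -EFinM ltry.
- by move=> t; rewrite invr_ge0 ltW // oneDsqr_pos.
- by move=> t /=; rewrite sqrrN.
Qed.

Definition line_const : R := \int[mu]_t (1 + t ^+ 2)^-1.

Lemma line_const_ge0 : 0 <= line_const.
Proof. by apply: Rintegral_ge0 => t _; rewrite invr_ge0 ltW // oneDsqr_pos. Qed.

Lemma integrable_decaying A f : decaying A f -> mu.-integrable setT (EFin \o f).
Proof.
move=> [cf fA]; apply: (@le_integrable _ _ _ mu setT measurableT _
    (EFin \o (fun t : R => A * (1 + t ^+ 2)^-1))).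
- exact: continuous_measurable.
- move=> t _ /=; rewrite lee_fin; apply: le_trans (fA t) _; exact: ler_norm.
- exact: (integrableZl measurableT A integrable_oneDsqrV).
Qed.

Lemma le_line_integral A f : decaying A f -> `|\int[mu]_t f t| <= A * line_const.
Proof.
move=> df; have If := integrable_decaying df.
apply: le_trans (le_normr_Rintegral measurableT If) _.
rewrite /line_const -RintegralZl //; last exact: integrable_oneDsqrV.
apply: le_Rintegral => //.
- exact: integrable_norm If.
- apply: (@integrable_decaying `|A|); split.
    suff : continuous (fun t : R => A * (1 + t ^+ 2)^-1) by [].
    exact: continuous_scaled continuous_oneDsqrV'.
  by move=> t; rewrite normrM ler_wpM2l // ger0_norm // invr_ge0 ltW // oneDsqr_pos.
- by move=> t _; have [_] := df.
Qed.

Lemma line_integral_dct A (f_ : nat -> R -> R) f : (forall k, decaying A (f_ k)) ->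
  decaying A f -> (forall t, f_ k t @[k --> \oo] --> f t) ->
  \int[mu]_t f_ k t @[k --> \oo] --> \int[mu]_t f t.
Proof.
move=> df_ df H.
have If := integrable_decaying df.
apply: fine_cvg; rewrite fineK; last exact: integrable_fin_num If.
apply: (@dominated_cvg _ _ _ mu setT measurableT _ _
    (EFin \o (fun t : R => A * (1 + t ^+ 2)^-1))).
- by move=> k; apply: continuous_measurable; have [] := df_ k.
- by move=> t _ /=; apply: cvg_EFin; [exact: nearW|exact: H].
- by move=> t _.
- exact: (integrableZl measurableT A integrable_oneDsqrV).
- by move=> k t _ /=; rewrite lee_fin; have [_] := df_ k.
Qed.

Lemma line_integralD A B f g : decaying A f -> decaying B g ->
  \int[mu]_t (f t + g t) = \int[mu]_t f t + \int[mu]_t g t.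
Proof. by move=> df dg; apply: RintegralD => //; apply: integrable_decaying; eauto. Qed.

Lemma line_integralZ A c f : decaying A f ->
  \int[mu]_t (c * f t) = c * \int[mu]_t f t.
Proof. by move=> df; apply: RintegralZl => //; apply: integrable_decaying; eauto. Qed.

Local Open Scope ereal_scope.

Lemma ge0_integral_reflect f : continuous f -> (forall t, 0 <= f t)%R ->
  \int[mu]_t (f (- t))%:E = \int[mu]_t (f t)%:E.
Proof.
(* Each integral is a sum over two half-lines, and the reflection exchanges the summands. *)
have split_half (g : R -> R) : continuous g -> (forall t, 0 <= g t)%R ->
    \int[mu]_t (g t)%:E = \int[mu]_(t in `[0%R, +oo[) (g t)%:E +
      \int[mu]_(t in `[0%R, +oo[) (g (- t))%:E.
  move=> cg g0; have mg : measurable_fun [set: R] g by exact: continuous_measurable_fun.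
  have mposnums : measurable [set x : R | 0 <= x]%R by rewrite -set_itvcy.
  rewrite -(setUv [set x : R | 0 <= x]%R) ge0_integral_setU//= ; last 4 first.
    exact: measurableC.
    by apply/measurable_EFinP; rewrite setUv.
    by move=> x _; rewrite lee_fin.
    exact/disj_setPCl.
  rewrite -set_itvcy// setCitvr; congr +%E.
  rewrite integral_itv_bndo_bndc; last exact/measurable_EFinP/measurable_funTS.
  rewrite -{1}oppr0 ge0_integration_by_substitutionNy//.
  exact: continuous_subspaceT.
move=> cf f0; rewrite split_half //; last first.
  move=> t; apply: continuous_comp; [exact: opp_continuous|exact: cf].
rewrite [RHS]split_half // addeC; congr (_ + _).
by apply: eq_integral => t _; rewrite opprK.
Qed.

Lemma ge0_integral_affine f (c s : R) : continuous f -> (forall t, 0 <= f t)%R ->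
  (0 < s)%R -> \int[mu]_t (s * f (c + s * t))%:E = \int[mu]_t (f t)%:E.
Proof.
move=> cf f0 s0.
pose F := fun t : R => (c + s * t)%R.
have dF (t : R) : is_derive t (1%R : R) F s.
  have := is_deriveD (is_derive_cst c t (1%R : R)) (is_deriveZ s (is_derive_id t (1%R : R))).
  by rewrite add0r /GRing.scale /= mulr1.
have F' : derive1 F = cst s.
  by apply/funext => t; rewrite derive1E; have [] := dF t.
rewrite (@increasing_ge0_integration_by_substitutionT _ F f) //.
- by apply: eq_integral => t _; rewrite F' /= mulrC.
- by move=> x y xy; rewrite /F ltrD2l ltr_pM2l.
- by rewrite F'; exact: cst_continuous.
- by rewrite F'; exact: is_cvg_cst.
- by rewrite F'; exact: is_cvg_cst.
- apply/cvgrNyPle => B; near=> u; rewrite /F addrC -lerBrDr -ler_pdivlMl //.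
- apply/cvgryPge => B; near=> u; rewrite /F addrC -lerBlDr -ler_pdivrMl //.
Unshelve. all: by end_near. Qed.

(** Positive and negative parts reduce the case s > 0 to [ge0_integral_affine]; a negative s is a
    positive one combined with a reflection. *)
Lemma line_integral_affine A f c s : decaying A f -> s != 0%R ->
  (\int[mu]_t (`|s| * f (c + s * t)) = \int[mu]_t f t)%R.
Proof.
move=> [cf _].
have key (s' : R) : (0 < s')%R -> forall g : R -> R, continuous g ->
    (\int[mu]_t (s' * g (c + s' * t)) = \int[mu]_t g t)%R.
  move=> s'0 g cg; have [cp cn] := continuous_posneg cg.
  rewrite /Rintegral integralE [in RHS]integralE; congr (fine (_ - _)).
    transitivity (\int[mu]_t (s' * Num.max (g (c + s' * t)) 0)%:E).
      by apply: eq_integral => t _; rewrite funeposE -EFin_max maxr_pMr ?mulr0 // ltW.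
    rewrite (@ge0_integral_affine (fun t => Num.max (g t) 0)%R _ _ cp) //.
      by apply: eq_integral => t _; rewrite funeposE -EFin_max.
    by move=> t; exact: max0_ge0.
  transitivity (\int[mu]_t (s' * Num.max (- g (c + s' * t)) 0)%:E).
    by apply: eq_integral => t _; rewrite funenegE -EFinN -EFin_max maxr_pMr ?mulr0 ?mulrN // ltW.
  rewrite (@ge0_integral_affine (fun t => Num.max (- g t) 0)%R _ _ cn) //.
    by apply: eq_integral => t _; rewrite funenegE -EFinN -EFin_max.
  by move=> t; exact: max0_ge0.
have refl (g : R -> R) : continuous g -> (\int[mu]_t g (- t) = \int[mu]_t g t)%R.
  move=> cg; have [cp cn] := continuous_posneg cg.
  rewrite /Rintegral integralE [in RHS]integralE; congr (fine (_ - _)).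
    transitivity (\int[mu]_t (Num.max (g (- t)) 0)%:E).
      by apply: eq_integral => t _; rewrite funeposE -EFin_max.
    rewrite (ge0_integral_reflect cp); last by move=> t; exact: max0_ge0.
    by apply: eq_integral => t _; rewrite funeposE -EFin_max.
  transitivity (\int[mu]_t (Num.max (- g (- t)) 0)%:E).
    by apply: eq_integral => t _; rewrite funenegE -EFinN -EFin_max.
  rewrite (ge0_integral_reflect cn); last by move=> t; exact: max0_ge0.
  by apply: eq_integral => t _; rewrite funenegE -EFinN -EFin_max.
rewrite neq_lt => /orP[s0|s0]; last by rewrite gtr0_norm // key.
rewrite ltr0_norm // -[RHS](@key (- s)%R) ?oppr_gt0 //.
rewrite -[RHS]refl; first by apply: eq_Rintegral => t _; rewrite mulrNN.
apply: continuous_scaled => t; apply: continuous_comp; last exact: cf.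
by apply: cvgD; [exact: cvg_cst|apply: continuous_scaled => u; exact: cvg_id].
Qed.

End LineIntegral.

(** * Integration over R^n by induction on the dimension *)

Section IteratedIntegral.
Context {R : realType}.
Local Notation mu := (@lebesgue_measure R).

(** A product majorant: fixing the first coordinate leaves a scalar multiple of the weight in one
    dimension less ([weight_row]), as the recursion of [rint] requires. *)
Definition weight n (y : 'rV[R]_n) : R := \prod_i (1 + y 0 i ^+ 2)^-1.

Definition integrand n (A : R) (f : 'rV[R]_n -> R) : Prop :=
  (forall y, {for y, continuous f}) /\ forall y, `|f y| <= A * weight y.

Definition slice n (f : 'rV[R]_n.+1 -> R) (t : R) : 'rV[R]_n -> R :=
  fun y => f (row_mx (const_mx t : 'rV[R]_1) y).

Lemma weight_gt0 n (y : 'rV[R]_n) : 0 < weight y.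
Proof. by apply: prodr_gt0 => i _; rewrite invr_gt0 oneDsqr_pos. Qed.

Lemma weight_row n (t : R) (y : 'rV[R]_n) :
  weight (row_mx (const_mx t : 'rV[R]_1) y) = (1 + t ^+ 2)^-1 * weight y.
Proof.
rewrite /weight (@big_split_ord _ _ _ 1 n) /= big_ord1.
by rewrite row_mxEl mxE; congr (_ * _); apply: eq_bigr => i _; rewrite row_mxEr.
Qed.

Lemma mx_norm_le n (v : 'rV[R]_n) (e : R) : 0 <= e -> (forall i, `|v 0 i| <= e) ->
  `|v| <= e.
Proof.
move=> e0 H; rewrite [`|v|]mx_normrE; apply: bigmax_le => // -[i j] _ /=.
by rewrite (ord1 i).
Qed.

Lemma row_mx_lipschitz n (t s : R) (y z : 'rV[R]_n) :
  `|row_mx (const_mx t : 'rV[R]_1) y - row_mx (const_mx s) z| <= `|t - s| + `|y - z|.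
Proof.
apply: mx_norm_le => [|i]; first by rewrite addr_ge0.
rewrite opp_row_mx add_row_mx; case: (split_ordP i) => j ->.
  by rewrite row_mxEl !mxE lerDl.
by rewrite row_mxEr; apply: le_trans (coord_le_norm _ _) _; rewrite lerDr.
Qed.

Lemma slice_cvg n (f : 'rV[R]_n.+1 -> R) (u : nat -> R) (t : R) y :
  (forall z, {for z, continuous f}) -> u k @[k --> \oo] --> t ->
  slice f (u k) y @[k --> \oo] --> slice f t y.
Proof.
move=> cf ut.
have c : {for t, continuous (fun s : R => row_mx (const_mx s : 'rV[R]_1) y : 'rV[R]_(1 + n))}.
  apply: (@lipschitz_continuous_at R _ _ _ _ 1) => s; rewrite mul1r.
  by apply: le_trans (row_mx_lipschitz _ _ _ _) _; rewrite subrr normr0 addr0.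
have c2 : {for t, continuous (fun s : R => slice f s y)}.
  by apply: (@continuous_comp _ _ _ (fun s : R => row_mx (const_mx s : 'rV[R]_1) y : 'rV[R]_(1 + n)) f).
exact: (@cvg_comp _ _ _ u (fun s => slice f s y) _ _ _ ut c2).
Qed.

Lemma slice_integrand n A (f : 'rV[R]_n.+1 -> R) t : integrand A f ->
  integrand (A * (1 + t ^+ 2)^-1) (slice f t).
Proof.
move=> [cf fA]; split=> [y|y]; last by rewrite -mulrA -weight_row; exact: fA.
have c : {for y, continuous (fun z => row_mx (const_mx t : 'rV[R]_1) z : 'rV[R]_(1 + n))}.
  apply: (@lipschitz_continuous_at R _ _ _ _ 1) => s; rewrite mul1r.
  by apply: le_trans (row_mx_lipschitz _ _ _ _) _; rewrite subrr normr0 add0r.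
by apply: (@continuous_comp _ _ _ (fun z => row_mx (const_mx t : 'rV[R]_1) z : 'rV[R]_(1 + n)) f).
Qed.

Lemma integrand_ge0 n A (f : 'rV[R]_n -> R) : integrand A f -> 0 <= A.
Proof.
move=> [_ /(_ 0)] /(le_trans (normr_ge0 _)); rewrite pmulr_lge0 //.
exact: weight_gt0.
Qed.

Definition rint_bounded n := forall A (f : 'rV[R]_n -> R), integrand A f ->
  `|rint f| <= A * line_const ^+ n.

Definition rint_dct n := forall A (f_ : nat -> 'rV[R]_n -> R) (f : 'rV[R]_n -> R),
  (forall k, integrand A (f_ k)) -> integrand A f ->
  (forall y, f_ k y @[k --> \oo] --> f y) ->
  rint (f_ k) @[k --> \oo] --> rint f.

Lemma integrand_le n A B (f : 'rV[R]_n -> R) : A <= B -> integrand A f -> integrand B f.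
Proof.
move=> AB [cf fA]; split => // y; apply: le_trans (fA y) _.
by rewrite ler_wpM2r // ltW // weight_gt0.
Qed.

Lemma decaying_slices_of n A (f : 'rV[R]_n.+1 -> R) : rint_bounded n -> rint_dct n ->
  integrand A f ->
  decaying (A * line_const ^+ n) (fun t => rint (slice f t)).
Proof.
(* Continuity in t is tested on sequences, so that dominated convergence in dimension n applies; the
   factor (1 + t^2)^-1 <= 1 is dropped to obtain a majorant common to all slices. *)
move=> B D If; have A0 := integrand_ge0 If; split.
  move=> t; apply/(@cvg_nbhsP _ R^o) => u ut.
  apply: (D A); last by move=> y; apply: slice_cvg ut; exact: If.1.
    move=> k; apply: integrand_le (slice_integrand (u k) If).
    by rewrite ler_piMr // invf_le1 ?lerDl ?sqr_ge0 // oneDsqr_pos.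
  apply: integrand_le (slice_integrand t If).
  by rewrite ler_piMr // invf_le1 ?lerDl ?sqr_ge0 // oneDsqr_pos.
move=> t; apply: le_trans (B _ _ (slice_integrand t If)) _.
by rewrite mulrAC.
Qed.

(** Both properties go through one induction: the outer integrand t |-> [rint (slice f t)] must be
    continuous, by dominated convergence in dimension n, and decaying, by the bound in dimension
    n. *)
Lemma rint_bounded_dct n : rint_bounded n /\ rint_dct n.
Proof.
elim: n => [|n [B D]].
  split=> [A f [_ fA]|A f_ f _ _ H] /=; last exact: H.
  by rewrite expr0 mulr1; have := fA 0; rewrite /weight big_ord0 mulr1.
split.
  move=> A f If /=; have := le_line_integral (decaying_slices_of B D If).
  by rewrite exprSr mulrA.
move=> A f_ f If_ If H /=.
apply: (@line_integral_dct _ (A * line_const ^+ n)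
   (fun k t => rint (slice (f_ k) t)) (fun t => rint (slice f t))).
- by move=> k; exact: decaying_slices_of.
- exact: decaying_slices_of.
- move=> t; apply: (D _ _ _ (fun k => slice_integrand t (If_ k)) (slice_integrand t If)).
  by move=> y; exact: H.
Qed.

Lemma le_rint n A (f : 'rV[R]_n -> R) : integrand A f -> `|rint f| <= A * line_const ^+ n.
Proof. by have [B _] := rint_bounded_dct n; exact: B. Qed.

Lemma decaying_slices n A (f : 'rV[R]_n.+1 -> R) : integrand A f ->
  decaying (A * line_const ^+ n) (fun t => rint (slice f t)).
Proof. by have [B D] := rint_bounded_dct n; exact: decaying_slices_of. Qed.

Lemma rintD n A B (f g : 'rV[R]_n -> R) : integrand A f -> integrand B g ->
  rint (fun y => f y + g y) = rint f + rint g.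
Proof.
elim: n A B f g => //= n IH A B f g If Ig.
rewrite -(line_integralD (decaying_slices If) (decaying_slices Ig)).
apply: eq_Rintegral => t _.
exact: (IH _ _ _ _ (slice_integrand t If) (slice_integrand t Ig)).
Qed.

Lemma rintZ n A c (f : 'rV[R]_n -> R) : integrand A f ->
  rint (fun y => c * f y) = c * rint f.
Proof.
elim: n A f => //= n IH A f If.
rewrite -(line_integralZ c (decaying_slices If)).
apply: eq_Rintegral => t _.
exact: (IH _ _ (slice_integrand t If)).
Qed.

Lemma eq_rint n (f g : 'rV[R]_n -> R) : f =1 g -> rint f = rint g.
Proof. by move=> /funext ->. Qed.

Lemma integrandZ n A c (f : 'rV[R]_n -> R) : integrand A f ->
  integrand (`|c| * A) (fun y => c * f y).
Proof.
move=> [cf fA]; split=> y; last by rewrite normrM -mulrA ler_wpM2l.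
by apply: continuousM; [exact: cst_continuous|exact: cf].
Qed.

Lemma integrandD n A B (f g : 'rV[R]_n -> R) : integrand A f -> integrand B g ->
  integrand (A + B) (fun y => f y + g y).
Proof.
move=> [cf fA] [cg gA]; split=> y.
  by apply: continuousD; [exact: cf|exact: cg].
by rewrite mulrDl (le_trans (ler_normD _ _)) // lerD.
Qed.

Lemma rintB n A B (f g : 'rV[R]_n -> R) : integrand A f -> integrand B g ->
  rint (fun y => f y - g y) = rint f - rint g.
Proof.
move=> If Ig; rewrite -mulN1r -(rintZ (-1) Ig) -(rintD If (integrandZ (-1) Ig)).
by apply: eq_rint => y; rewrite mulN1r.
Qed.

Lemma rint_sum n (I : Type) (r : seq I) (A : I -> R) (f : I -> 'rV[R]_n -> R) :
  (forall i, integrand (A i) (f i)) ->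
  (exists B, integrand B (fun y => \sum_(i <- r) f i y)) /\
  rint (fun y => \sum_(i <- r) f i y) = \sum_(i <- r) rint (f i).
Proof.
move=> If; elim: r => [|i r [[B IB] IH]].
  have I0 : integrand 0 (fun y : 'rV[R]_n => \sum_(i <- [::]) f i y).
    split=> y; last by rewrite big_nil normr0 mul0r.
    by rewrite (_ : (fun y => _) = cst 0); [exact: cst_continuous|apply/funext => z; rewrite big_nil].
  split; first by exists 0.
  rewrite big_nil (_ : (fun y => _) = (fun y => 0 * (\sum_(i <- [::]) f i y))).
    by rewrite (rintZ 0 I0) mul0r.
  by apply/funext => y; rewrite big_nil mulr0.
have E0 : (fun y => \sum_(j <- i :: r) f j y) = (fun y => f i y + \sum_(j <- r) f j y).
  by apply/funext => y; rewrite big_cons.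
rewrite E0; split; first by exists (A i + B); exact: integrandD.
by rewrite (rintD (If i) IB) big_cons IH.
Qed.

Lemma weight_affine n (c : 'rV[R]_n) (s : R) : s != 0 ->
  exists2 K, 0 < K & forall y, weight (c + s *: y) <= K * weight y.
Proof.
move=> s0.
have H i : exists2 K : R, 0 < K & forall t, (1 + (c 0 i + s * t) ^+ 2)^-1 <= K * (1 + t ^+ 2)^-1.
  (* With a = c_i and r = a + s t, one has t = (r - a) / s and (r - a)^2 <= 2 (1 + a^2) (1 + r^2);
     the final 1 pays for the summand 1 in 1 + t^2. *)
  exists (2 * (1 + c 0 i ^+ 2) / s ^+ 2 + 1).
    by rewrite ltr_pwDr // divr_ge0 ?sqr_ge0 // mulr_ge0 // ltW // oneDsqr_pos.
  move=> t; rewrite ler_pdivlMr ?oneDsqr_pos // mulrC ler_pdivrMr ?oneDsqr_pos //.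
  set r := c 0 i + s * t; have tE : t = (r - c 0 i) / s by rewrite /r addrC addKr mulrC mulKf.
  rewrite {1}tE; set a := c 0 i; set q := (s ^+ 2)^-1.
  have q0 : 0 <= q by rewrite invr_ge0 sqr_ge0.
  rewrite expr_div_n -/q; clear tE; move: r a q q0 => r a q q0.
  have h : (r - a) ^+ 2 <= 2 * (1 + a ^+ 2) * (1 + r ^+ 2).
    rewrite -subr_ge0 (_ : _ - _ = 2 + a ^+ 2 + r ^+ 2 + 2 * (a * r) ^+ 2 + 2 * a * r); last by ring.
    have := sqr_ge0 (a + r); have := sqr_ge0 (a * r); nra.
  have := sqr_ge0 r; nra.
have {H} /choice[K HK] : forall i, exists K : R, 0 < K /\
    forall t, (1 + (c 0 i + s * t) ^+ 2)^-1 <= K * (1 + t ^+ 2)^-1.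
  by move=> i; have [K K0 HK] := H i; exists K.
exists (\prod_i K i); first by apply: prodr_gt0 => i _; have [] := HK i.
move=> y; rewrite /weight -big_split /=; apply: ler_prod => i _.
rewrite !mxE invr_ge0 ltW ?oneDsqr_pos //=.
by have [_] := HK i; apply.
Qed.

Lemma integrand_affine n A (f : 'rV[R]_n -> R) c s : s != 0 -> integrand A f ->
  exists B, integrand B (fun y => f (c + s *: y)).
Proof.
move=> s0 If; have A0 := integrand_ge0 If; have [cf fA] := If.
have [K K0 HK] := weight_affine c s0; exists (A * K); split=> y.
  have ca : {for y, continuous (fun y : 'rV[R]_n => c + s *: y)}.
    apply: (@lipschitz_continuous_at R _ _ _ _ `|s|) => z.
    by rewrite opprD addrACA subrr add0r -scalerBr normrZ.
  by apply: (@continuous_comp _ _ _ (fun y : 'rV[R]_n => c + s *: y : 'rV[R]_n) f).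
by apply: le_trans (fA _) _; rewrite -mulrA ler_wpM2l.
Qed.

Lemma rint_affine n A (f : 'rV[R]_n -> R) c s : s != 0 -> integrand A f ->
  `|s| ^+ n * rint (fun y => f (c + s *: y)) = rint f.
Proof.
move=> s0; elim: n A f c => [|n IH] A f c If.
  rewrite expr0 mul1r /=; congr (f _); apply/rowP => -[] //.
rewrite /= -[RHS](line_integral_affine (c 0 0) (decaying_slices If) s0).
have [B IB] := integrand_affine c s0 If.
rewrite exprSr -(line_integralZ _ (decaying_slices IB)).
apply: eq_Rintegral => t _; rewrite [_ * `|s|]mulrC -mulrA; congr (_ * _).
rewrite -(IH _ _ (rsubmx (c : 'rV[R]_(1 + n))) (slice_integrand (c 0 0 + s * t) If)).
congr (_ * _); apply: eq_rint => y; rewrite /slice; congr f.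
have E1 (M : 'rV[R]_(1 + n)) k : (c + s *: M : 'rV[R]_(1 + n)) 0 k = c 0 k + s * M 0 k.
  by rewrite !mxE.
apply/rowP => i; case: (split_ordP (i : 'I_(1 + n))) => j ->.
  rewrite (E1 (row_mx _ _)) (@row_mxEl R 1 1 n) (@row_mxEl R 1 1 n) !mxE (ord1 j).
  by congr (c _ _ + _); exact/val_inj.
by rewrite (E1 (row_mx _ _)) (@row_mxEr R 1 1 n) (@row_mxEr R 1 1 n) !mxE.
Qed.

End IteratedIntegral.

(** * Convolution and Taylor expansion *)

Section Convolution.
Context {R : realType} {n : nat}.
Local Notation E := 'rV[R]_n.
Implicit Types (f g h q u : E -> R) (x y z v : E) (w : seq 'I_n).

Lemma integrandM A M f u : integrand A f -> (forall y, {for y, continuous u}) ->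
  (forall y, `|u y| <= M) -> integrand (A * M) (fun y => f y * u y).
Proof.
move=> [cf fA] cu uM; split=> y; first by apply: continuousM; [exact: cf|exact: cu].
rewrite normrM mulrAC; apply: ler_pM => //; exact: fA.
Qed.

Lemma tame_continuous u y : tame u -> {for y, continuous u}.
Proof. by move=> [su _]; exact: (su [::] y I).1. Qed.

Lemma tame_bound u : tame u -> exists M, forall y, `|u y| <= M.
Proof. by move=> [_ bu]; have [M HM] := bu 0%N; exists M; exact: (HM [::]). Qed.

Lemma translate_continuous u x y : tame u -> {for y, continuous (fun y => u (x - y))}.
Proof.
move=> tu; have -> : (fun y => u (x - y)) = u \o affine (- 1%:M) x.
  by apply/funext => z; rewrite /affine /= mulmxN mulmx1 addrC.
exact: tame_affine_continuous.
Qed.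

Lemma integrand_compact u (S : set E) : tame u -> compact S ->
  (forall y, ~ S y -> u y = 0) -> exists A, integrand A u.
Proof.
move=> tu cS u0; have [M HM] := tame_bound tu.
have M0 : 0 <= M by exact: le_trans (HM 0).
have [r [_ rS]] := compact_bounded cS.
have r1 : r < `|r| + 1 by rewrite (le_lt_trans (ler_norm _)) // ltrDl.
have Sr y : S y -> `|y| <= `|r| + 1 by move=> Sy; exact: rS r1 _ Sy.
set b := `|r| + 1 in Sr.
have b0 : 0 <= b by rewrite addr_ge0.
(* On S every coordinate is at most b in absolute value, so each of the n factors of the weight is
   at least (1 + b^2)^-1. *)
exists (M * (1 + b ^+ 2) ^+ n); split=> [y|y]; first exact: tame_continuous.
have [Sy|/u0 ->] := pselect (S y); last first.
  by rewrite normr0 mulr_ge0 ?(ltW (weight_gt0 _)) // mulr_ge0 // exprn_ge0 // ltW // oneDsqr_pos.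
apply: le_trans (HM y) _; rewrite -mulrA ler_peMr //.
rewrite /weight -[X in _ ^+ X]card_ord -prodr_const -big_split /=.
apply: (big_ind (fun r => 1 <= r)) => // [c d c1 d1|i _]; first exact: mulr_ege1.
rewrite ler_pdivlMr ?oneDsqr_pos // mul1r lerD2l.
rewrite -[leLHS]real_normK ?num_real // ler_sqr ?nnegrE //.
exact: le_trans (coord_le_norm y i) (Sr y Sy).
Qed.

Lemma integrandB A B f g : integrand A f -> integrand B g ->
  integrand (A + B) (fun y => f y - g y).
Proof.
move=> If [cg gB]; apply: integrandD => //; split=> y; last by rewrite normrN.
by apply: continuousN; exact: cg.
Qed.

Definition conv f g x : R := rint (fun y => f y * g (x - y)).

Lemma conv_integrand A f g x : integrand A f -> tame g ->
  exists B, integrand B (fun y => f y * g (x - y)).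
Proof.
move=> If tg; have [M HM] := tame_bound tg; exists (A * M).
by apply: integrandM => // y; exact: translate_continuous.
Qed.

Lemma norm1_basis i : norm1 (basis_vec i : E) = 1.
Proof.
rewrite /norm1 (bigD1 i) //= !mxE !eqxx normr1 big1 ?addr0 // => j ji.
by rewrite !mxE (negbTE ji) andbF normr0.
Qed.

(** Differentiation under the integral sign with an explicit rate: by [taylor1] the difference
    quotient of g has error at most M |h| everywhere, and integration against f keeps it O(h). *)
Lemma is_derive_conv A f g x i : integrand A f -> tame g ->
  is_derive x (basis_vec i) (conv f g) (conv f (pd i g) x).
Proof.
move=> If tg; have A0 := integrand_ge0 If; have [M HM] := tg.2 2%N.
have tpg : tame (pd i g) by exact: (@tame_pdw _ _ [:: i]).
apply: (@is_derive_bound _ _ _ _ _ _ (A * M * line_const ^+ n)) => h h0.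
have [B1 I1] := conv_integrand (h *: basis_vec i + x) If tg.
have [B2 I2] := conv_integrand x If tg.
have [B3 I3] := conv_integrand x If tpg.
rewrite /conv -(rintB I1 I2) -(rintZ h^-1 (integrandB I1 I2)).
rewrite -(rintB (integrandZ h^-1 (integrandB I1 I2)) I3).
rewrite mulrAC; apply: le_rint; split=> y.
  have [c _] := integrandB (integrandZ h^-1 (integrandB I1 I2)) I3; exact: c.
have -> : h^-1 * (f y * g (h *: basis_vec i + x - y) - f y * g (x - y)) - f y * pd i g (x - y)
   = f y * (h^-1 * (g (x - y + h *: basis_vec i) - g (x - y) - h * pd i g (x - y))).
  rewrite (_ : h *: basis_vec i + x - y = x - y + h *: basis_vec i); last by rewrite -addrA addrC.
  by rewrite !mulrBr mulKf //; ring.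
rewrite normrM (_ : A * M * `|h| * weight y = A * weight y * (M * `|h|)); last by ring.
have [_ fA] := If; apply: ler_pM => //.
rewrite normrM normfV ler_pdivrMl ?normr_gt0 //.
have := taylor1 (x - y) (h *: basis_vec i) tg.1 HM.
rewrite norm1Z norm1_basis mulr1 (bigD1 i) //= big1 ?addr0.
  by move=> T; rewrite !mxE !eqxx mulr1 in T; rewrite mulrCA -expr2.
by move=> j ji; rewrite !mxE (negbTE ji) andbF mulr0 mul0r.
Qed.

Lemma pdw_conv A f g w : integrand A f -> tame g -> pdw w (conv f g) = conv f (pdw w g).
Proof.
move=> If tg; elim: w => //= i w ->; apply/funext => x; apply: derivable_pdP.
exact: is_derive_conv If (tame_pdw w tg).
Qed.

Lemma convC A f g x : integrand A f -> tame g -> conv f g x = conv g f x.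
Proof.
move=> If tg; have [B I0] := conv_integrand x If tg.
rewrite /conv -(rint_affine x (s := -1) _ I0) ?oppr_eq0 ?oner_eq0 //.
rewrite normrN normr1 expr1n mul1r; apply: eq_rint => y.
by rewrite scaleN1r opprB addrCA subrr addr0 mulrC.
Qed.

(* The commutativity of the convolution replaces an integration by parts. *)
Lemma conv_pdw A B f g w x : integrand A f -> integrand B g -> tame f -> tame g ->
  conv f (pdw w g) x = conv g (pdw w f) x.
Proof.
move=> If Ig tf tg; rewrite -(pdw_conv w If tg) -(pdw_conv w Ig tf).
by congr (pdw w _ x); apply/funext => y; exact: convC If tg.
Qed.

End Convolution.

Lemma is_derive_bound_R (R : realType) (f : R -> R) (t d C : R) :
  (forall h : R, h != 0 -> `|h^-1 * (f (h + t) - f t) - d| <= C * `|h|) ->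
  is_derive t (1 : R) f d.
Proof.
move=> H.
have C0 : (fun h : R => h^-1 *: ((f \o shift t) (h *: (1 : R)) - f t)) @ 0^' --> d.
  apply/cvgrPdist_le => e e0; near=> h; rewrite distrC.
  have h0 : h != 0 by near: h; exact: nbhs_dnbhs_neq.
  rewrite /= (_ : h *: (1 : R) = h); last exact: mulr1.
  apply: le_trans (H h h0) _.
  apply: (@le_trans _ _ ((`|C| + 1) * `|h|)).
    by rewrite ler_wpM2r // (le_trans (ler_norm _)) // lerDl.
  rewrite -ler_pdivlMl ?ltr_pwDr //.
  near: h; apply: dnbhs0_le.
  by rewrite mulr_gt0 // invr_gt0 ltr_pwDr.
by split; [apply/cvg_ex; exists d|apply/cvg_lim].
Unshelve. all: by end_near. Qed.

(** * Taylor's formula *)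

Section Taylor.
Context {R : realType} {n : nat}.
Local Notation E := 'rV[R]_n.
Implicit Types (u h : E -> R) (x y v : E) (w : seq 'I_n).

(** The derivative of the remainder of order m.+1 is the remainder of order m of the shifted
    sequence, so the mean value theorem on [0, t] with t <= 1 carries the bound over. The usual
    factor 1/m! is given up. *)
Lemma taylor_line (m : nat) (phi : nat -> R -> R) (B : R) :
  (forall k t, is_derive t (1 : R) (phi k) (phi k.+1 t)) ->
  (forall t, 0 <= t <= 1 -> `|phi m t| <= B) -> forall t, 0 <= t <= 1 ->
  `|phi 0%N t - \sum_(k < m) phi k 0 / k`!%:R * t ^+ k| <= B.
Proof.
elim: m phi => [|m IH] phi D H t t01; first by rewrite big_ord0 subr0 H.
have t0 : 0 <= t by case/andP: t01.
pose P (s : R) := \sum_(k < m.+1) phi k 0 / k`!%:R * s ^+ k.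
pose P' (s : R) := \sum_(k < m) phi k.+1 0 / k`!%:R * s ^+ k.
have DP (s : R) : is_derive s (1 : R) P (P' s).
  have D1 : is_derive s (1 : R) P (\sum_(k < m.+1) phi k 0 / k`!%:R * (s ^+ k.-1 *+ k)).
    rewrite (_ : P = \sum_(k < m.+1) (fun s : R => phi k 0 / k`!%:R * s ^+ k)); last first.
      by apply/funext => r; rewrite fct_sumE.
    apply: is_derive_sum => k.
    have Dk : is_derive s (1 : R) (fun s : R => s ^+ k) (s ^+ k.-1 *+ k).
      by split; [exact: exprn_derivable|rewrite exp_derive /GRing.scale /= mulr1 mulr_natl].
    exact: (is_deriveZ (phi k 0 / k`!%:R) Dk).
  apply: is_derive_eq D1 _; rewrite big_ord_recl /= mulr0n mulr0 add0r.
  apply: eq_bigr => k _; rewrite /bump /= add1n add0n factS natrM -[s ^+ _ *+ _]mulr_natr.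
  have h1 : k.+1%:R != 0 :> R by rewrite pnatr_eq0.
  have h2 : k`!%:R != 0 :> R by rewrite pnatr_eq0 -lt0n fact_gt0.
  by rewrite invfM; move: h1 h2; move: (k.+1%:R : R) (k`!%:R : R) => a1 a2 h1 h2; field; rewrite h1 h2.
pose r s := phi 0%N s - P s.
have Dr (s : R) : is_derive s (1 : R) r (phi 1%N s - P' s) by apply: is_deriveB.
have cr : {within `[0, t], continuous r}.
  by apply: derivable_within_continuous => s _; have [] := Dr s.
have [c c0t Ec] := @MVT_segment _ r _ 0 t t0 (fun s _ => Dr s) cr.
have r0 : r 0 = 0.
  rewrite /r /P big_ord_recl /= fact0 divr1 expr0 mulr1 big1 ?addr0 ?subrr //.
  by move=> k _; rewrite /bump /= add1n expr0n /= mulr0.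
rewrite r0 !subr0 in Ec; rewrite -/(P t) -/(r t) Ec normrM.
have c01 : 0 <= c <= 1.
  move: c0t; rewrite in_itv /= => /andP[-> /le_trans]; apply.
  by case/andP: t01.
have := IH (fun k => phi k.+1) (fun k => D k.+1) H c c01; rewrite -/(P' c) => /= Hc.
apply: le_trans Hc; rewrite [`|t|]ger0_norm // ler_piMr //.
by case/andP: t01.
Qed.

Fixpoint words (k : nat) : seq (seq 'I_n) :=
  if k is k'.+1 then [seq i :: w | i <- enum 'I_n, w <- words k'] else [:: [::]].

Lemma mem_words k w : w \in words k -> size w = k.
Proof.
elim: k w => [|k IH] w /=; first by rewrite inE => /eqP ->.
by move=> /allpairsP[[i w'] /= [_ /IH h ->]] /=; rewrite h.
Qed.

Definition wpow v w : R := \prod_(i <- w) v 0 i.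

Lemma sum_words k v : \sum_(w <- words k) `|wpow v w| = norm1 v ^+ k.
Proof.
elim: k => [|k IH] /=; first by rewrite big_seq1 /wpow big_nil normr1 expr0.
rewrite big_allpairs_dep /= exprS -IH /norm1 mulr_suml big_enum /=.
apply: eq_bigr => i _; rewrite mulr_sumr; apply: eq_bigr => w _.
by rewrite /wpow big_cons normrM.
Qed.

Lemma is_derive_dir u x v t : tame u ->
  is_derive t (1 : R) (fun t : R => u (x + t *: v)) (\sum_i v 0 i * pd i u (x + t *: v)).
Proof.
move=> [su bu]; have [M HM] := bu 2%N.
apply: (@is_derive_bound_R _ _ _ _ (M * norm1 v ^+ 2)) => s s0.
rewrite (_ : x + (s + t) *: v = x + t *: v + s *: v); last by rewrite scalerDl addrCA addrC.
have := taylor1 (x + t *: v) (s *: v) su HM.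
have -> : \sum_i (s *: v) 0 i * pd i u (x + t *: v) = s * \sum_i v 0 i * pd i u (x + t *: v).
  by rewrite mulr_sumr; apply: eq_bigr => j _; rewrite !mxE mulrA.
set D := u _ - u _; set S := \sum_j _; rewrite norm1Z exprMn.
rewrite -[D in D - _](mulVKf s0) -mulrBr normrM.
rewrite expr2 mulrCA -!mulrA ler_pM2l ?normr_gt0 // => /le_trans; apply.
rewrite (_ : `|s| * _ = M * (norm1 v * (norm1 v * `|s|))) ?lexx //.
by rewrite expr2; ring.
Qed.

(** Ordered words count each multi-index with its multinomial multiplicity, hence 1/k! in place of
    1/alpha!. *)
Definition taylor_poly (m : nat) h x v : R :=
  \sum_(k < m) k`!%:R^-1 * \sum_(w <- words k) wpow v w * pdw w h x.

Lemma taylor_tame m M h x v : tame h -> bnd m M h ->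
  `|h (x + v) - taylor_poly m h x v| <= norm1 v ^+ m * M.
Proof.
move=> th bh.
pose phi k (t : R) := \sum_(w <- words k) wpow v w * pdw w h (x + t *: v).
have D k t : is_derive t (1 : R) (phi k) (phi k.+1 t).
  rewrite /phi /= big_allpairs_dep /= exchange_big /=.
  rewrite (_ : (fun t => _) = (fun t => \sum_(w <- words k) wpow v w * pdw w h (x + t *: v))) //.
  have D1 w : is_derive t (1 : R) (fun t : R => wpow v w * pdw w h (x + t *: v))
     (wpow v w * \sum_i v 0 i * pd i (pdw w h) (x + t *: v)).
    exact: (is_deriveZ (wpow v w) (is_derive_dir x v t (tame_pdw w th))).
  elim: (words k) => [|w s IH].
    rewrite big_nil (_ : (fun t => _) = cst 0); first exact: is_derive_cst.
    by apply/funext => r; rewrite big_nil.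
  rewrite big_cons (_ : (fun t => _) = (fun t : R => wpow v w * pdw w h (x + t *: v)) +
      (fun t : R => \sum_(w <- s) wpow v w * pdw w h (x + t *: v))); last first.
    by apply/funext => r; rewrite big_cons.
  apply: is_deriveD => //; apply: is_derive_eq (D1 w) _.
  rewrite mulr_sumr big_enum /=; apply: eq_bigr => i _.
  by rewrite /wpow big_cons mulrCA mulrA.
have := @taylor_line m phi (norm1 v ^+ m * M) D _ 1.
have -> : phi 0%N 1 = h (x + v).
  by rewrite /phi /= big_seq1 /wpow big_nil mul1r scale1r.
have -> : \sum_(k < m) phi k 0 / k`!%:R * 1 ^+ k = taylor_poly m h x v.
  apply: eq_bigr => k _; rewrite expr1n mulr1 mulrC; congr (_ * _).
  by apply: eq_bigr => w _; rewrite scale0r addr0.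
apply; last by rewrite ler01 lexx.
move=> t _; rewrite /phi; apply: le_trans (ler_norm_sum _ _ _) _.
rewrite -sum_words mulr_suml big_seq [leRHS]big_seq; apply: ler_sum => w /mem_words wm.
by rewrite normrM ler_wpM2l // bh // wm.
Qed.

(** Serves where the cut-off differs from 1: there the Taylor polynomial itself has to be estimated,
    and its polynomial growth is left to the decay of the mollifier. *)
Lemma taylor_poly_le m M h x v : bnd m M h -> `|taylor_poly m h x v| <= m%:R * M * (1 + norm1 v) ^+ m.
Proof.
move=> bh; have M0 := bnd_ge0 bh.
apply: le_trans (ler_norm_sum _ _ _) _.
rewrite -[m in m%:R]card_ord -sum1_card natr_sum !mulr_suml; apply: ler_sum => k _.
rewrite mul1r normrM.
have f1 : `|k`!%:R^-1| <= 1 :> R.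
  by rewrite ger0_norm ?invr_ge0 // invf_le1 ?ltr0n ?fact_gt0 // ler1n fact_gt0.
apply: (@le_trans _ _ (1 * (M * norm1 v ^+ k))).
  apply: ler_pM => //; apply: le_trans (ler_norm_sum _ _ _) _.
  rewrite -sum_words mulr_sumr big_seq [leRHS]big_seq; apply: ler_sum => w /mem_words wk.
  by rewrite normrM mulrC ler_wpM2r // bh // wk ltnW.
rewrite mul1r ler_wpM2l //.
apply: (@le_trans _ _ ((1 + norm1 v) ^+ k)).
  by rewrite lerXn2r ?nnegrE ?addr_ge0 ?norm1_ge0 // lerDr.
by rewrite ler_weXn2l ?lerDl ?norm1_ge0 // ltnW.
Qed.

End Taylor.

(** * Rapidly decreasing functions and vanishing moments *)

Section RapidDecay.
Context {R : realType} {n : nat}.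
Local Notation E := 'rV[R]_n.
Implicit Types (q h chi : E -> R) (x y v : E) (w : seq 'I_n) (a b : {ffun 'I_n -> nat}).

Definition rapid q : Prop := (forall y, {for y, continuous q}) /\
  forall a, exists M, forall y, `|monomial a y * q y| <= M.

Lemma monomialS a b i y : (forall j, b j = ((i == j) + a j)%N) ->
  monomial b y = y 0 i * monomial a y.
Proof.
move=> H; rewrite /monomial (bigD1 i) //= [in RHS](bigD1 i) //= H eqxx add1n exprS -mulrA.
by congr (_ * (_ * _)); apply: eq_bigr => j ji; rewrite H eq_sym (negbTE ji).
Qed.

Lemma wpow_monomial w y : wpow y w = monomial (mi_count w) y.
Proof.
rewrite /wpow; elim: w => [|i w IH].
  by rewrite big_nil /monomial big1 // => i _; rewrite ffunE expr0.
rewrite big_cons IH -(@monomialS _ (mi_count (i :: w)) i) // => j.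
by rewrite !ffunE.
Qed.

Lemma coord_continuous y i : {for y, continuous (fun y : E => y 0 i)}.
Proof.
apply: (@lipschitz_continuous_at R _ _ _ _ 1) => z; rewrite mul1r.
by have := coord_le_norm (z - y) i; rewrite !mxE.
Qed.

Lemma rapid_coord i q : rapid q -> rapid (fun y => y 0 i * q y).
Proof.
move=> [cq dq]; split=> [y|a].
  by apply: continuousM; [exact: coord_continuous|exact: cq].
have [M HM] := dq [ffun j => ((i == j) + a j)%N]; exists M => y.
by have := HM y; rewrite (@monomialS a _ i) => [|j]; rewrite ?ffunE // -mulrA mulrCA.
Qed.

Lemma rapid_wpow w q : rapid q -> rapid (fun y => wpow y w * q y).
Proof.
move=> rq; elim: w => [|i w IH].
  rewrite (_ : (fun y => _) = q) //; apply/funext => y; by rewrite /wpow big_nil mul1r.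
rewrite (_ : (fun y => _) = (fun y => y 0 i * (wpow y w * q y))); first exact: rapid_coord.
by apply/funext => y; rewrite /wpow big_cons mulrA.
Qed.

Lemma rapid_weight q : rapid q -> exists A, forall y, `|q y| <= A * weight y.
Proof.
(* The factors 1 + y_i^2 are multiplied in one at a time, by the induction hypothesis for the
   function and for its product with y_i^2. *)
have key (s : seq 'I_n) : forall q, rapid q ->
    exists A, forall y, `|q y| * \prod_(i <- s) (1 + y 0 i ^+ 2) <= A.
  elim: s => [|i s IH] r rr.
    have [M HM] := rr.2 [ffun=> 0%N]; exists M => y; have := HM y.
    by rewrite big_nil mulr1 /monomial big1 ?mul1r // => i _; rewrite ffunE expr0.
  have [A1 H1] := IH r rr.
  have [A2 H2] := IH _ (rapid_coord i (rapid_coord i rr)).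
  exists (A1 + A2) => y; rewrite big_cons mulrA mulrDr mulr1 mulrDl.
  apply: lerD; first exact: H1.
  apply: le_trans (H2 y); rewrite !normrM -[y 0 i ^+ 2]ger0_norm ?sqr_ge0 //.
  by rewrite normrX expr2 [`|r y| * _]mulrC !mulrA.
move=> rq; have [A HA] := key (enum 'I_n) q rq; exists A => y.
have := HA y; rewrite big_enum /= /weight -ler_pdivlMr; last first.
  by apply: prodr_gt0 => i _; exact: oneDsqr_pos.
by rewrite prodfV.
Qed.

Lemma rapid_norm1 p q : rapid q ->
  exists2 A, 0 <= A & forall y, `|q y| * (1 + norm1 y) ^+ p <= A * weight y.
Proof.
elim: p q => [|p IH] q rq.
  have [A HA] := rapid_weight rq; exists `|A| => // y; rewrite expr0 mulr1.
  by apply: le_trans (HA y) _; rewrite ler_wpM2r ?ler_norm // ltW // weight_gt0.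
have [A0 A00 H0] := IH q rq.
have /choice[A HA] : forall i, exists A, 0 <= A /\
    forall y, `|y 0 i * q y| * (1 + norm1 y) ^+ p <= A * weight y.
  by move=> i; have [A A1 HA] := IH _ (rapid_coord i rq); exists A.
exists (A0 + \sum_i A i).
  by rewrite addr_ge0 // sumr_ge0 // => i _; have [] := HA i.
move=> y; rewrite exprS mulrA mulrDr mulr1 mulrDl mulrDl lerD //.
rewrite {1}/norm1 mulr_sumr !mulr_suml; apply: ler_sum => i _.
by have [_ /(_ y)] := HA i; rewrite normrM [`|q y| * _]mulrC.
Qed.

Lemma rapid_integrand q : rapid q -> exists A, integrand A q.
Proof. by move=> rq; have [A HA] := rapid_weight rq; exists A; split=> //; exact: rq.1. Qed.

Lemma enorm_norm1 y : enorm y <= norm1 y.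
Proof.
rewrite /enorm -[leRHS]ger0_norm ?norm1_ge0 // -sqrtr_sqr ler_sqrt ?sqr_ge0 //.
rewrite [leRHS]expr2 {1}/norm1 mulr_suml; apply: ler_sum => i _.
rewrite -[leLHS]real_normK ?num_real // expr2 ler_wpM2l //.
by rewrite /norm1 (bigD1 i) //= lerDl sumr_ge0.
Qed.

Lemma wpowZ (s : R) y w : wpow (s *: y) w = s ^+ size w * wpow y w.
Proof.
rewrite /wpow; elim: w => [|i w IH]; first by rewrite !big_nil expr0 mulr1.
by rewrite !big_cons IH mxE exprS; ring.
Qed.

(* Only the constant term of the Taylor polynomial survives integration
   against q, whose moments vanish. *)
Lemma rint_taylor q (m0 s : R) m h x : rapid q -> rint q = m0 ->
  (forall a, (0 < mi_deg a)%N -> rint (fun y => monomial a y * q y) = 0) ->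
  (exists B, integrand B (fun y => q y * taylor_poly m.+1 h x (s *: y))) /\
  rint (fun y => q y * taylor_poly m.+1 h x (s *: y)) = m0 * h x.
Proof.
move=> rq q0 qm.
have /choice[A HA] : forall w, exists A, integrand A (fun y => wpow y w * q y).
  by move=> w; apply: rapid_integrand; exact: rapid_wpow.
have Iw w : rint (fun y => wpow y w * q y) = if w is [::] then m0 else 0.
  case: w => [|i w].
    by rewrite -q0; apply: eq_rint => y; rewrite /wpow big_nil mul1r.
  rewrite -(qm (mi_count (i :: w))) ?mi_deg_count //.
  by apply: eq_rint => y; rewrite wpow_monomial.
pose c (k : nat) w := k`!%:R^-1 * (s ^+ size w * pdw w h x).
have E0 : (fun y => q y * taylor_poly m.+1 h x (s *: y)) =
    (fun y => \sum_(k <- index_enum 'I_m.+1) \sum_(w <- words k) c k w * (wpow y w * q y)).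
  apply/funext => y; rewrite /taylor_poly mulr_sumr; apply: eq_bigr => k _.
  rewrite mulrCA !mulr_sumr; apply: eq_bigr => w _; rewrite wpowZ /c; ring.
have /choice[B HB] : forall k : 'I_m.+1, exists B,
    integrand B (fun y => \sum_(w <- words k) c k w * (wpow y w * q y)).
  by move=> k; have [] := rint_sum (words k) (fun w => integrandZ (c k w) (HA w)).
have [EB E1] := rint_sum (index_enum 'I_m.+1) HB.
rewrite E0; split => //; rewrite E1 big_ord_recl /= big1 ?addr0.
  rewrite (_ : (fun y => _) = (fun y => c 0%N [::] * (wpow y [::] * q y))); last first.
    by apply/funext => y; rewrite big_seq1.
  by rewrite (rintZ _ (HA [::])) Iw /c fact0 invr1 expr0 !mul1r mulrC.
move=> k _; have [_ ->] := rint_sum (words (bump 0 k)) (fun w => integrandZ (c (bump 0 k) w) (HA w)).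
rewrite big_seq big1 // => w /mem_words; rewrite (rintZ _ (HA w)) Iw.
by case: w => //= i w _; rewrite mulr0.
Qed.

(** m0 is 1 for the real part of rho and 0 for its imaginary part; L stands for |ln e| and enters
    through the bound on (L e)^2. With X the cut-off and P the Taylor polynomial, X h - P = X (h -
    P) + (X - 1) P: the Taylor remainder makes the first term of order e^(m+1), the estimate of X -
    1 the second, and the decay of q absorbs the growth in y. *)
Lemma mollifier_estimate q chi (m0 : R) m : rapid q -> rint q = m0 ->
  (forall a, (0 < mi_deg a)%N -> rint (fun y => monomial a y * q y) = 0) ->
  (forall y, {for y, continuous chi}) -> (forall y, 0 <= chi y <= 1) ->
  (forall y, enorm y < 1 -> chi y = 1) ->
  exists2 C, 0 <= C & forall (e L : R) h M x, 0 < e <= 1 -> 0 <= L -> (L * e) ^+ 2 <= 4 * e ->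
    tame h -> bnd m.+1 M h ->
    `|rint (fun y => q y * (chi (L *: (e *: y)) * h (x - e *: y))) - m0 * h x|
      <= C * (M * e ^+ m.+1).
Proof.
move=> rq q0 qm cchi chi01 chi1.
(* The worst growth is that of (X - 1) P: the cut-off contributes the exponent 2(m+1) and the Taylor
   polynomial m+1. *)
have [A A0 HA] := rapid_norm1 (m.+1.*2 + m.+1) rq.
pose C1 : R := A + 4 ^+ m.+1 * m.+1%:R * A.
have C10 : 0 <= C1 by rewrite addr_ge0 // mulr_ge0 // mulr_ge0 // exprn_ge0.
exists (C1 * line_const ^+ n).
  by rewrite mulr_ge0 // exprn_ge0 // line_const_ge0.
move=> e L h M x /andP[e0 e1] L0 Le th bh; have M0 := bnd_ge0 bh.
have [[B IB] Eq] := rint_taylor (- e) m h x rq q0 qm.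
have cX y : {for y, continuous (fun y => chi (L *: (e *: y)) * h (x - e *: y))}.
  apply: continuousM.
    have cZ : {for y, continuous (fun y : E => L *: (e *: y) : E)}.
      apply: (@lipschitz_continuous_at R _ _ _ _ (`|L| * `|e|)) => z.
      by rewrite -!scalerBr !normrZ mulrA.
    exact: (@continuous_comp _ _ _ (fun y : E => L *: (e *: y) : E) chi).
  have cZ : {for y, continuous (fun y : E => x - e *: y : E)}.
    apply: (@lipschitz_continuous_at R _ _ _ _ `|e|) => z.
    by rewrite opprB addrC addrA subrK -scalerBr normrZ distrC.
  apply: (@continuous_comp _ _ _ (fun y : E => x - e *: y : E) h) => //.
  exact: tame_continuous.
have [A' IA'] := rapid_integrand rq.
have IX : integrand (A' * M) (fun y => q y * (chi (L *: (e *: y)) * h (x - e *: y))).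
  apply: integrandM => // y; rewrite normrM -[M]mul1r; apply: ler_pM => //.
    by rewrite ger0_norm; have /andP[] := chi01 (L *: (e *: y)).
  exact: (bh [::]).
rewrite -Eq -(rintB IX IB).
rewrite -mulrA [line_const ^+ n * _]mulrC mulrA; apply: le_rint; split=> y.
  by have [c _] := integrandB IX IB; exact: c.
set X := chi _; set P := taylor_poly _ _ _ _.
have [X0 X1] : 0 <= X /\ X <= 1 by have /andP[] := chi01 (L *: (e *: y)).
pose N := norm1 y; have N0 : 0 <= N := norm1_ge0 y.
have vE : norm1 (- e *: y) = e * N by rewrite norm1Z normrN gtr0_norm.
have T1 : `|h (x - e *: y) - P| <= (e * N) ^+ m.+1 * M.
  by rewrite -vE -scaleNr; exact: taylor_tame.
have T2 : `|P| <= m.+1%:R * M * (1 + N) ^+ m.+1.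
  apply: le_trans (taylor_poly_le x _ bh) _; rewrite ler_wpM2l ?mulr_ge0 //.
  by rewrite vE lerXn2r ?nnegrE ?addr_ge0 ?mulr_ge0 ?(ltW e0) // lerD2l ler_piMl.
(* Where chi differs from 1, one has 1 <= L e |y|, whose square is <= 4 e |y|^2. *)
have T3 : `|X - 1| <= (4 * e * N ^+ 2) ^+ m.+1.
  have [lt1|ge1] := ltP (enorm (L *: (e *: y))) 1.
    by rewrite /X chi1 // subrr normr0 exprn_ge0 // mulr_ge0 ?sqr_ge0 // mulr_ge0 // ltW.
  have g1 : 1 <= L * e * N.
    apply: le_trans ge1 _; apply: le_trans (enorm_norm1 _) _.
    by rewrite !norm1Z !ger0_norm ?mulrA // ltW.
  have g2 : 1 <= 4 * e * N ^+ 2.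
    apply: (@le_trans _ _ ((L * e * N) ^+ 2)); first exact: exprn_ege1.
    by rewrite exprMn ler_wpM2r // sqr_ge0.
  apply: (@le_trans _ _ 1); last exact: exprn_ege1.
  by rewrite distrC ger0_norm ?subr_ge0 // lerBlDr lerDl.
have Np : N <= 1 + N by rewrite lerDr.
have N1 : 1 <= 1 + N by rewrite lerDl.
have e0' := ltW e0.
have -> : q y * (X * h (x - e *: y)) - q y * P = q y * (X * (h (x - e *: y) - P) + (X - 1) * P).
  by ring.
rewrite normrM; apply: (@le_trans _ _ (`|q y| * ((e * N) ^+ m.+1 * M
    + (4 * e * N ^+ 2) ^+ m.+1 * (m.+1%:R * M * (1 + N) ^+ m.+1)))).
  rewrite ler_wpM2l //; apply: le_trans (ler_normD _ _) _; apply: lerD.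
    rewrite normrM -[leRHS]mul1r; apply: ler_pM => //.
    by rewrite ger0_norm.
  by rewrite normrM; apply: ler_pM.
have q1 : `|q y| * N ^+ m.+1 <= A * weight y.
  apply: le_trans (HA y); rewrite ler_wpM2l //.
  apply: (@le_trans _ _ ((1 + N) ^+ m.+1)); first by rewrite lerXn2r ?nnegrE ?addr_ge0.
  by rewrite ler_weXn2l // leq_addl.
have q2 : `|q y| * ((N ^+ 2) ^+ m.+1 * (1 + N) ^+ m.+1) <= A * weight y.
  apply: le_trans (HA y); rewrite ler_wpM2l // exprD -exprM mul2n.
  by rewrite ler_wpM2r ?exprn_ge0 ?addr_ge0 // lerXn2r ?nnegrE ?addr_ge0.
have -> : `|q y| * ((e * N) ^+ m.+1 * M + (4 * e * N ^+ 2) ^+ m.+1 * (m.+1%:R * M * (1 + N) ^+ m.+1))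
  = M * e ^+ m.+1 * (`|q y| * N ^+ m.+1 + 4 ^+ m.+1 * m.+1%:R *
     (`|q y| * ((N ^+ 2) ^+ m.+1 * (1 + N) ^+ m.+1))).
  by rewrite !exprMn; ring.
have -> : C1 * (M * e ^+ m.+1) * weight y =
   M * e ^+ m.+1 * (A * weight y + 4 ^+ m.+1 * m.+1%:R * (A * weight y)).
  by rewrite /C1; ring.
rewrite ler_wpM2l ?mulr_ge0 ?exprn_ge0 // lerD // ler_wpM2l // mulr_ge0 // exprn_ge0 //.
Qed.

(** With s = sqrt e, the inequality ln (1/s) <= 1/s - 1 gives |ln e| s = 2 s ln (1/s) <= 2; the
    claim is the square of this times e = s^2. *)
Lemma ln_sqr_le (e : R) : 0 < e <= 1 -> (`|ln e| * e) ^+ 2 <= 4 * e.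
Proof.
move=> /andP[e0 e1].
pose s := Num.sqrt e; have s0 : 0 < s by rewrite sqrtr_gt0.
have s2 : e = s ^+ 2 by rewrite sqr_sqrtr // ltW.
have l1 : `|ln e| * s <= 2.
  rewrite s2 lnXn // normrMn ler0_norm; last first.
    apply: ln_le0; rewrite -(ler_pXn2r (n := 2)) ?nnegrE ?(ltW s0) // expr1n -s2 //.
  rewrite -[- ln s]lnV ?posrE // mulrnAl -[leRHS]mulr1n.
  have := le_ln1Dx (x := s^-1 - 1); rewrite [1 + _]addrC subrK => H.
  have h : ln s^-1 * s <= 1.
    rewrite -ler_pdivlMr // mul1r; apply: le_trans (H _) _.
      by rewrite ltrBrDl subrr invr_gt0.
    by rewrite lerBlDr lerDl.
  by rewrite mulr2n [2]mulr2n mulr1n lerD.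
rewrite exprMn {2}s2 -exprM (_ : (2 * 2 = 2 + 2)%N) // exprD mulrA -exprMn -s2.
rewrite ler_pM2r //; apply: (@le_trans _ _ (2 ^+ 2)); last by rewrite -natrX.
by rewrite lerXn2r ?nnegrE ?mulr_ge0 // ltW.
Qed.

End RapidDecay.

(** * Mollifiers *)

Section Scaling.
Context {R : realType} {n : nat}.
Local Notation E := 'rV[R]_n.
Local Notation C := (Rcomplex R).
Implicit Types (u v : E -> R) (f g : E -> C) (x y b : E) (w : seq 'I_n) (s e : R).

Lemma pdw_scale u b s : tame u ->
  tame (fun x => u (b + s *: x)) /\
  forall w x, pdw w (fun x => u (b + s *: x)) x = s ^+ size w * pdw w u (b + s *: x).
Proof.
move=> tu.
have E0 v : (fun x => v (b + s *: x)) = v \o affine s%:M b :> (E -> R).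
  by apply/funext => x; rewrite /affine /= mul_mx_scalar addrC.
have T v : tame v -> tame (fun x => v (b + s *: x)).
  by move=> tv; rewrite E0; exact: tame_affine.
split; first exact: T.
have [|||_ E1] := @smoothI _ _ setT (fun x => u (b + s *: x))
  (fun w x => s ^+ size w * pdw w u (b + s *: x)) openT.
- by move=> x _; rewrite /= expr0 mul1r.
- move=> w x _; apply: continuousM; first exact: cst_continuous.
  by apply: tame_continuous; apply: T; exact: tame_pdw.
- move=> w i x _; have D := is_derive_affine s%:M b x i (tame_pdw w tu).
  rewrite -E0 in D; have D' := is_deriveZ (s ^+ size w) D.
  apply: is_derive_eq D' _; rewrite /GRing.scale /= (bigD1 i) //= big1 ?addr0.
    by rewrite !mxE eqxx mulr1n /affine mul_mx_scalar exprSr mulrA [_ + b]addrC.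
  by move=> j ji; rewrite !mxE eq_sym (negbTE ji) mul0r.
- by move=> w x; exact: E1.
Qed.

Lemma bnd_scale u b s (S : R) k M : tame u -> `|s| <= S -> 1 <= S -> bnd k M u ->
  bnd k (S ^+ k * M) (fun x => u (b + s *: x)).
Proof.
move=> tu sS S1 bu w wk x; have [_ ->] := pdw_scale b s tu.
rewrite normrM; apply: ler_pM => //; last exact: bu.
rewrite normrX; apply: (@le_trans _ _ (S ^+ size w)); last exact: ler_weXn2l.
by rewrite lerXn2r ?nnegrE // (le_trans _ sS).
Qed.

Lemma bndM k M N u v : tame u -> tame v -> bnd k M u -> bnd k N v ->
  bnd k (2 ^+ k * (M * N)) (u * v).
Proof.
move=> tu tv /bnd_bndon bu /bnd_bndon bv; apply/bnd_bndon.
exact: (bndonM openT _ tu.1 tv.1).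
Qed.

Lemma bndZ k M c u : tame u -> bnd k M u -> bnd k (`|c| * M) (fun x => c * u x).
Proof.
move=> tu bu w wk x; have [_ ->] := smoothZ c openT tu.1 => //.
by rewrite normrM ler_wpM2l // bu.
Qed.

Lemma bndD k M N u v : tame u -> tame v -> bnd k M u -> bnd k N v -> bnd k (M + N) (u + v).
Proof.
move=> tu tv bu bv w wk x; have [_ ->] := smoothD openT tu.1 tv.1 => //.
by rewrite (le_trans (ler_normD _ _)) // lerD ?bu ?bv.
Qed.

Lemma bndB k M N u v : tame u -> tame v -> bnd k M u -> bnd k N v -> bnd k (M + N) (u - v).
Proof.
move=> tu tv bu bv w wk x; have [_ ->] := smoothB openT tu.1 tv.1 => //.
by rewrite (le_trans (ler_normB _ _)) // lerD ?bu ?bv.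
Qed.

Lemma tame_bnd2 u v k : tame u -> tame v ->
  exists M, 0 <= M /\ bnd k M u /\ bnd k M v.
Proof.
move=> tu tv; have [M HM] := tu.2 k; have [N HN] := tv.2 k.
exists (M + N); have M0 := bnd_ge0 HM; have N0 := bnd_ge0 HN.
split; first exact: addr_ge0.
by split; [apply: bnd_le HM|apply: bnd_le HN]; rewrite ?lerDl ?lerDr.
Qed.

Section Theta.
Variables (rho chi : E -> C).
Hypotheses (trho : ctame rho) (tchi : ctame chi).

Lemma theta_parts e :
  rpart (theta rho chi e) =
    (fun y => e ^- n * ((fun y => rpart rho (0 + e^-1 *: y)) * (fun y => rpart chi (0 + `|ln e| *: y))
      - (fun y => ipart rho (0 + e^-1 *: y)) * (fun y => ipart chi (0 + `|ln e| *: y))) y) /\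
  ipart (theta rho chi e) =
    (fun y => e ^- n * ((fun y => rpart rho (0 + e^-1 *: y)) * (fun y => ipart chi (0 + `|ln e| *: y))
      + (fun y => ipart rho (0 + e^-1 *: y)) * (fun y => rpart chi (0 + `|ln e| *: y))) y).
Proof.
by split; apply/funext => y; rewrite /rpart /ipart /theta !fctE /= !add0r;
  case: (rho _) (chi _) => a b [c d] /=; ring.
Qed.

Lemma ctame_theta e : ctame (theta rho chi e).
Proof.
have [tr ti] := trho; have [cr ci] := tchi; have [Er Ei] := theta_parts e.
have S u s : tame u -> tame (fun y : E => u (0 + s *: y)) by move=> tu; have [] := pdw_scale 0 s tu.
split; rewrite ?Er ?Ei; apply: tameZ; [apply: tameB|apply: tameD]; apply: tameM; exact: S.
Qed.

Lemma abs_ln_le e : 0 < e <= 1 -> `|ln e| <= 2 * e^-1.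
Proof.
move=> e01; have /andP[e0 e1] := e01; rewrite ler_pdivlMr //.
rewrite -(ler_pXn2r (n := 2)) ?nnegrE ?mulr_ge0 // ?(ltW e0) //.
apply: le_trans (ln_sqr_le e01) _; rewrite expr2; nra.
Qed.

(** In the exponent, n comes from the factor e^-n, one k from the scaling of rho by 1/e and the
    other from that of chi by |ln e| <= 2/e. *)
Lemma theta_bnd k : exists2 D, 0 <= D & forall e, 0 < e <= 1 ->
  bnd k (D * e^-1 ^+ (n + (k + k))) (rpart (theta rho chi e)) /\
  bnd k (D * e^-1 ^+ (n + (k + k))) (ipart (theta rho chi e)).
Proof.
have [tr ti] := trho; have [cr ci] := tchi.
have [M [M0 [br bi]]] := tame_bnd2 k tr ti.
have [N [N0 [dr di]]] := tame_bnd2 k cr ci.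
(* 2 for the two products in each part, 2^k for Leibniz's formula, 2^(k+k) for the two scalings by
   at most 2/e. *)
pose D : R := 2 * (2 ^+ k * (2 ^+ (k + k) * (M * N))).
exists D; first by rewrite !mulr_ge0 ?exprn_ge0.
move=> e e01; have [Er Ei] := theta_parts e; have /andP[e0 e1] := e01.
have ie : 1 <= e^-1 by rewrite invf_ge1.
have S1 : 1 <= 2 * e^-1 by rewrite mulr_ege1 // ler1n.
have s1 : `|e^-1| <= 2 * e^-1.
  by rewrite ger0_norm ?invr_ge0 ?(ltW e0) // ler_peMl ?ler1n // invr_ge0 ltW.
have s2 : `| (`|ln e|) | <= 2 * e^-1 by rewrite normr_id; exact: abs_ln_le.
have S u s : tame u -> tame (fun y : E => u (0 + s *: y)) by move=> tu; have [] := pdw_scale 0 s tu.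
have DE : D * e^-1 ^+ (n + (k + k)) = `|e ^- n| * (2 ^+ k * (((2 * e^-1) ^+ k * M) * ((2 * e^-1) ^+ k * N))
   + 2 ^+ k * (((2 * e^-1) ^+ k * M) * ((2 * e^-1) ^+ k * N))).
  rewrite ger0_norm ?invr_ge0 ?exprn_ge0 ?(ltW e0) // -exprVn /D !exprD !exprMn; ring.
have B u s K : tame u -> `|s| <= 2 * e^-1 -> bnd k K u ->
    bnd k ((2 * e^-1) ^+ k * K) (fun y : E => u (0 + s *: y)).
  by move=> tu sS bu; exact: bnd_scale.
rewrite DE Er Ei; split.
  apply: bndZ; first by apply: tameB; apply: tameM; exact: S.
  by apply: bndB; try (by apply: tameM; exact: S); apply: bndM; try exact: S; exact: B.
apply: bndZ; first by apply: tameD; apply: tameM; exact: S.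
by apply: bndD; try (by apply: tameM; exact: S); apply: bndM; try exact: S; exact: B.
Qed.

End Theta.

(* The kernel beta(x) theta_e(x - y) kappa(y), as a function on R^n x R^n. *)
Lemma ctame_kernel f g h s b : ctame f -> ctame g -> ctame h ->
  exists2 Phi : 'rV[R]_(n + n) -> C, ctame Phi &
    forall x y, Phi (row_mx x y) = f (b + s *: x) * (g (x - y) * h y).
Proof.
move=> tf tg th.
pose F := f \o affine (col_mx s%:M 0 : 'M[R]_(n + n, n)) b.
pose G := g \o affine (col_mx 1%:M (- 1%:M) : 'M[R]_(n + n, n)) 0.
pose H := h \o affine (col_mx 0 1%:M : 'M[R]_(n + n, n)) 0.
exists (fun z => F z * (G z * H z)).
  by apply: ctameM; [|apply: ctameM]; exact: ctame_affine.
move=> x y; rewrite /F /G /H /affine /= !mul_row_col !mulmx0 !addr0 add0r.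
by rewrite mul_mx_scalar mulmx1 mulmxN !mulmx1 addrC.
Qed.

End Scaling.

(** * Approximation of derivatives by the mollifier *)

Section Mollifier.
Context {R : realType} {n : nat}.
Local Notation E := 'rV[R]_n.
Local Notation C := (Rcomplex R).
Implicit Types (q h : E -> R) (f : E -> C) (x y z : E) (w : seq 'I_n) (e : R).

Lemma norm_le_enorm y : `|y| <= enorm y.
Proof.
apply: mx_norm_le => [|i]; first exact: sqrtr_ge0.
rewrite /enorm -sqrtr_sqr ler_sqrt; last by apply: sumr_ge0 => j _; exact: sqr_ge0.
by rewrite (bigD1 i) //= lerDl sumr_ge0 // => j _; exact: sqr_ge0.
Qed.

Lemma enormZ (s : R) y : enorm (s *: y) = `|s| * enorm y.
Proof.
rewrite /enorm -sqrtr_sqr -sqrtrM ?sqr_ge0 // mulr_sumr; congr Num.sqrt.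
by apply: eq_bigr => i _; rewrite mxE exprMn.
Qed.

Lemma closed_cball x (r : R) : closed [set y : E | `|y - x| <= r].
Proof.
have -> : [set y : E | `|y - x| <= r] = (fun y => `|y - x|) @^-1` [set s | s <= r] by [].
apply: preimage_closed; last exact: closed_le.
move=> y _; apply: (@lipschitz_continuous_at R _ _ _ _ 1) => z; rewrite mul1r.
apply: le_trans (ler_dist_dist _ _) _.
by rewrite opprB addrA subrK.
Qed.

Lemma compact_cball x (r : R) : compact [set y : E | `|y - x| <= r].
Proof.
apply: bounded_closed_compact; last exact: closed_cball.
exists (r + `|x|); split => [|b rb y /= yr]; first exact: num_real.
apply: le_trans (ltW rb); rewrite -[y](subrK x) (le_trans (ler_normD _ _)) //.
by rewrite lerD2r.
Qed.

(* The terms [0 + _] give the shape to which [pdw_scale] applies. *)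
Definition scaled_cutoff (q X : E -> R) e : E -> R :=
  fun z => e ^- n * (q (0 + e^-1 *: z) * X (0 + `|ln e| *: z)).

Lemma tame_scaled_cutoff q X e : tame q -> tame X -> tame (scaled_cutoff q X e).
Proof.
move=> tq tX; have [t1 _] := pdw_scale 0 e^-1 tq; have [t2 _] := pdw_scale 0 `|ln e| tX.
exact: (tameZ (e ^- n) (tameM t1 t2)).
Qed.

(** At e = 1 the logarithm vanishes and nothing is cut off, hence the strict bound on e. *)
Lemma scaled_cutoff_supp q X e z : (forall y, X y != 0 -> enorm y < 2) -> 0 < e < 1 ->
  2 / `|ln e| <= `|z| -> scaled_cutoff q X e z = 0.
Proof.
move=> HX /andP[e0 e1] ze; rewrite /scaled_cutoff add0r add0r.
have l0 : 0 < `|ln e| by rewrite normr_gt0 lt_eqF // ln_lt0 // e0.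
rewrite [X _](_ : _ = 0) ?mulr0 //; apply/eqP; apply: contraT => /HX.
rewrite enormZ normr_id => H; exfalso; move: ze; apply/negP; rewrite -ltNge.
rewrite ltr_pdivlMr // mulrC; apply: le_lt_trans H.
by rewrite ler_wpM2l ?norm_le_enorm.
Qed.

(** [conv_pdw] moves the derivatives onto h, which costs c of the m.+1 + c orders; the other m.+1
    are for [mollifier_estimate]. Integrability belongs to the conclusion because complex integrals
    are later assembled by [rintB] and [rintD]. *)
Lemma scaled_cutoff_conv q X (m0 : R) c m : rapid q -> tame q -> rint q = m0 ->
  (forall a, (0 < mi_deg a)%N -> rint (fun y => monomial a y * q y) = 0) ->
  tame X -> (forall y, 0 <= X y <= 1) -> (forall y, enorm y < 1 -> X y = 1) ->
  (forall y, X y != 0 -> enorm y < 2) ->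
  exists2 D, 0 <= D & forall e h A M w x, 0 < e < 1 -> tame h -> integrand A h ->
    bnd (m.+1 + c) M h -> (size w <= c)%N ->
    `|rint (fun y => h y * pdw w (scaled_cutoff q X e) (x - y)) - m0 * pdw w h x|
      <= D * (M * e ^+ m.+1) /\
    exists B, integrand B (fun y => h y * pdw w (scaled_cutoff q X e) (x - y)).
Proof.
move=> rq tq q0 qm tX X01 X1 X2.
have [D D0 HD] := mollifier_estimate m rq q0 qm (fun y => @tame_continuous _ _ X y tX) X01 X1.
exists D => // e h A M w x e01 th Ih bh wc; have /andP[e0 e1] := e01.
have e0' : e != 0 by rewrite gt_eqF.
pose T := scaled_cutoff q X e.
have tT : tame T by exact: tame_scaled_cutoff.
have [B IT] : exists B, integrand B T.
  apply: (integrand_compact (S := [set z | `|z - 0| <= 2 / `|ln e|])) => //.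
    exact: compact_cball.
  move=> z /negP; rewrite subr0 -ltNge => /ltW; exact: scaled_cutoff_supp.
split; last by exact: (conv_integrand x Ih (tame_pdw w tT)).
have th' := tame_pdw w th.
have -> : rint (fun y => h y * pdw w T (x - y)) = conv T (pdw w h) x.
  exact: (conv_pdw w x Ih IT th tT).
have [B' IC] := conv_integrand x IT th'.
rewrite /conv -(rint_affine 0 e0' IC) [`|e|]gtr0_norm //.
have [A' Iq] := rapid_integrand rq.
pose G y := q y * (X (`|ln e| *: (e *: y)) * pdw w h (x - e *: y)).
have IG : exists B, integrand B G.
  have [K HK] := tame_bound th'; exists (A' * K).
  apply: integrandM => // y.
    have [t1 _] := pdw_scale 0 (`|ln e| * e) tX.
    have [t2 _] := pdw_scale x (- e) th'.
    have := @tame_continuous _ _ _ y (tameM t1 t2).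
    rewrite (_ : _ * _ = fun y => X (`|ln e| *: (e *: y)) * pdw w h (x - e *: y)) //.
    by apply/funext => z; rewrite !fctE add0r scalerA scaleNr.
  rewrite normrM -[K]mul1r; apply: ler_pM => //.
  by rewrite ger0_norm; have /andP[] := X01 (`|ln e| *: (e *: y)).
have {IG}[B'' IG] := IG.
have -> : rint (fun y => T (0 + e *: y) * pdw w h (x - (0 + e *: y))) = e ^- n * rint G.
  rewrite -(rintZ _ IG); apply: eq_rint => y.
  by rewrite /T /scaled_cutoff /G !add0r scalerA mulVf // scale1r; ring.
(* The Jacobian e^n cancels the normalization e^-n. *)
rewrite mulrA divff ?mul1r ?expf_neq0 //.
apply: HD => //.
- by rewrite e0 ltW.
- by apply: ln_sqr_le; rewrite e0 ltW.
- by apply: bnd_pdw; apply: bnd_le bh => //; rewrite leq_add2l.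
Qed.

Variables (rho chi : E -> C).
Hypotheses (rho_schwartz : schwartz rho) (rho_int : cint rho = 1)
  (rho_moments : forall a : {ffun 'I_n -> nat}, (0 < mi_deg a)%N ->
      cint (fun x => monomial a x *: rho x) = 0)
  (chi_test : lcs_pts (Dtest setT) chi)
  (chi_01 : forall y, 0 <= (chi y : R[i]) <= 1)
  (chi_1 : forall y, enorm y < 1 -> chi y = 1)
  (chi_supp : forall y, supp chi y -> enorm y < 2).

Lemma word0 : word ([ffun=> 0%N] : {ffun 'I_n -> nat}) = [::].
Proof.
apply: size0nil; rewrite size_word /mi_deg big1 // => i _.
by rewrite ffunE.
Qed.

Lemma rapid_rho : rapid (rpart rho) /\ rapid (ipart rho).
Proof.
have [tr ti] := ctame_schwartz rho_schwartz.
have H a : exists M, forall y, `|monomial a y *: rho y| <= M.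
  have [_ /(_ a [ffun=> 0%N])[M HM]] := rho_schwartz; exists M => y.
  rewrite (_ : rho y = pderiv [ffun=> 0%N] rho y) //.
  by apply: Rcomplex_eq; rewrite ?Re_pderiv ?Im_pderiv word0.
split; split=> [y|a]; try exact: tame_continuous.
  have [M HM] := H a; exists M => y; apply: le_trans (HM y).
  by apply: le_trans (normC_Re _); rewrite /rpart; case: (rho y).
have [M HM] := H a; exists M => y; apply: le_trans (HM y).
by apply: le_trans (normC_Im _); rewrite /ipart; case: (rho y).
Qed.

Lemma rho_parts : [/\ rint (rpart rho) = 1, rint (ipart rho) = 0 &
  forall a, (0 < mi_deg a)%N -> rint (fun y => monomial a y * rpart rho y) = 0 /\
    rint (fun y => monomial a y * ipart rho y) = 0].
Proof.
split.
- by have := congr1 (@complex.Re R) rho_int.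
- by have := congr1 (@complex.Im R) rho_int.
- move=> a a0; have H := rho_moments a0; split.
    rewrite -[RHS]/(complex.Re (0 : C)) -H /cint /=; apply: eq_rint => y.
    by rewrite /rpart; case: (rho y).
  rewrite -[RHS]/(complex.Im (0 : C)) -H /cint /=; apply: eq_rint => y.
  by rewrite /ipart; case: (rho y).
Qed.

Lemma chi_parts y : ipart chi y = 0 /\ 0 <= rpart chi y <= 1.
Proof.
rewrite /rpart /ipart; have := chi_01 y; case: (chi y) => c d; rewrite !lecE /=.
by move=> /andP[/andP[/eqP -> ->] /andP[_ ->]].
Qed.

Lemma rpart_chi_supp y : rpart chi y != 0 -> enorm y < 2.
Proof.
move=> H; apply: chi_supp; apply: contrapT => /supp_out c0.
by move: H; rewrite /rpart c0 eqxx.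
Qed.

Lemma theta_real e : rpart (theta rho chi e) = scaled_cutoff (rpart rho) (rpart chi) e /\
  ipart (theta rho chi e) = scaled_cutoff (ipart rho) (rpart chi) e.
Proof.
have [-> ->] := theta_parts rho chi e.
split; apply/funext => y; rewrite !fctE /scaled_cutoff.
  by have [-> _] := chi_parts (0 + `|ln e| *: y); rewrite mulr0 subr0.
by have [-> _] := chi_parts (0 + `|ln e| *: y); rewrite mulr0 add0r.
Qed.

Lemma theta_supp e z : 0 < e < 1 -> 2 / `|ln e| <= `|z| -> theta rho chi e z = 0.
Proof.
move=> e01 ze; have [Er Ei] := theta_real e.
apply: Rcomplex_eq; rewrite -/(rpart (theta rho chi e) z) -/(ipart (theta rho chi e) z).
  by rewrite Er; apply: scaled_cutoff_supp => //; exact: rpart_chi_supp.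
by rewrite Ei; apply: scaled_cutoff_supp => //; exact: rpart_chi_supp.
Qed.

(** Since chi is real, the parts of theta_e come from those of rho, and pairing them with the parts
    of f gives four real estimates. The real part of rho, of mass 1, reproduces the derivatives of
    f; the imaginary part, of mass 0, contributes only to the error. *)
Lemma theta_delta c m : exists2 D, 0 <= D & forall e f (S : set E) M a x, 0 < e < 1 ->
  ctame f -> compact S -> (forall y, ~ S y -> f y = 0) ->
  bnd (m.+1 + c) M (rpart f) -> bnd (m.+1 + c) M (ipart f) -> (mi_deg a <= c)%N ->
  `|cint (fun y => f y * pderiv a (theta rho chi e) (x - y)) - pderiv a f x|
     <= D * (M * e ^+ m.+1).
Proof.
have [tr ti] := ctame_schwartz rho_schwartz; have [rr ri] := rapid_rho.
have [r1 i0 mo] := rho_parts; have [tc _] := ctame_test chi_test.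
have c1 y : enorm y < 1 -> rpart chi y = 1 by move=> /chi_1; rewrite /rpart => ->.
have c01 y : 0 <= rpart chi y <= 1 by have [] := chi_parts y.
have [D1 D10 H1] := scaled_cutoff_conv c m rr tr r1 (fun a a0 => (mo a a0).1) tc c01 c1 rpart_chi_supp.
have [D2 D20 H2] := scaled_cutoff_conv c m ri ti i0 (fun a a0 => (mo a a0).2) tc c01 c1 rpart_chi_supp.
exists (2 * (D1 + D2)); first by rewrite mulr_ge0 // addr_ge0.
move=> e f S M a x e01 [tfr tfi] cS f0 br bi ac.
have [Ar Ir] : exists A, integrand A (rpart f).
  by apply: (integrand_compact (S := S)) => // y /f0; rewrite /rpart => ->.
have [Ai Ii] : exists A, integrand A (ipart f).
  by apply: (integrand_compact (S := S)) => // y /f0; rewrite /ipart => ->.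
have wc : (size (word a) <= c)%N by rewrite size_word.
have [Er Ei] := theta_real e.
set T := theta rho chi e in Er Ei *.
have [h1 [B1 J1]] := H1 e _ _ _ _ x e01 tfr Ir br wc; rewrite -Er mul1r in h1 J1.
have [h2 [B2 J2]] := H2 e _ _ _ _ x e01 tfr Ir br wc; rewrite -Ei mul0r subr0 in h2 J2.
have [h3 [B3 J3]] := H1 e _ _ _ _ x e01 tfi Ii bi wc; rewrite -Er mul1r in h3 J3.
have [h4 [B4 J4]] := H2 e _ _ _ _ x e01 tfi Ii bi wc; rewrite -Ei mul0r subr0 in h4 J4.
have ReE : complex.Re (cint (fun y => f y * pderiv a T (x - y))) =
    rint (fun y => rpart f y * pdw (word a) (rpart T) (x - y)) -
    rint (fun y => ipart f y * pdw (word a) (ipart T) (x - y)).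
  rewrite -(rintB J1 J4) /cint /=; apply: eq_rint => y.
  rewrite -Re_pderiv -Im_pderiv /rpart /ipart; by case: (f y) (pderiv _ _ _) => ? ? [].
have ImE : complex.Im (cint (fun y => f y * pderiv a T (x - y))) =
    rint (fun y => rpart f y * pdw (word a) (ipart T) (x - y)) +
    rint (fun y => ipart f y * pdw (word a) (rpart T) (x - y)).
  rewrite -(rintD J2 J3) /cint /=; apply: eq_rint => y.
  rewrite -Re_pderiv -Im_pderiv /rpart /ipart; by case: (f y) (pderiv _ _ _) => ? ? [].
apply: le_trans (normC_le _) _.
have subRe (z1 z2 : C) : complex.Re (z1 - z2) = complex.Re z1 - complex.Re z2 by case: z1 z2 => ? ? [].
have subIm (z1 z2 : C) : complex.Im (z1 - z2) = complex.Im z1 - complex.Im z2 by case: z1 z2 => ? ? [].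
rewrite subRe subIm ReE ImE Re_pderiv Im_pderiv mulr_natl mulr2n mulrDl mulrDl.
apply: lerD.
  by rewrite addrAC; apply: le_trans (ler_normB _ _) _; exact: lerD.
by rewrite -addrA addrC; apply: le_trans (ler_normD _ _) _; exact: lerD.
Qed.

End Mollifier.

(** * Local and global estimates *)

Section PolynomialBounds.
Variable R : realType.
(* [mpoly] is required without being imported, which leaves this instance inactive. *)
Canonical mpoly.mpoly_multinom__canonical__eqtype_Equality.

Lemma meval_le (r : nat) (lam : mpoly.mpoly r R) : nneg_coeffs lam ->
  exists S D, 0 <= S /\ forall (B : R) v, 1 <= B -> (forall i, 0 <= v i <= B) ->
    mpoly.meval v lam <= S * B ^+ D.
Proof.
(* S is the sum of the coefficients and D the total degree; B >= 1 lets every degree be raised to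
   D. *)
move=> lam0; exists (\sum_(m <- mpoly.msupp lam) mpoly.mcoeff m lam),
  (\max_(m <- mpoly.msupp lam) mpoly.mdeg m)%N; split; first by apply: sumr_ge0.
move=> B v B1 vB; rewrite mpoly.mevalE mulr_suml.
rewrite big_seq [leRHS]big_seq; apply: ler_sum => m mlam.
rewrite ler_wpM2l //; apply: (@le_trans _ _ (B ^+ mpoly.mdeg m)); last first.
  by rewrite ler_weXn2l // leq_bigmax_seq.
rewrite mpoly.mdegE -prodrXr; apply: ler_prod => i _.
have /andP[v0 vb] := vB i.
by rewrite exprn_ge0 //= lerXn2r // nnegrE // (le_trans v0).
Qed.

(** Evaluate at y = 1, z = 0: a vanishing sum of nonnegative terms has only zero terms, so a
    monomial with nonzero coefficient vanishes there, which forces a factor z_j. *)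
Lemma in_I_monomial (k : nat) (lam : mpoly.mpoly (k.+1 + k.+1) R) (m : mpoly.multinom _) : in_I lam ->
  m \in mpoly.msupp lam -> exists j : 'I_k.+1, (0 < mpoly.fun_of_multinom m (rshift _ j))%N.
Proof.
move=> [lam0 H] mlam.
have := H (fun=> 1); rewrite mpoly.mevalE => /eqP.
rewrite psumr_eq0; last first.
  move=> m' _; apply: mulr_ge0 => //; apply: prodr_ge0 => i _; apply: exprn_ge0.
  by rewrite /yz_point; case: fintype.split.
move=> /allP /(_ _ mlam); rewrite mulf_eq0 mpoly.mcoeff_eq0 mlam /= => /prodf_eq0[i _].
rewrite expf_eq0 => /andP[mi]; rewrite /yz_point.
case: split_ordP => j ij; first by rewrite oner_eq0.
by move=> _; exists j; rewrite -ij.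
Qed.

(** One factor z_j of each monomial supplies d, even out of a higher power since d <= 1; all other
    variables are at most B, the z_i because d <= 1 <= B. *)
Lemma meval_in_I_le (k : nat) (lam : mpoly.mpoly (k.+1 + k.+1) R) : in_I lam ->
  exists S D, 0 <= S /\ forall (B d : R) y z, 1 <= B -> d <= 1 ->
    (forall i, 0 <= y i <= B) -> (forall i, 0 <= z i <= d) ->
    mpoly.meval (yz_point y z) lam <= S * (B ^+ D * d).
Proof.
move=> lamI; have [lam0 _] := lamI.
exists (\sum_(m <- mpoly.msupp lam) mpoly.mcoeff m lam),
  (\max_(m <- mpoly.msupp lam) mpoly.mdeg m)%N; split; first by apply: sumr_ge0.
move=> B d y z B1 d1 yB zd; rewrite mpoly.mevalE mulr_suml.
have d0 : 0 <= d by have /andP[] := zd ord0; exact: le_trans.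
have vB i : 0 <= yz_point y z i <= B.
  rewrite /yz_point; case: fintype.split => // j.
  by have /andP[-> /= h] := zd j; apply: le_trans h (le_trans d1 B1).
rewrite big_seq [leRHS]big_seq; apply: ler_sum => m mlam.
rewrite ler_wpM2l //; have [j mj] := in_I_monomial lamI mlam.
apply: (@le_trans _ _ (B ^+ mpoly.mdeg m * d)); last first.
  by rewrite ler_wpM2r // ler_weXn2l // leq_bigmax_seq.
rewrite mpoly.mdegE -prodrXr (bigD1 (rshift _ j)) //= [in leRHS](bigD1 (rshift _ j)) //=.
rewrite mulrAC ler_pM //.
- by apply: exprn_ge0; have /andP[] := vB (rshift _ j).
- by apply: prodr_ge0 => i _; apply: exprn_ge0; have /andP[] := vB i.
- have vj : yz_point y z (rshift k.+1 j) = z j.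
    by rewrite /yz_point -[rshift _ _]/(unsplit (inr j)) unsplitK.
  have /andP[z0 zjd] := zd j; have zj1 := le_trans zjd d1.
  rewrite vj -[leLHS]mul1r; apply: ler_pM => //; first exact: exprn_ge0.
    exact: exprn_ege1.
  by apply: le_trans zjd; rewrite -(prednK mj) exprS ler_piMr // exprn_ile1.
- apply: ler_prod => i _; have /andP[v0 vb] := vB i.
  by rewrite exprn_ge0 //= lerXn2r // nnegrE // (le_trans v0).
Qed.

End PolynomialBounds.

(** * Estimates near a point *)

Section Localization.
Context {R : realType} {n : nat}.
Local Notation E := 'rV[R]_n.
Local Notation C := (Rcomplex R).
Implicit Types (u v : E -> R) (f : E -> C) (x y z : E) (w : seq 'I_n) (e : R)
  (a : {ffun 'I_n -> nat}).

Lemma pdw_reflect u z w y : tame u ->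
  pdw w (fun y => u (z - y)) y = (-1) ^+ size w * pdw w u (z - y).
Proof.
move=> tu; have [_ H] := pdw_scale z (-1) tu.
have -> : (fun y => u (z - y)) = (fun y => u (z + -1 *: y)).
  by apply/funext => y'; rewrite scaleN1r.
by rewrite H scaleN1r.
Qed.

Lemma pdw_translate u y w x : tame u -> pdw w (fun x => u (x - y)) x = pdw w u (x - y).
Proof.
move=> tu; have [_ H] := pdw_scale (- y) 1 tu.
have -> : (fun x => u (x - y)) = (fun x => u (- y + 1 *: x)).
  by apply/funext => x'; rewrite scale1r addrC.
by rewrite H scale1r expr1n mul1r addrC.
Qed.

Lemma pderiv_translate f a y x : ctame f ->
  pderiv a (fun x => f (x - y)) x = pderiv a f (x - y).
Proof.
by move=> [tr ti]; apply: Rcomplex_eq; rewrite ?Re_pderiv ?Im_pderiv;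
  [exact: (pdw_translate _ _ _ tr)|exact: (pdw_translate _ _ _ ti)].
Qed.

Lemma pdw_mixed u a b x y : tame u ->
  pdw (word a) (fun z => pdw (word b) (fun y => u (z - y)) y) x =
  (-1) ^+ size (word b) * pdw (word a ++ word b) u (x - y).
Proof.
move=> tu; rewrite (_ : (fun z => _) = (fun z => (-1) ^+ size (word b) * pdw (word b) u (z - y))).
  have tb := tame_pdw (word b) tu.
  have sm : smooth setT (fun z => pdw (word b) u (z - y)).
    have [[s _] _] := pdw_scale (- y) 1 tb.
    rewrite (_ : (fun z => _) = (fun z => pdw (word b) u (- y + 1 *: z))) //.
    by apply/funext => z; rewrite scale1r addrC.
  have [_ ->] := smoothZ ((-1) ^+ size (word b)) openT sm => //.
  by rewrite pdw_translate // pdw_cat.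
by apply/funext => z; rewrite pdw_reflect.
Qed.

(** Mixed derivatives of a translation kernel are, up to sign, derivatives of f at x - y of order at
    most c + l; the factor 2 comes from the real and imaginary parts. *)
Lemma pderiv_mixed_le f a b x y c l (M : R) : ctame f ->
  bnd (c + l) M (rpart f) -> bnd (c + l) M (ipart f) ->
  (mi_deg a <= c)%N -> (mi_deg b <= l)%N ->
  `|pderiv a (fun z => pderiv b (fun y => f (z - y)) y) x| <= 2 * M.
Proof.
move=> [tr ti] br bi ac bl.
have wl : (size (word a ++ word b) <= c + l)%N by rewrite size_cat !size_word leq_add.
apply: (@pderiv_norm_le _ _ setT).
  rewrite (_ : rpart _ = fun z => pdw (word b) (fun y => rpart f (z - y)) y); last first.
    by apply/funext => z; rewrite /rpart Re_pderiv.
  by rewrite pdw_mixed // normrM normrX normrN1 expr1n mul1r br.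
rewrite (_ : ipart _ = fun z => pdw (word b) (fun y => ipart f (z - y)) y); last first.
  by apply/funext => z; rewrite /ipart Im_pderiv.
by rewrite pdw_mixed // normrM normrX normrN1 expr1n mul1r bi.
Qed.

(** u is smooth on U only, but the product is also zero on the complement of S. These two open sets
    cover the space because S lies in U, and the bounds on u concern S alone. *)
Lemma cutoffM u v (U S : set E) : open U -> compact S -> S `<=` U -> smooth U u -> tame v ->
  (forall y, ~ S y -> v y = 0) ->
  tame (u * v) /\ forall k M N, 0 <= M -> bndon S k M u -> bnd k N v ->
    bnd k (2 ^+ k * (M * N)) (u * v).
Proof.
move=> oU cS SU su tv v0.
have clS : closed S by apply: compact_closed => //; exact: norm_hausdorff.
have uv0 y : ~ S y -> (u * v) y = 0 by move=> /v0 H; rewrite fctE H mulr0.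
have suv : smooth setT (u * v).
  have -> : setT = U `|` ~` S.
    by rewrite eqEsubset; split => // y _; have [/SU|] := pselect (S y); [left|right].
  apply: smoothU; first by apply: smoothM => //; apply: smooth_sub tv.1.
  have oS : open (~` S) by exact: closed_openC.
  apply: (@smooth_open _ _ _ (cst 0)) => //; first by move=> y /uv0.
  by have [] := smooth_cst 0 oS.
split; first by exact: tame_compact cS uv0.
move=> k M N M0 bu bv w wk y; have N0 := bnd_ge0 bv.
have [Sy|Sy] := pselect (S y); last first.
  by rewrite (pdw_supp _ clS uv0 Sy) normr0 mulr_ge0 ?exprn_ge0 ?mulr_ge0.
apply: (@bndonM _ _ U S k M N u v) => //; first by apply: smooth_sub tv.1.
by move=> w' w'k z _; exact: bv.
Qed.

Variables (Omega : set E) (rho chi : E -> C) (kappa : R -> E -> C).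
Hypotheses (Omega_open : open Omega) (rho_schwartz : schwartz rho) (rho_int : cint rho = 1)
  (rho_moments : forall a : {ffun 'I_n -> nat}, (0 < mi_deg a)%N ->
      cint (fun x => monomial a x *: rho x) = 0)
  (chi_test : lcs_pts (Dtest setT) chi)
  (chi_01 : forall y, 0 <= (chi y : R[i]) <= 1)
  (chi_1 : forall y, enorm y < 1 -> chi y = 1)
  (chi_supp : forall y, supp chi y -> enorm y < 2)
  (kappa_test : forall e : R, 0 < e <= 1 -> lcs_pts (Dtest Omega) (kappa e))
  (kappa_1 : forall e : R, 0 < e <= 1 -> forall y, Keps Omega e y -> kappa e y = 1).

Lemma ctame_kappa e : 0 < e <= 1 -> ctame (kappa e).
Proof.
move=> /kappa_test[sk ck _]; apply: (@ctame_compact _ _ (supp (kappa e))) => //.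
by move=> x; exact: supp_out.
Qed.

(** The cut-off beta, made from chi. The argument is expanded to the form b + s x, to which
    [pdw_scale] and [ctame_kernel] apply. *)
Definition bump (x0 : E) (s : R) : E -> C := fun x => chi (- (s *: x0) + s *: x).

Lemma bumpE x0 s x : bump x0 s x = chi (s *: (x - x0)).
Proof. by rewrite /bump scalerBr addrC. Qed.

(* [`|x|] is the maximum norm of a row vector. *)
Definition dimc : R := n%:R + 1.

Lemma dimc_ge1 : 1 <= dimc. Proof. by rewrite /dimc lerDr. Qed.

Lemma dimc_gt0 : 0 < dimc. Proof. exact: lt_le_trans ltr01 dimc_ge1. Qed.

Lemma enorm_le x : enorm x <= dimc * `|x|.
Proof.
apply: le_trans (enorm_norm1 _) _; apply: le_trans (norm1_norm _) _.
by rewrite ler_wpM2r // /dimc lerDl.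
Qed.

Lemma bump_one x0 s x : 0 < s -> dimc * (s * `|x - x0|) < 1 -> bump x0 s x = 1.
Proof.
move=> s0 H; rewrite bumpE; apply: chi_1; apply: le_lt_trans (enorm_le _) _.
by rewrite normrZ gtr0_norm.
Qed.

Lemma bump_zero x0 s x : 0 < s -> 2 <= s * `|x - x0| -> bump x0 s x = 0.
Proof.
move=> s0 H; rewrite bumpE; apply: supp_out => /chi_supp; apply/negP; rewrite -leNgt.
apply: le_trans H _; apply: le_trans (norm_le_enorm _).
by rewrite normrZ gtr0_norm.
Qed.

Lemma ctame_bump x0 s : ctame (bump x0 s).
Proof.
have [tr ti] := ctame_test chi_test; split.
  by have [] := pdw_scale (- (s *: x0)) s tr.
by have [] := pdw_scale (- (s *: x0)) s ti.
Qed.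

Lemma ln_large (r : R) : 0 < r -> exists2 e0, 0 < e0 < 1 &
  forall e, 0 < e < e0 -> 2 / `|ln e| < r.
Proof.
move=> r0; exists (expR (- (2 / r))).
  by rewrite expR_gt0 /= -expR0 ltr_expR oppr_lt0 divr_gt0.
move=> e /andP[e0 ee].
have le0 : ln e < - (2 / r) by rewrite -ltr_expR lnK.
have l0 : ln e < 0 by apply: lt_trans le0 _; rewrite oppr_lt0 divr_gt0.
rewrite ltr0_norm // ltr_pdivrMr ?oppr_gt0 // mulrC -ltr_pdivrMr //.
by rewrite ltrNr.
Qed.

Lemma kappa_one x0 (r : R) : 0 < r -> ball x0 (4 * r) `<=` Omega ->
  exists2 e0, 0 < e0 < 1 & forall e y, 0 < e < e0 -> `|y - x0| < 3 * r -> kappa e y = 1.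
Proof.
move=> r0 HO.
(* b exceeds the Euclidean norm of every y considered, so e < 1/b puts y in the ball of radius 1/e;
   e < r keeps it at distance at least e from the complement, as 4 r - 3 r = r. *)
pose b := dimc * (`|x0| + 3 * r) + 1.
have b0 : 0 < b by rewrite ltr_pwDr // mulr_ge0 ?(ltW dimc_gt0) // addr_ge0 // mulr_ge0 // ltW.
exists (Num.min (2^-1) (Num.min r b^-1)).
  rewrite !lt_min invr_gt0 ltr0n r0 invr_gt0 b0 /= gt_min.
  by rewrite invf_lt1 ?ltr1n ?ltr0n.
move=> e y /andP[e0]; rewrite !lt_min => /andP[e2 /andP[er eb]] yr.
apply: kappa_1; first by rewrite e0 ltW // (lt_trans e2) // invf_lt1 ?ltr1n ?ltr0n.
split.
- apply: HO; rewrite -ball_normE /= distrC; apply: lt_trans yr _.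
  by rewrite ltr_pM2r // ltr_nat.
- apply: le_ereal_inf_tmp => _ [z Oz <-]; rewrite lee_fin.
  apply: le_trans (norm_le_enorm _); apply: le_trans (ltW er) _.
  have zr : 4 * r <= `|z - x0|.
    by rewrite leNgt; apply/negP => H; apply: Oz; apply: HO; rewrite -ball_normE /= distrC.
  have := ler_normD (z - y) (y - x0); rewrite addrA subrK => H.
  rewrite distrC; move: H zr yr; move: (`|z - x0|) (`|z - y|) (`|y - x0|) => p1 p2 p3.
  lra.
- have ey : enorm y < b.
    apply: le_lt_trans (enorm_le _) _; rewrite /b (le_lt_trans (y := dimc * (`|x0| + 3 * r))) //.
      rewrite ler_wpM2l ?(ltW dimc_gt0) //.
      have := ler_normD (y - x0) x0; rewrite subrK addrC => /le_trans; apply.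
      by rewrite lerD2l ltW.
    by rewrite ltrDl.
  by apply: lt_trans ey _; rewrite -[b]invrK ltf_pV2 ?posrE ?invr_gt0.
Qed.

Definition small_kernel (x0 : E) (r : R) (U : set E) e : E -> E -> C :=
  restr U (fun x y => bump x0 (2 / r) x * (theta rho chi e (x - y) * kappa e y)).

Lemma psi_CinfV e : 0 < e <= 1 ->
  lcs_pts (CinfV Omega (Dtest Omega)) (psi Omega rho chi kappa e).
Proof.
move=> e01; have [_ ck kO] := kappa_test e01.
(* psi_e is the kernel of [ctame_kernel] with the constant 1 as cut-off in x. *)
have t1 : ctame (fun _ : E => 1 : C).
  have H (c : R) : tame (cst c : E -> R).
    have [s E1] := @smooth_cst _ n setT c openT; split => // k; exists `|c| => w _ x.
    by rewrite E1 //; case: w => // *; rewrite normr0.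
  by split; exact: H.
have [Phi tPhi PhiE] := ctame_kernel 0 0 t1
  (ctame_theta (ctame_schwartz rho_schwartz) (ctame_test chi_test) e) (ctame_kappa e01).
rewrite (_ : psi _ _ _ _ _ = restr Omega (fun x y => Phi (row_mx x y))); last first.
  by rewrite /psi; congr restr; apply/funext => x; apply/funext => y; rewrite PhiE mul1r.
apply: (@kernel_CinfV _ _ (supp (kappa e))) => //.
- exact: closed_closure.
- exact: test_lcs_Dtest.
- by move=> x y /supp_out k0; rewrite PhiE k0 !mulr0.
Qed.

Lemma open_ball2 (U : set E) x0 : open U -> U x0 ->
  exists2 rad : R, 0 < rad & ball x0 (2 * rad) `<=` U.
Proof.
move=> oU Ux; have /nbhs_ballP[d d0 dU] := open_nbhs_nbhs (conj oU Ux).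
by exists (d / 2); [exact: divr_gt0|rewrite mulrC divfK].
Qed.

Section Ball.
Variables (x0 : E) (U : set E) (rad : R).
Hypotheses (UO : U `<=` Omega) (rad0 : 0 < rad) (ballU : ball x0 (2 * rad) `<=` U).

(* beta = 1 on V and beta = 0 outside the ball of radius r; theta_e(x - y) = 0 for
   |x - y| >= r when e is small, whence the radius of L. *)
Let r := rad / (4 * dimc).
(** The factors [dimc] pass from the maximum norm to the Euclidean norm used by chi: dimc (2 / r) r1
    = 1 makes beta equal to 1 on V, and dimc (2 / rad) (2 r) = 1 does the same for the cut-off in
    [norm_delta_small]. *)
Let r1 := r / (2 * dimc).
Let V : set E := ball x0 r1.
Let K : set E := [set x | `|x - x0| <= r1 / 2].
Let L : set E := [set x | `|x - x0| <= 2 * r].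
Local Notation phi := (small_kernel x0 r U).

Let r0 : 0 < r. Proof. by rewrite divr_gt0 // mulr_gt0 // dimc_gt0. Qed.
Let sr0 : 0 < 2 / r. Proof. by apply: divr_gt0 => //; exact: r0. Qed.
Let r10 : 0 < r1. Proof. by rewrite divr_gt0 // mulr_gt0 // dimc_gt0. Qed.
Let r1r : r1 <= r / 2.
Proof.
rewrite ler_pM2l // lef_pV2 ?posrE ?mulr_gt0 ?dimc_gt0 //.
by rewrite ler_peMr // dimc_ge1.
Qed.
Let rrad : 4 * r <= rad.
Proof.
rewrite /r -[leRHS]mulr1 mulrCA ler_pM2l // invfM mulrA divff ?mul1r //.
by rewrite invf_le1 ?dimc_gt0 // dimc_ge1.
Qed.

Lemma ball_rad (s : R) : s <= 2 * rad -> forall y, `|y - x0| < s -> U y.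
Proof.
move=> sr y ys; apply: ballU; rewrite -ball_normE /= distrC.
exact: lt_le_trans sr.
Qed.

Lemma V_open : open V. Proof. exact: ball_open. Qed.

Lemma VP y : V y <-> `|y - x0| < r1.
Proof. by rewrite /V -ball_normE /= distrC. Qed.

Lemma KV : K `<=` V.
Proof.
by move=> y Ky; apply/VP; apply: le_lt_trans Ky _; rewrite ltr_pdivrMr // ltr_pMr // ltr1n.
Qed.

Lemma VU : V `<=` U.
Proof.
move=> y /VP yr; apply: (ball_rad (lexx _)); apply: lt_le_trans yr _.
move: r1r rrad rad0 r0; lra.
Qed.

Lemma csub_cball (s : R) : s < 2 * rad -> csub [set x | `|x - x0| <= s] U.
Proof.
move=> sr; split; first exact: compact_cball.
apply: (@subset_trans _ (ball x0 (2 * rad))).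
  by move=> y /= ys; rewrite -ball_normE /= distrC; exact: le_lt_trans sr.
by rewrite -open_subsetE //; exact: ball_open.
Qed.

Lemma csubK : csub K U.
Proof. apply: csub_cball; move: r1r rrad rad0 r0; lra. Qed.

Lemma csubL : csub L U.
Proof. apply: csub_cball; move: r1r rrad rad0 r0; lra. Qed.

Lemma nbhsK : nbhs x0 K.
Proof.
apply/nbhs_ballP; exists (r1 / 2); first by rewrite /= divr_gt0.
by move=> y; rewrite -ball_normE /= distrC => /ltW.
Qed.

Lemma bump_V x : V x -> bump x0 (2 / r) x = 1.
Proof.
move=> /VP xr; apply: bump_one => //.
rewrite mulrA -ltr_pdivlMl ?mulr1; last by apply: mulr_gt0 => //; exact: dimc_gt0.
apply: lt_le_trans xr _; by rewrite invfM invf_div mulrC -mulrA -invfM.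
Qed.

Lemma kernel_Phi e : 0 < e <= 1 -> exists2 Phi : 'rV[R]_(n + n) -> C, ctame Phi &
  (forall x y, Phi (row_mx x y) = bump x0 (2 / r) x * (theta rho chi e (x - y) * kappa e y)).
Proof.
move=> e01; have [Phi tPhi PhiE] := ctame_kernel (2 / r) (- ((2 / r) *: x0)) (ctame_test chi_test)
  (ctame_theta (ctame_schwartz rho_schwartz) (ctame_test chi_test) e) (ctame_kappa e01).
by exists Phi.
Qed.

(** The sheaf property concerns kernels with values in D(Omega), the estimates kernels with values
    in D_L; phi_e has to be placed in both spaces. *)
Lemma phi_Dtest e : 0 < e <= 1 -> lcs_pts (CinfV U (Dtest Omega)) (phi e).
Proof.
move=> e01; have [_ ck kO] := kappa_test e01; have [Phi tPhi PhiE] := kernel_Phi e01.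
rewrite (_ : phi e = restr U (fun x y => Phi (row_mx x y))); last first.
  by congr restr; apply/funext => x; apply/funext => y; rewrite PhiE.
apply: (@kernel_CinfV _ _ (supp (kappa e))) => //.
- exact: closed_closure.
- exact: test_lcs_Dtest.
- by move=> x y /supp_out k0; rewrite PhiE k0 !mulr0.
Qed.

Lemma phi_Dsupp e : 0 < e < 1 -> 2 / `|ln e| < r -> lcs_pts (CinfV U (Dsupp L)) (phi e).
Proof.
move=> e01 er; have e01' : 0 < e <= 1 by have /andP[-> /ltW] := e01.
have [Phi tPhi PhiE] := kernel_Phi e01'.
rewrite (_ : phi e = restr U (fun x y => Phi (row_mx x y))); last first.
  by congr restr; apply/funext => x; apply/funext => y; rewrite PhiE.
have cL : closed L by exact: closed_cball.
apply: (@kernel_CinfV _ _ L) => //; first exact: test_lcs_Dsupp.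
move=> x y /negP; rewrite -ltNge => yr; rewrite PhiE.
have [xr|xr] := leP r `|x - x0|.
  rewrite bump_zero ?mul0r //.
  by rewrite mulrAC ler_pdivlMr // ler_pM2l.
rewrite (@theta_supp _ _ rho chi) // ?mul0r ?mulr0 //; apply: le_trans (ltW er) _.
have := ler_normD (y - x) (x - x0); rewrite addrA subrK => H.
rewrite distrC; move: H xr yr; move: (`|y - x0|) (`|y - x|) (`|x - x0|) => p1 p2 p3.
lra.
Qed.

Lemma psi_phi e : restr V (psi Omega rho chi kappa e) = restr V (phi e).
Proof.
apply/funext => x; rewrite /restr; have [Vx|Vx] := pselect (V x); last first.
  by rewrite !patchN // notin_setE.
rewrite !patchT ?inE // /psi /small_kernel /restr.
rewrite !patchT ?inE; [|exact: VU|exact/UO/VU].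
by apply/funext => y; rewrite bump_V // mul1r.
Qed.

(** For z in V and small e both cut-offs are inactive: beta is 1 on V, kappa_e is 1 for |y - x0| < 3
    r, and beyond that theta_e (z - y) vanishes, z being within r / 2 of x0. *)
Lemma phiE : exists2 e0, 0 < e0 < 1 & forall e, 0 < e < e0 ->
  2 / `|ln e| < r /\ forall z y, V z -> phi e z y = theta rho chi e (z - y).
Proof.
have HO : ball x0 (4 * r) `<=` Omega.
  move=> y; rewrite -ball_normE /= distrC => yr; apply: UO; apply: (ball_rad (lexx _)).
  apply: lt_le_trans yr _; move: rrad rad0; lra.
have [e1 /andP[e10 e11] H1] := ln_large r0; have [e2 /andP[e20 e21] H2] := kappa_one r0 HO.
exists (Num.min e1 e2); first by rewrite lt_min e10 e20 gt_min e11.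
move=> e /andP[e0]; rewrite lt_min => /andP[ee1 ee2].
have l1 : 2 / `|ln e| < r by apply: H1; rewrite e0.
split => // z y Vz; rewrite /small_kernel /restr patchT ?inE; last exact: VU.
rewrite bump_V // mul1r.
have [yr|yr] := ltP `|y - x0| (3 * r); first by rewrite H2 ?mulr1 // e0.
rewrite (@theta_supp _ _ rho chi) // ?mul0r //.
  by rewrite e0 (lt_trans ee1).
apply: le_trans (ltW l1) _; have /VP zr := Vz.
have := ler_normD (y - z) (z - x0); rewrite addrA subrK => H.
rewrite distrC; move: H zr yr r1r r0; move: (`|y - x0|) (`|y - z|) (`|z - x0|) => p1 p2 p3.
lra.
Qed.

Lemma norm_cl_small c l : exists N : nat, exists2 e0, 0 < e0 < 1 & forall e, 0 < e < e0 ->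
  norm_cl K c L l (phi e) <= e ^- N.
Proof.
have tt := ctame_theta (ctame_schwartz rho_schwartz) (ctame_test chi_test).
have [D D0 HD] := theta_bnd (ctame_schwartz rho_schwartz) (ctame_test chi_test) (c + l).
have [e1 /andP[e10 e11] H1] := phiE.
set N := (n + _)%N in HD.
have P : 0 < 2 * D + 1 by rewrite ltr_pwDr // mulr_ge0.
(* The additional power of 1/e absorbs the constant, as 2 D + 1 <= 1/e. *)
exists N.+1, (Num.min e1 (2 * D + 1)^-1).
  by rewrite lt_min e10 invr_gt0 P /= gt_min e11.
move=> e /andP[e0]; rewrite lt_min => /andP[ee1 eD].
have [|l1 pE] := H1 e; first by rewrite e0.
have e1' : e <= 1 by rewrite ltW // (lt_trans ee1).
have [|br bi] := HD e; first by rewrite e0.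
apply: sup_le_ge0; first by rewrite invr_ge0 exprn_ge0 // ltW.
move=> s [x [y [a [b [Kx Ly ac bl ->]]]]].
rewrite (@pderiv_open _ _ V a _ (fun z => pderiv b (fun y => theta rho chi e (z - y)) y)) //.
- apply: le_trans (pderiv_mixed_le x y (tt e) br bi ac bl) _.
  rewrite -exprVn exprS mulrA ler_wpM2r ?exprn_ge0 ?invr_ge0 ?(ltW e0) //.
  apply: (@le_trans _ _ (2 * D + 1)); first by rewrite lerDl.
  by rewrite -[leLHS]invrK lef_pV2 ?posrE ?invr_gt0 // ltW.
- exact: V_open.
- move=> z Vz; by congr pderiv; apply/funext => y'; exact: pE.
- exact: KV.
Qed.

Lemma norm_delta_small c (B : set (E -> C)) N : bounded_Cinf Omega B ->
  exists2 e0, 0 < e0 < 1 & forall e, 0 < e < e0 -> norm_delta_B K c B (phi e) <= e ^+ N.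
Proof.
move=> [BO bB].
have tt := ctame_theta (ctame_schwartz rho_schwartz) (ctame_test chi_test).
(* theta_e(x - .) only sees f near x0, so f can be multiplied by a cut-off to
   have bounded derivatives on the whole space. *)
pose S : set E := [set y | `|y - x0| <= rad].
have cS : compact S by exact: compact_cball.
have SO : S `<=` Omega.
  move=> y /= yr; apply: UO; apply: (ball_rad (lexx _)); apply: le_lt_trans yr _.
  by rewrite ltr_pMl // ltr1n.
(* c orders are moved onto f and N + 1 go into Taylor's formula. The resulting e^(N+1) has one power
   more than the target, which absorbs [D * M3]. *)
pose k := (N.+1 + c)%N.
have [M HM] : exists M, forall f, B f -> snorm S k f <= M.
  by apply: bB; exists S, k.
have tb := ctame_bump x0 (2 / rad).
have bi0 : ipart (bump x0 (2 / rad)) = cst 0.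
  by apply/funext => y; rewrite /bump /ipart; have [] := chi_parts chi_01 (- ((2 / rad) *: x0) + (2 / rad) *: y).
have b0 y : ~ S y -> bump x0 (2 / rad) y = 0.
  move=> /negP; rewrite -ltNge => yr; apply: bump_zero; first by rewrite divr_gt0.
  by rewrite mulrAC ler_pdivlMr // ler_pM2l // ltW.
have b1 y : `|y - x0| < 2 * r -> bump x0 (2 / rad) y = 1.
  move=> yr; apply: bump_one; first by rewrite divr_gt0.
  rewrite mulrA -ltr_pdivlMl ?mulr1; last by rewrite mulr_gt0 ?dimc_gt0 ?divr_gt0.
  apply: lt_le_trans yr _; rewrite /r -subr_ge0 (_ : _ - _ = 0) //.
  by have := lt0r_neq0 dimc_gt0; have := lt0r_neq0 rad0 => ? ?; field; apply/andP; split.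
have [M2 HM2] := tb.1.2 k.
have [D D0 HD] := theta_delta rho_schwartz rho_int rho_moments chi_test chi_01 chi_1 chi_supp c N.
have [e1 /andP[e10 e11] H1] := phiE.
pose M3 := 2 ^+ k * (`|M| * M2); have M20 := bnd_ge0 HM2.
have M30 : 0 <= M3 by rewrite mulr_ge0 ?exprn_ge0 // mulr_ge0.
have P : 0 < D * M3 + 1 by rewrite ltr_pwDr // mulr_ge0.
exists (Num.min e1 (D * M3 + 1)^-1).
  by rewrite lt_min e10 invr_gt0 P /= gt_min e11.
move=> e /andP[e0]; rewrite lt_min => /andP[ee1 eD].
have [|l1 pE] := H1 e; first by rewrite e0.
have e1' : e < 1 by rewrite (lt_trans ee1).
apply: sup_le_ge0; first by rewrite exprn_ge0 // ltW.
move=> s [x [a [f [Kx ac Bf ->]]]].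
have [sf f0] := BO f Bf; have [sfr sfi] := (smooth_onP Omega f).1 sf.
pose g : E -> C := fun y => f y * bump x0 (2 / rad) y.
have gr : rpart g = rpart f * rpart (bump x0 (2 / rad)).
  apply/funext => y; have := congr1 (fun h => h y) bi0; rewrite /g /rpart /ipart fctE.
  move=> h; rewrite -[RHS]/(complex.Re (f y) * complex.Re (bump x0 (2 / rad) y)).
  by move: (f y) (bump _ _ y) h; rewrite /Rcomplex => -[p q] [p' q'] /= ->; rewrite mulr0 subr0.
have gi : ipart g = ipart f * rpart (bump x0 (2 / rad)).
  apply/funext => y; have := congr1 (fun h => h y) bi0; rewrite /g /rpart /ipart fctE.
  move=> h; rewrite -[RHS]/(complex.Im (f y) * complex.Re (bump x0 (2 / rad) y)).
  by move: (f y) (bump _ _ y) h; rewrite /Rcomplex => -[p q] [p' q'] /= ->; rewrite mulr0 add0r.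
have rb0 y : ~ S y -> rpart (bump x0 (2 / rad)) y = 0 by move=> /b0; rewrite /rpart => ->.
have [tgr bgr] := cutoffM Omega_open cS SO sfr tb.1 rb0; rewrite -gr in tgr bgr.
have [tgi bgi] := cutoffM Omega_open cS SO sfi tb.1 rb0; rewrite -gi in tgi bgi.
have bf w y : (size w <= k)%N -> S y ->
    `|pdw w (rpart f) y| <= `|M| /\ `|pdw w (ipart f) y| <= `|M|.
  move=> wk Sy; have [h1 h2] := pdw_le_pderiv w Omega_open sf (SO y Sy).
  have h3 : `|pderiv (mi_count w) f y| <= `|M|.
    apply: le_trans (ler_norm M); apply: le_trans (HM f Bf).
    by apply: (le_snorm sf cS SO Sy); rewrite mi_deg_count.
  by split; [exact: le_trans h1 h3|exact: le_trans h2 h3].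
have bg1 : bnd k M3 (rpart g) by apply: bgr => // w wk y Sy; have [] := bf w y wk Sy.
have bg2 : bnd k M3 (ipart g) by apply: bgi => // w wk y Sy; have [] := bf w y wk Sy.
have g0 y : ~ S y -> g y = 0 by move=> /b0 h; rewrite /g h mulr0.
have Vg y : V y -> f y = g y.
  move=> /VP yr; rewrite /g b1 ?mulr1 //; apply: lt_le_trans yr _.
  by move: r1r r0; lra.
have xE y : xderiv a (phi e) x y = pderiv a (theta rho chi e) (x - y).
  rewrite -pderiv_translate //; apply: (@pderiv_open _ _ V).
  - exact: V_open.
  - by move=> z Vz; exact: pE.
  - exact: KV.
have -> : pderiv a f x = pderiv a g x.
  by apply: (@pderiv_open _ _ V) => //; [exact: V_open|exact: KV].
have -> : cint (fun y => f y * xderiv a (phi e) x y) =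
          cint (fun y => g y * pderiv a (theta rho chi e) (x - y)).
  congr cint; apply/funext => y; rewrite xE.
  (* f and g agree within 2 r of x0; elsewhere x - y lies outside the closed set Z that carries
     theta_e, where its derivatives vanish too. *)
  have [yr|yr] := ltP `|y - x0| (2 * r); first by rewrite /g b1 // mulr1.
  rewrite (_ : pderiv a _ _ = 0) ?mulr0 //.
  pose Z : set E := [set z | `|z - 0| <= 2 / `|ln e|].
  have cZ : closed Z by exact: closed_cball.
  have tZ z : ~ Z z -> theta rho chi e z = 0.
    move=> /negP; rewrite subr0 -ltNge => /ltW; apply: theta_supp => //.
    by rewrite e0.
  have nZ : ~ Z (x - y).
    apply/negP; rewrite /Z /= subr0 -ltNge; apply: lt_le_trans l1 _.
    have := KV Kx => /VP xr.
    have := ler_normD (y - x) (x - x0); rewrite addrA subrK => H.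
    rewrite distrC; move: H xr yr r1r r0; move: (`|y - x0|) (`|y - x|) (`|x - x0|) => p1 p2 p3.
    lra.
  apply: Rcomplex_eq; rewrite ?Re_pderiv ?Im_pderiv.
    by apply: (pdw_supp _ cZ) => // z /tZ; rewrite /rpart => ->.
  by apply: (pdw_supp _ cZ) => // z /tZ; rewrite /ipart => ->.
apply: le_trans (HD e g S M3 a x _ (conj tgr tgi) cS g0 bg1 bg2 ac) _.
  by rewrite e0.
rewrite exprS mulrA mulrA -[leRHS]mul1r ler_wpM2r ?exprn_ge0 ?(ltW e0) //.
apply: (@le_trans _ _ ((D * M3 + 1) * e)); first by rewrite mulrA ler_wpM2r ?(ltW e0) // lerDl.
by rewrite -ler_pdivlMl // mulr1 ltW.
Qed.

Lemma local_pderiv_le (T : opfamily R n) e m a x : is_basic Omega T -> open U -> 0 < e <= 1 ->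
  K x -> (mi_deg a <= m)%N ->
  `|pderiv a (to_special Omega rho chi kappa T e) x| <= snorm K m (T U (phi e)).
Proof.
move=> HT oU e01 Kx am.
have [_ _ shO] := HT Omega Omega_open (@subset_refl _ _).
have [TU _ shU] := HT U oU UO.
have TE : restr V (to_special Omega rho chi kappa T e) = restr V (T U (phi e)).
  have VO := subset_trans VU UO.
  by rewrite /to_special (shO _ _ V_open VO (psi_CinfV e01)) psi_phi (shU _ _ V_open VU (phi_Dtest e01)).
rewrite (@pderiv_open _ _ V a _ (T U (phi e))).
- have [sT _] := TU _ (phi_Dtest e01).
  by apply: (le_snorm sT csubK.1 _ Kx) => //; apply: subset_trans VU; exact: KV.
- exact: V_open.
- by move=> y Vy; have := congr1 (fun h => h y) TE; rewrite /restr !patchT ?inE.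
- exact: KV.
Qed.

Lemma local_moderate (T : opfamily R n) m : is_basic Omega T -> open U ->
  (forall K L, csub K U -> csub L U -> forall m k : nat,
    exists (c l : nat) (lam : mpoly.mpoly k.+1 R), nneg_coeffs lam /\
    forall phi : 'I_k.+1 -> E -> E -> C,
      (forall i, lcs_pts (CinfV U (Dsupp L)) (phi i)) ->
      snorm K m (dT T U phi) <= mpoly.meval (fun i => norm_cl K c L l (phi i)) lam) ->
  exists N : nat, exists2 e0, 0 < e0 <= 1 & forall e x a, 0 < e < e0 -> K x -> (mi_deg a <= m)%N ->
    `|pderiv a (to_special Omega rho chi kappa T e) x| <= e ^- N.
Proof.
move=> HT oU H; have [c [l [lam [lam0 Hlam]]]] := H K L csubK csubL m 0%N.
have [S [D [S0 HS]]] := meval_le lam0.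
have [N [e1 /andP[e10 e11] H1]] := norm_cl_small c l.
have [e2 /andP[e20 e21] H2] := ln_large r0.
have P : 0 < S + 1 by rewrite ltr_pwDr.
(* The polynomial is at most S (e^-N)^D; one more power of 1/e absorbs S. *)
exists (N * D).+1, (Num.min (Num.min e1 e2) (S + 1)^-1).
  by rewrite !lt_min e10 e20 invr_gt0 P /= !ge_min (ltW e11).
move=> e x a /andP[e0]; rewrite !lt_min => /andP[/andP[ee1 ee2] eS] Kx am.
have e1' : e < 1 by exact: lt_trans e11.
apply: le_trans (local_pderiv_le HT oU _ Kx am) _; first by rewrite e0 ltW.
(* For k = 0 the list of directions is empty and [dT] is T U phi_e itself. *)
have := Hlam (fun=> phi e); rewrite /dT /= (_ : enum 'I_0 = [::]) /=; last first.
  by apply: size0nil; rewrite size_enum_ord.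
move=> /(_ _)/le_trans; apply.
  by move=> _; apply: phi_Dsupp; [rewrite e0|apply: H2; rewrite e0].
apply: le_trans (HS (e ^- N) _ _ _) _.
- by rewrite -exprVn exprn_ege1 // invf_ge1 // ltW.
- move=> _; rewrite H1 ?e0 // andbT; apply: sup_ge0 => s [y [z [b [b' [_ _ _ _ ->]]]]].
  exact: normr_ge0.
rewrite -exprVn -exprM -exprVn exprS ler_wpM2r ?exprn_ge0 ?invr_ge0 ?(ltW e0) //.
apply: (@le_trans _ _ (S + 1)); first by rewrite lerDl.
by rewrite -[leLHS]invrK lef_pV2 ?posrE ?invr_gt0 // ltW.
Qed.

Lemma local_negligible (T : opfamily R n) m N : is_basic Omega T -> open U ->
  (forall K L, csub K U -> csub L U -> forall m k : nat,
    exists (c l : nat) (lam : mpoly.mpoly (k.+1 + k.+1) R) (B : set (E -> C)),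
    [/\ in_I lam, bounded_Cinf Omega B &
    forall phi : 'I_k.+1 -> E -> E -> C,
      (forall i, lcs_pts (CinfV U (Dsupp L)) (phi i)) ->
      snorm K m (dT T U phi) <=
        mpoly.meval (yz_point (fun i => norm_cl K c L l (phi i))
                          (fun i => if i == ord0 then norm_delta_B K c B (phi i)
                                    else norm_B K c B (phi i))) lam]) ->
  exists2 e0, 0 < e0 <= 1 & forall e x a, 0 < e < e0 -> K x -> (mi_deg a <= m)%N ->
    `|pderiv a (to_special Omega rho chi kappa T e) x| <= e ^+ N.
Proof.
move=> HT oU H; have [c [l [lam [B [lamI bB Hlam]]]]] := H K L csubK csubL m 0%N.
have [S [D [S0 HS]]] := meval_in_I_le lamI.
have [M [e1 /andP[e10 e11] H1]] := norm_cl_small c l.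
have [e2 /andP[e20 e21] H2] := ln_large r0.
(* e^(M D) compensates the growth (e^-M)^D of the [norm_cl] variables, e^N is the target, and the
   last factor e absorbs S. *)
have [e3 /andP[e30 e31] H3] := norm_delta_small c (M * D + N.+1) bB.
have P : 0 < S + 1 by rewrite ltr_pwDr.
exists (Num.min (Num.min e1 (Num.min e2 e3)) (S + 1)^-1).
  by rewrite !lt_min e10 e20 e30 invr_gt0 P /= !ge_min (ltW e11).
move=> e x a /andP[e0]; rewrite !lt_min => /andP[/andP[ee1 /andP[ee2 ee3]] eS] Kx am.
have e1' : e < 1 by exact: lt_trans e11.
apply: le_trans (local_pderiv_le HT oU _ Kx am) _; first by rewrite e0 ltW.
have := Hlam (fun=> phi e); rewrite /dT /= (_ : enum 'I_0 = [::]) /=; last first.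
  by apply: size0nil; rewrite size_enum_ord.
move=> /(_ _)/le_trans; apply.
  by move=> _; apply: phi_Dsupp; [rewrite e0|apply: H2; rewrite e0].
apply: le_trans (HS (e ^- M) (e ^+ (M * D + N.+1)) _ _ _ _ _ _) _.
- by rewrite -exprVn exprn_ege1 // invf_ge1 // ltW.
- by rewrite exprn_ile1 // ltW.
- move=> _; rewrite H1 ?e0 // andbT; apply: sup_ge0 => s [y [z [b [b' [_ _ _ _ ->]]]]].
  exact: normr_ge0.
- move=> i; rewrite ord1 eqxx H3 ?e0 // andbT.
  by apply: sup_ge0 => s [y [b [f [_ _ _ ->]]]]; exact: normr_ge0.
rewrite exprD -exprVn -exprM exprVn mulKf ?expf_neq0 ?gt_eqF //.
rewrite exprS mulrA -[leRHS]mul1r ler_wpM2r ?exprn_ge0 ?(ltW e0) //.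
apply: (@le_trans _ _ ((S + 1) * e)); first by rewrite ler_wpM2r ?(ltW e0) // lerDl.
by rewrite -ler_pdivlMl // mulr1 ltW.
Qed.

End Ball.

Lemma moderate_at (T : opfamily R n) m x0 : is_moderate Omega T -> Omega x0 ->
  exists2 K, nbhs x0 K & exists N : nat, exists2 e0, 0 < e0 <= 1 &
  forall e x a, 0 < e < e0 -> K x -> (mi_deg a <= m)%N ->
    `|pderiv a (to_special Omega rho chi kappa T e) x| <= e ^- N.
Proof.
move=> [HT HM] Ox; have [U [oU Ux UO] H] := HM x0 Ox.
have [rad rad0 ballU] := open_ball2 oU Ux.
exists [set x | `|x - x0| <= rad / (4 * dimc) / (2 * dimc) / 2]; first exact: nbhsK.
exact: (local_moderate UO rad0 ballU m HT oU H).
Qed.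

Lemma negligible_at (T : opfamily R n) m N x0 : is_negligible Omega T -> Omega x0 ->
  exists2 K, nbhs x0 K & exists2 e0, 0 < e0 <= 1 &
  forall e x a, 0 < e < e0 -> K x -> (mi_deg a <= m)%N ->
    `|pderiv a (to_special Omega rho chi kappa T e) x| <= e ^+ N.
Proof.
move=> [HT HM] Ox; have [U [oU Ux UO] H] := HM x0 Ox.
have [rad rad0 ballU] := open_ball2 oU Ux.
exists [set x | `|x - x0| <= rad / (4 * dimc) / (2 * dimc) / 2]; first exact: nbhsK.
exact: (local_negligible UO rad0 ballU m N HT oU H).
Qed.

End Localization.

(** * Passage to compact sets by covering *)

Section Globalization.
Context {R : realType} {n : nat}.
Local Notation E := 'rV[R]_n.
Local Notation C := (Rcomplex R).
Implicit Types (v : R -> E -> C) (K : set E) (e : R).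

(** The exponent N varies with the point. Compactness is therefore applied along the product of the
    filters e -> 0+ and k -> oo to the bound e^-k, which weakens as k grows since e <= 1; one
    exponent then serves all of K. *)
Lemma compact_moderate v K m : compact K ->
  (forall x0, K x0 -> exists2 W, nbhs x0 W & exists N : nat, exists2 e0, 0 < e0 <= 1 &
    forall e x a, 0 < e < e0 -> W x -> (mi_deg a <= m)%N -> `|pderiv a (v e) x| <= e ^- N) ->
  exists2 N : nat, (0 < N)%N &
    (fun e => snorm K m (v e)) =O_ (0^'+) (fun e => e ^- N).
Proof.
move=> /compact_near_coveringP cK H.
pose P (i : R * nat) x := forall a, (mi_deg a <= m)%N ->
  `|pderiv a (v i.1) x| <= i.1 ^- i.2.
have [|[A B] /= [A0 [k _ kB]] AB] := cK _ (filter_prod (0^'+ : set_system R) \oo) P _.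
  move=> x0 Kx0; have [W nW [N [e0 /andP[e00 e01] HW]]] := H x0 Kx0.
  exists (W, [set i : R * nat | 0 < i.1 < e0 /\ (N <= i.2)%N]) => /=.
    split=> //; exists ([set e : R | 0 < e < e0], [set k | (N <= k)%N]) => /=.
      split; last by exists N.
      near=> e => /=; apply/andP; split => //; near: e; exact: nbhs_right_lt.
    by move=> [e k] [].
  move=> [x [e k]] /= [Wx [/andP[e1 e2] Nk]] a am; apply: le_trans (HW e x a _ Wx am) _.
    by rewrite e1.
  rewrite lef_pV2 ?posrE ?exprn_gt0 // ler_wiXn2l ?(ltW e1) //.
  exact: le_trans (ltW e2) _.
exists k.+1 => //; apply/eqO_exP; exists 1 => //.
near=> e; have Ae : A e by near: e.
have e0 : 0 < e by near: e; exact: nbhs_right_gt.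
rewrite mul1r ger0_norm ?snorm_ge0 // [leRHS]ger0_norm ?invr_ge0 ?exprn_ge0 ?(ltW e0) //.
apply: snorm_le => [|x a Kx am]; first by rewrite invr_ge0 exprn_ge0 // ltW.
by apply: (AB (e, k.+1) (conj Ae _) x Kx a am); exact/kB/leqnSn.
Unshelve. all: by end_near.
Qed.

(** N is given in advance here, so the covering argument runs along e -> 0+ alone. *)
Lemma compact_negligible v K m N : compact K ->
  (forall x0, K x0 -> exists2 W, nbhs x0 W & exists2 e0, 0 < e0 <= 1 &
    forall e x a, 0 < e < e0 -> W x -> (mi_deg a <= m)%N -> `|pderiv a (v e) x| <= e ^+ N) ->
  (fun e => snorm K m (v e)) =O_ (0^'+) (fun e => e ^+ N).
Proof.
move=> /compact_near_coveringP cK H.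
pose P e x := forall a, (mi_deg a <= m)%N -> `|pderiv a (v e) x| <= e ^+ N.
have nA := cK _ (0^'+ : set_system R) P _.
apply/eqO_exP; exists 1 => //; near=> e.
have e0 : 0 < e by near: e; exact: nbhs_right_gt.
rewrite mul1r ger0_norm ?snorm_ge0 // [leRHS]ger0_norm ?exprn_ge0 ?(ltW e0) //.
have KP : K `<=` P e.
  near: e; apply: nA => x0 Kx0; have [W nW [e0 /andP[e00 e01] HW]] := H x0 Kx0.
  exists (W, [set e : R | 0 < e < e0]) => /=.
    by split=> //; near=> e => /=; apply/andP; split => //; near: e; exact: nbhs_right_lt.
  by move=> [x e] /= [Wx ee] a am; exact: HW.
apply: snorm_le => [|x a Kx am]; first by rewrite exprn_ge0 // ltW.
exact: KP.
Unshelve. all: by end_near.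
Qed.

End Globalization.

Theorem proposition32 (R : realType) (n : nat) (Omega : set 'rV[R]_n)
    (rho chi : 'rV[R]_n -> Rcomplex R) (kappa : R -> 'rV[R]_n -> Rcomplex R)
    (Omega_open : open Omega)
    (rho_schwartz : schwartz rho)
    (rho_int : cint rho = 1)
    (rho_moments : forall a : {ffun 'I_n -> nat}, (0 < mi_deg a)%N ->
      cint (fun x => monomial a x *: rho x) = 0)
    (chi_test : lcs_pts (Dtest setT) chi)
    (chi_01 : forall y, 0 <= (chi y : R[i]) <= 1)
    (chi_1 : forall y, enorm y < 1 -> chi y = 1)
    (chi_supp : forall y, supp chi y -> enorm y < 2)
    (kappa_test : forall e : R, 0 < e <= 1 -> lcs_pts (Dtest Omega) (kappa e))
    (kappa_01 : forall e : R, 0 < e <= 1 -> forall y, 0 <= (kappa e y : R[i]) <= 1)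
    (kappa_1 : forall e : R, 0 < e <= 1 ->
      forall y, Keps Omega e y -> kappa e y = 1) :
  let s := to_special Omega rho chi kappa in
  [/\ forall T : opfamily R n, is_basic Omega T -> Es Omega (s T),
      forall u, is_distribution Omega u -> forall e : R, 0 < e <= 1 ->
        s (emb_dist u) e = emb_dist_s Omega rho chi kappa u e,
      forall f, lcs_pts (Cinf Omega) f -> forall e : R, 0 < e <= 1 ->
        s (emb_smooth f) e = emb_smooth_s f e,
      forall T : opfamily R n, is_moderate Omega T -> EsM Omega (s T)
    & forall T : opfamily R n, is_negligible Omega T -> Ns Omega (s T)].
Proof.
move=> s.
have psiC (e : R) (e01 : 0 < e <= 1) := psi_CinfV rho_schwartz chi_test kappa_test e01.
have sEs T : is_basic Omega T -> Es Omega (s T).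
  move=> HT e e01; have [TO _ _] := HT Omega Omega_open (@subset_refl _ _).
  exact: TO (psiC e e01).
(* This also closes the compatibility with distributions: both sides unfold to x |-> u (psi_e (x))
   on Omega. *)
split => //.
- move=> f [_ f0] e _; apply/funext => x; rewrite /s /to_special /emb_smooth /restr.
  have [Ox|Ox] := pselect (Omega x); first by rewrite patchT ?inE.
  (* Off Omega both sides are 0, f being represented by its extension by 0. *)
  by rewrite patchN ?notin_setE // /emb_smooth_s f0.
- move=> T HT; split; first exact: sEs HT.1.
  move=> K m [cK KO]; apply: compact_moderate => // x0 Kx0.
  apply: (moderate_at Omega_open rho_schwartz) => //.
  by apply: interior_subset; exact: KO.
- move=> T HT; split; first exact: sEs HT.1.
  move=> K m [cK KO] N _; apply: compact_negligible => // x0 Kx0.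
  apply: (negligible_at Omega_open rho_schwartz) => //.
  by apply: interior_subset; exact: KO.
Qed.
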